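(* The convolution $\circledast_+$ (defined in the context) defines a $\mathbb{C}$-bilinear product $SK\times SK\to SK$ with the following properties. For all $f,g,h\in SK$: (1) (Commutativity) $f\circledast_+ g=g\circledast_+ f$. (2) (Associativity) $(f\circledast_+ g)\circledast_+ h=f\circledast_+(g\circledast_+ h)$. (3) (Regularity) Suppose that for some $m,n\in\mathbb{N}$, $f$ is regular on $0<\operatorname{Im}(x)<m\operatorname{Im}(\tau)$ and $g$ is regular on $0<\operatorname{Im}(x)<n\operatorname{Im}(\tau)$. Then $f\circledast_+ g$ is regular on $0<\operatorname{Im}(x)<(m+n)\operatorname{Im}(\tau)$.
   Context: Fix $\tau\in\mathbb{C}$ with $\operatorname{Im}(\tau)>0$ and let $\Lambda=\mathbb{Z}+\tau\mathbb{Z}$. For a meromorphic function $f$ on $\mathbb{C}$ of period $1$ put $\Delta f(x)=f(x+\tau)-f(x)$. $SK$ (special quasi-elliptic functions) is the set of meromorphic functions $f$ on $\mathbb{C}$ of period $1$, with all poles in $\Lambda$, such that $\Delta^kf=0$ for some $k\ge0$. Convolution: for meromorphic $1$-periodic functions $f,g$ on $\mathbb{C}$ with poles only in $\Lambda$, and for $0<\operatorname{Im}(x)<2\operatorname{Im}(\tau)$, define $(f\circledast_+ g)(x)=\oint_{\operatorname{Im}(z)=\operatorname{Im}(x)/2}f(x-z)g(z)\,dz$, where the integral runs over one real period, i.e. over $z=t+\tfrac{i}{2}\operatorname{Im}(x)$, $t\in[0,1]$. This has a unique analytic continuation to a meromorphic function on $\mathbb{C}$ of period $1$, which is also denoted $f\circledast_+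 g$. *)

(* Defs.v *)
From Stdlib Require Export Reals ZArith.
From Stdlib Require Import ClassicalEpsilon.
From Coquelicot Require Export Coquelicot.

Global Open Scope R_scope.
Global Open Scope C_scope.

(* A meromorphic function is represented by a total function C -> C whose values
   at isolated points (in particular at its poles) carry no information.  Equality
   of meromorphic functions is thus [meq], and pointwise operations represent the
   operations on meromorphic functions. *)

Definition meq (f g : C -> C) : Prop :=
  forall z0 : C, locally' z0 (fun z => f z = g z).

Definition holomorphic_at (f : C -> C) (z0 : C) : Prop :=
  locally z0 (fun z => ex_derive (K := C_AbsRing) (V := C_NormedModule) f z).

(* Holomorphic at [z0] after possibly changing the value at [z0]; for a
   meromorphic function, this says that [z0] is not a pole. *)
Definition regular_at (f : C -> C) (z0 : C) : Prop :=
  exists h : C -> C, holomorphic_at h z0 /\ locally' z0 (fun z => f z = h z).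

Definition meromorphic_at (f : C -> C) (z0 : C) : Prop :=
  exists n : nat, regular_at (fun z => (z - z0) ^ n * f z) z0.

Definition meromorphic (f : C -> C) : Prop :=
  forall z0 : C, meromorphic_at f z0.

Definition pole (f : C -> C) (z0 : C) : Prop :=
  meromorphic_at f z0 /\ ~ regular_at f z0.

Definition periodic1 (f : C -> C) : Prop := meq (fun x => f (x + 1)) f.

Definition in_lattice (tau z : C) : Prop :=
  exists a b : Z, z = RtoC (IZR a) + tau * RtoC (IZR b).

Definition Delta (tau : C) (f : C -> C) : C -> C := fun x => f (x + tau) - f x.

Definition SK (tau : C) (f : C -> C) : Prop :=
  meromorphic f /\ periodic1 f /\
  (forall z, pole f z -> in_lattice tau z) /\
  exists k : nat, meq (Nat.iter k (Delta tau) f) (fun _ => RtoC 0).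

(* The integral over z = t + (i/2) Im x, with t in [0, 1]. *)
Definition conv_integral (f g : C -> C) (x : C) : C :=
  RInt (V := C_R_CompleteNormedModule)
    (fun t : R => let z : C := (t, (Im x / 2)%R) in f (x - z) * g z) 0 1.

(* The values of [h] on the strip are prescribed everywhere, elsewhere [h] is
   determined up to [meq]. *)
Definition is_conv (tau : C) (f g h : C -> C) : Prop :=
  meromorphic h /\ periodic1 h /\
  forall x : C, (0 < Im x < 2 * Im tau)%R -> h x = conv_integral f g x.

(* The analytic continuation of [conv_integral f g], chosen by Hilbert's epsilon;
   the value is unspecified when there is no such continuation. *)
Definition conv (tau : C) (f g : C -> C) : C -> C :=
  epsilon (inhabits (fun _ : C => RtoC 0)) (is_conv tau f g).

Definition regular_on_strip (f : C -> C) (b : R) : Prop :=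
  forall x : C, (0 < Im x < b)%R -> regular_at f x.

(* Main.v *)
Require Import Defs.
From Stdlib Require Import Lra Lia Classical ClassicalEpsilon.

(** The proof has an analytic core and rests on one-variable complex analysis, which is
    developed first from complex differentiability alone: Goursat's theorem, Cauchy's
    formula, holomorphy of derivatives ([C_derive_differentiable]), the order of a zero
    ([hol_zero_order]) and the identity theorem for meromorphic functions
    ([identity_theorem]). Every integral is taken over the unit interval. Holomorphic
    dependence on a parameter, hence also independence of the contour, comes from
    [cder_under_int].

    Existence of the convolution. On [0 < Im x < 2 * Im tau] the integral
    [F x = conv_integral f g x] is holomorphic, because its contour may be kept fixed
    locally. For [F (x + tau)] the contour must lie above the point [z = x], and for
    [F x] below it. Hence [Delta F] is the convolution of [Delta f] with [g] plus the
    residue at [z = x] of [f (x + tau - z) * g z]. That residue is a combination of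
    derivatives of [g] ([crosses_tame]): up to functions without a pole at 0, every
    function of period 1 with poles in the lattice is near the real axis a combination
    of derivatives of [1 / (exp (2 pi i z) - 1)], and for this function the residue term
    is a multiple of [g]. By induction on the number of applications of [Delta] that
    annihilate [f], the right-hand side [E] of [Delta F = E] is in SK. This equation
    then extends [F] to the plane strip by strip ([continuation_eq]) and shows that the
    extension is in SK ([conv_continuation]). Uniqueness, independence of the chosen
    values and bilinearity follow from the identity theorem.

    Commutativity is the substitution of [x - z] for [z]. Associativity is an exchange
    of two integrals, together with commutativity ([triple_sym], [conv_assoc]). For the
    regularity statement, if [f] and [g] are regular on strips of heights [A] and [B],
    then a contour that divides [Im x] in the ratio [A : B] gives a holomorphic function
    on the strip of height [A + B] ([conv_regular]).

    Elements of SK are given up to their values at isolated points. Each one is replaced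
    by a representative that is holomorphic outside the lattice ([SK_normalise]), and
    such a change does not affect the integrals ([conv_integral_meq]). *)

(** * Complex derivatives and continuity *)

Notation cder f z l := (is_derive (K := C_AbsRing) (V := C_NormedModule) f (z : C) (l : C)).
Notation CR_space := C_R_NormedModule.
Notation CR_complete := C_R_CompleteNormedModule.
Notation R_space := R_NormedModule.
Notation R_complete := R_CompleteNormedModule.
Notation ccont f x := (continuous (U := C_UniformSpace) f x).

Lemma locally_Cmod (z : C) (P : C -> Prop) :
  locally (T := C_UniformSpace) z P <->
  exists d : R, (0 < d) /\ forall w : C, (Cmod (w - z) < d)%R -> P w.
Proof.
split.
- intros [e He]; exists e; split; [apply cond_pos|].
  intros w Hw; apply He, C_NormedModule_mixin_compat1; exact Hw.
- intros (d & Hd & H).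
  assert (Hs : (0 < sqrt 2)%R) by (apply sqrt_lt_R0; lra).
  exists (mkposreal (d / sqrt 2) (Rdiv_lt_0_compat _ _ Hd Hs)).
  intros w Hw; apply H.
  apply C_NormedModule_mixin_compat2 in Hw; simpl in Hw.
  replace d with (sqrt 2 * (d / sqrt 2))%R by (field; lra). exact Hw.
Qed.

Lemma locally'_Cmod (z : C) (P : C -> Prop) :
  locally' (T := C_UniformSpace) z P <->
  exists d : R, (0 < d) /\ forall w : C, (Cmod (w - z) < d)%R -> w <> z -> P w.
Proof. exact (locally_Cmod z (fun w => w <> z -> P w)). Qed.

Lemma cder_eps (f : C -> C) (z l : C) :
  cder f z l <->
  forall eps : R, (0 < eps) -> exists d : R, (0 < d) /\
    forall w : C, (Cmod (w - z) < d)%R ->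
      (Cmod (f w - f z - l * (w - z)) <= eps * Cmod (w - z))%R.
Proof.
split.
- intros [_ H] eps He.
  specialize (H z (fun P HP => HP) (mkposreal eps He)).
  apply locally_C, locally_Cmod in H.
  destruct H as (d & Hd & H); exists d; split; [exact Hd|].
  intros w Hw; specialize (H w Hw).
  rewrite (Cmult_comm l). exact H.
- intros H; split; [apply is_linear_scal_l|].
  intros x Hx eps. 
  apply (is_filter_lim_locally_unique (V := AbsRing_NormedModule C_AbsRing)) in Hx; subst x.
  destruct (H eps (cond_pos eps)) as (d & Hd & H').
  apply locally_C, locally_Cmod; exists d; split; [exact Hd|].
  intros w Hw; specialize (H' w Hw).
  rewrite (Cmult_comm l) in H'. exact H'.
Qed.

Lemma ccont_eps {T : UniformSpace} (f : T -> C) (x : T) :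
  ccont f x <->
  forall eps : R, (0 < eps) -> locally x (fun y => (Cmod (f y - f x) < eps)%R).
Proof.
split.
- intros H eps He.
  apply (H (fun w => (Cmod (w - f x) < eps)%R)).
  apply locally_Cmod; exists eps; split; auto.
- intros H P HP.
  apply locally_Cmod in HP; destruct HP as (d & Hd & HP).
  unfold filtermap; generalize (H d Hd); apply filter_imp; intros y Hy; apply HP, Hy.
Qed.

Lemma ccont_pair {T : UniformSpace} (f : T -> C) (x : T) :
  continuous (fun y => fst (f y)) x -> continuous (fun y => snd (f y)) x -> ccont f x.
Proof.
intros H1 H2 P [e He].
unfold filtermap.
generalize (filter_and _ _ (proj1 (filterlim_locally _ _) H1 e) (proj1 (filterlim_locally _ _) H2 e)).
apply filter_imp; intros y [A B]; apply He; split; assumption.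
Qed.

Lemma ccont_fst {T : UniformSpace} (f : T -> C) (x : T) :
  ccont f x -> continuous (fun y => fst (f y)) x.
Proof. intros H; apply (continuous_comp f fst); [exact H|apply continuous_fst]. Qed.

Lemma ccont_snd {T : UniformSpace} (f : T -> C) (x : T) :
  ccont f x -> continuous (fun y => snd (f y)) x.
Proof. intros H; apply (continuous_comp f snd); [exact H|apply continuous_snd]. Qed.

Lemma ccont_plus {T : UniformSpace} (f g : T -> C) (x : T) :
  ccont f x -> ccont g x -> ccont (fun y => f y + g y) x.
Proof.
intros H1 H2.
exact (ccont_pair (fun y => f y + g y) x
  (continuous_plus (V := R_space) _ _ x (ccont_fst f x H1) (ccont_fst g x H2))
  (continuous_plus (V := R_space) _ _ x (ccont_snd f x H1) (ccont_snd g x H2))).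
Qed.

Lemma ccont_mult {T : UniformSpace} (f g : T -> C) (x : T) :
  ccont f x -> ccont g x -> ccont (fun y => f y * g y) x.
Proof.
intros H1 H2.
assert (M : forall p q : T -> R, continuous p x -> continuous q x ->
   continuous (fun y => (p y * q y)%R) x) by exact (fun p q => continuous_mult (K := R_AbsRing) p q x).
exact (ccont_pair (fun y => f y * g y) x
  (continuous_minus (V := R_space) _ _ x
     (M _ _ (ccont_fst f x H1) (ccont_fst g x H2)) (M _ _ (ccont_snd f x H1) (ccont_snd g x H2)))
  (continuous_plus (V := R_space) _ _ x
     (M _ _ (ccont_fst f x H1) (ccont_snd g x H2)) (M _ _ (ccont_snd f x H1) (ccont_fst g x H2)))).
Qed.

Lemma ccont_opp {T : UniformSpace} (f : T -> C) (x : T) :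
  ccont f x -> ccont (fun y => - f y) x.
Proof.
intros H1.
exact (ccont_pair (fun y => - f y) x
  (continuous_opp (V := R_space) _ x (ccont_fst f x H1))
  (continuous_opp (V := R_space) _ x (ccont_snd f x H1))).
Qed.

Lemma ccont_minus {T : UniformSpace} (f g : T -> C) (x : T) :
  ccont f x -> ccont g x -> ccont (fun y => f y - g y) x.
Proof. intros H1 H2; apply ccont_plus; [exact H1|now apply ccont_opp]. Qed.

Lemma ccont_const {T : UniformSpace} (c : C) (x : T) : ccont (fun _ : T => c) x.
Proof. apply continuous_const. Qed.

Lemma ccont_RtoC {T : UniformSpace} (f : T -> R) (x : T) :
  continuous f x -> ccont (fun y => RtoC (f y)) x.
Proof. intros H; apply ccont_pair; simpl; [exact H|apply continuous_const]. Qed.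

Lemma ccont_RtoC_id (t : R) : ccont RtoC t.
Proof. exact (ccont_RtoC (fun s : R => s) t (continuous_id t)). Qed.

Lemma Cmod_minus_self (z : C) : Cmod (z - z) = 0%R.
Proof. replace (z - z) with (RtoC 0) by ring. apply Cmod_0. Qed.

Lemma Cminus_0_r (z : C) : z - 0 = z.
Proof. ring. Qed.

Lemma RtoC_m1 : RtoC (-1) = - (1).
Proof. rewrite <- RtoC_opp. reflexivity. Qed.

Lemma cder_ccont (f : C -> C) (z l : C) : cder f z l -> ccont f z.
Proof.
intros H. assert (K := ex_derive_continuous (K := C_AbsRing) (V := C_NormedModule) f z (ex_intro _ l H)).
intros P HP. apply locally_C. exact (K P HP).
Qed.

Lemma cder_const (c z : C) : cder (fun _ => c) z 0.
Proof. exact (is_derive_const (K := C_AbsRing) (V := C_NormedModule) c z). Qed.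

Lemma cder_id (z : C) : cder (fun w => w) z 1.
Proof.
apply cder_eps; intros eps He; exists 1%R; split; [lra|]; intros w _.
replace (w - z - 1 * (w - z)) with (RtoC 0) by ring.
rewrite Cmod_0. apply Rmult_le_pos; [lra|apply Cmod_ge_0].
Qed.

Lemma cder_plus (f g : C -> C) (z a b : C) :
  cder f z a -> cder g z b -> cder (fun w => f w + g w) z (a + b).
Proof. exact (is_derive_plus (K := C_AbsRing) (V := C_NormedModule) f g z a b). Qed.

Lemma cder_opp (f : C -> C) (z a : C) :
  cder f z a -> cder (fun w => - f w) z (- a).
Proof. exact (is_derive_opp (K := C_AbsRing) (V := C_NormedModule) f z a). Qed.

Lemma cder_minus (f g : C -> C) (z a b : C) :
  cder f z a -> cder g z b -> cder (fun w => f w - g w) z (a - b).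
Proof. exact (is_derive_minus (K := C_AbsRing) (V := C_NormedModule) f g z a b). Qed.

Lemma cder_ext_loc (f g : C -> C) (z l : C) :
  locally (T := C_UniformSpace) z (fun w => f w = g w) -> cder f z l -> cder g z l.
Proof.
intros H; apply (is_derive_ext_loc (K := C_AbsRing) (V := C_NormedModule)).
apply locally_C; exact H.
Qed.

Lemma cder_ext (f g : C -> C) (z l : C) :
  (forall w, f w = g w) -> cder f z l -> cder g z l.
Proof. intros H; apply cder_ext_loc, filter_forall, H. Qed.

Lemma cder_eq (f : C -> C) (z l l' : C) : cder f z l -> l = l' -> cder f z l'.
Proof. now intros H <-. Qed.

(** The topology of [C] as a product and its topology as a ring with absolute value are
    two different structures with the same little-o conditions; the product and chain
    rules are available for the second one. *)
Lemma cder_absring (f : C -> C) (z l : C) :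
  cder f z l <-> is_derive (K := C_AbsRing) (V := AbsRing_NormedModule C_AbsRing) f z l.
Proof. split; intros [_ H]; (split; [apply is_linear_scal_l|exact H]). Qed.

Lemma cder_mult (f g : C -> C) (z a b : C) :
  cder f z a -> cder g z b -> cder (fun w => f w * g w) z (a * g z + f z * b).
Proof.
rewrite !cder_absring. intros Hf Hg.
exact (is_derive_mult (K := C_AbsRing) f g z a b Hf Hg Cmult_comm).
Qed.

Lemma cder_comp (f g : C -> C) (z a b : C) :
  cder f (g z) a -> cder g z b -> cder (fun w => f (g w)) z (a * b).
Proof.
intros Hf Hg. rewrite Cmult_comm. rewrite cder_absring in Hg.
exact (is_derive_comp (K := C_AbsRing) (V := C_NormedModule) f g z a b Hf Hg).
Qed.

Lemma cder_inv (z : C) : z <> 0 -> cder (fun w => / w) z (- / (z * z)).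
Proof.
intros Hz.
assert (Hm : (0 < Cmod z)%R) by now apply Cmod_gt_0.
apply cder_eps; intros eps He.
set (m := Cmod z) in *.
assert (m3 : (0 < m * m * m)%R) by (repeat apply Rmult_lt_0_compat; assumption).
exists (Rmin (m / 2) (eps * (m * m * m) / 2)); split.
{ apply Rmin_pos; [lra|]. apply Rdiv_lt_0_compat; [|lra]. now apply Rmult_lt_0_compat. }
intros w Hw.
assert (B1 := Rmin_l (m / 2) (eps * (m * m * m) / 2)).
assert (B2 := Rmin_r (m / 2) (eps * (m * m * m) / 2)).
assert (Hw1 : (m / 2 < Cmod w)%R).
{ assert (m <= Cmod w + Cmod (w - z))%R; [|lra].
  unfold m. replace z with (w + - (w - z)) at 1 by ring.
  eapply Rle_trans; [apply Cmod_triangle|]. rewrite Cmod_opp. lra. }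
assert (w <> 0). { intros ->. rewrite Cmod_0 in Hw1. lra. }
replace (/ w - / z - - / (z * z) * (w - z)) with ((w - z) * (w - z) / (w * (z * z))).
2:{ field. now split. }
rewrite Cmod_div, !Cmod_mult. 2:{ repeat apply Cmult_neq_0; assumption. }
fold m. set (D := Cmod (w - z)) in *.
assert (D0 : (0 <= D)) by apply Cmod_ge_0.
apply Rmult_le_reg_r with (Cmod w * (m * m))%R.
{ repeat apply Rmult_lt_0_compat; lra. }
unfold Rdiv at 1. rewrite Rmult_assoc, Rinv_l, Rmult_1_r.
2:{ apply Rgt_not_eq. repeat apply Rmult_lt_0_compat; lra. }
apply Rle_trans with (D * (eps * (m * m * m) / 2))%R; [apply Rmult_le_compat_l; lra|].
replace (D * (eps * (m * m * m) / 2))%R with (eps * D * (m / 2 * (m * m)))%R by field.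
apply Rmult_le_compat_l; [apply Rmult_le_pos; lra|].
apply Rmult_le_compat_r; [nra|lra].
Qed.

Lemma cder_unique (f : C -> C) (z a b : C) : cder f z a -> cder f z b -> a = b.
Proof.
intros Ha Hb.
rewrite <- (is_C_derive_unique f z a), <- (is_C_derive_unique f z b); trivial;
now apply locally_C || exact Ha || exact Hb.
Qed.

Lemma ccont_comp {T : UniformSpace} (f : C -> C) (g : T -> C) (x : T) :
  ccont g x -> ccont f (g x) -> ccont (fun y => f (g y)) x.
Proof. intros; now apply continuous_comp. Qed.

Lemma ccont_inv {T : UniformSpace} (f : T -> C) (x : T) :
  ccont f x -> f x <> 0 -> ccont (fun y => / f y) x.
Proof.
intros H1 H2; apply (ccont_comp (fun w => / w)); [exact H1|].
eapply cder_ccont; now apply cder_inv.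
Qed.

Definition seg (a b : C) (t : R) : C := a + RtoC t * (b - a).

Lemma is_derive_seg (f : C -> C) (a b l : C) (t : R) :
  cder f (seg a b t) l ->
  is_derive (K := R_AbsRing) (V := CR_space) (fun s => f (seg a b s)) t ((b - a) * l).
Proof.
intros H. split; [apply is_linear_scal_l|].
intros x Hx eps.
apply (is_filter_lim_locally_unique (V := AbsRing_NormedModule R_AbsRing)) in Hx; subst x.
set (K := (1 + Cmod (b - a))%R).
assert (K0 : (0 < K)) by (unfold K; generalize (Cmod_ge_0 (b - a)); lra).
apply cder_eps with (eps := (eps / K)%R) in H.
2:{ apply Rdiv_lt_0_compat; [apply cond_pos|exact K0]. }
destruct H as (d & Hd & H).
exists (mkposreal _ (Rdiv_lt_0_compat _ _ Hd K0)); intros s Hs.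
change (Rabs (s - t) < d / K)%R in Hs.
assert (E : seg a b s - seg a b t = RtoC (s - t) * (b - a)).
{ unfold seg. rewrite RtoC_minus. ring. }
assert (Hn : Cmod (seg a b s - seg a b t) = (Rabs (s - t) * Cmod (b - a))%R)
  by now rewrite E, Cmod_mult, Cmod_R.
assert (L : (Rabs (s - t) * Cmod (b - a) <= Rabs (s - t) * K)%R).
{ apply Rmult_le_compat_l; [apply Rabs_pos|unfold K; lra]. }
assert (L2 : (Rabs (s - t) * K < d)%R).
{ apply Rmult_lt_compat_r with (r := K) in Hs; [|exact K0].
  replace (d / K * K)%R with d in Hs by (field; lra). exact Hs. }
specialize (H (seg a b s) ltac:(lra)).
rewrite <- Cmod_norm.
change (Cmod (f (seg a b s) - f (seg a b t) - scal (V := C_R_ModuleSpace) (s - t)%R (Cmult (Cminus b a) l)) <= eps * Rabs (s - t))%R.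
rewrite scal_R_Cmult.
replace (RtoC (s - t) * ((b - a) * l)) with (l * (seg a b s - seg a b t)) by (rewrite E; ring).
eapply Rle_trans; [exact H|]. rewrite Hn.
apply Rle_trans with (eps / K * (Rabs (s - t) * K))%R.
{ apply Rmult_le_compat_l; [|exact L]. left; apply Rdiv_lt_0_compat; [apply cond_pos|exact K0]. }
right; field; lra.
Qed.

(** Apply the real mean value theorem to the real part of
    [Cconj V * (f z - l * (z - a))] along the segment, where [V] is the quantity to be
    bounded: its total increment is [Cmod V ^ 2]. Differentiability is all that enters,
    so the bound is available before Goursat's theorem. *)
Lemma mean_value_bound (f df : C -> C) (a b l : C) (eps : R) :
  (forall t : R, (0 <= t <= 1) ->
     cder f (seg a b t) (df (seg a b t)) /\ (Cmod (df (seg a b t) - l) <= eps)%R) ->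
  (Cmod (f b - f a - l * (b - a)) <= eps * Cmod (b - a))%R.
Proof.
intros H.
(* pairing with V turns the complex estimate into a real one *)
set (V := f b - f a - l * (b - a)).
set (G := fun z => Cconj V * (f z - l * (z - a))).
assert (Hd : forall t : R, (0 <= t <= 1) ->
   is_derive (fun s => Re (G (seg a b s))) t (Re ((b - a) * (Cconj V * (df (seg a b t) - l))))).
{ intros t Ht. destruct (H t Ht) as [H1 _].
  assert (HG : cder G (seg a b t) (Cconj V * (df (seg a b t) - l))).
  { eapply cder_eq. apply cder_mult; [apply cder_const|].
    apply cder_minus; [exact H1|]. apply cder_mult; [apply cder_const|].
    apply cder_minus; [apply cder_id|apply cder_const]. simpl. ring. }
  apply is_derive_seg in HG.
  apply (filterdiff_comp' (K := R_AbsRing) (U := R_space) (V := CR_space) (W := R_space) 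
     (fun s : R => G (seg a b s)) (fun z : C => Re z) t
     (fun y => scal y ((b - a) * (Cconj V * (df (seg a b t) - l)))) (fun z => Re z)) in HG.
  2:{ apply filterdiff_linear. exact (is_linear_fst (U := R_space) (V := R_space)). }
  exact HG. }
destruct (MVT_gen (fun s => Re (G (seg a b s))) 0 1 
  (fun t => Re ((b - a) * (Cconj V * (df (seg a b t) - l))))) as (c & Hc & E).
{ intros x Hx. apply Hd. rewrite Rmin_left, Rmax_right in Hx; lra. }
{ intros x Hx. rewrite Rmin_left, Rmax_right in Hx by lra.
  apply continuity_pt_filterlim.
  apply (ex_derive_continuous (K := R_AbsRing) (V := R_space)). eexists; apply Hd; lra. }
rewrite Rmin_left, Rmax_right in Hc by lra.
destruct (H c Hc) as [_ H2].
assert (E0 : (Re (G (seg a b 1)) - Re (G (seg a b 0)) = Cmod V * Cmod V)%R).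
{ replace (seg a b 1) with b by (unfold seg; ring).
  replace (seg a b 0) with a by (unfold seg; ring).
  replace (Re (G b) - Re (G a))%R with (Re (G b - G a)) by (unfold Re; simpl; ring).
  replace (G b - G a) with (V * Cconj V) by (unfold G, V; ring).
  rewrite <- Cmod2_conj. simpl. ring. }
rewrite E0 in E.
assert (B : (Cmod V * Cmod V <= Cmod (b - a) * (Cmod V * eps))%R).
{ rewrite E. replace (1 - 0)%R with 1%R by ring. rewrite Rmult_1_r.
  eapply Rle_trans; [apply Rle_abs|]. eapply Rle_trans; [apply re_le_Cmod|].
  rewrite !Cmod_mult, Cmod_conj.
  apply Rmult_le_compat_l; [apply Cmod_ge_0|]. apply Rmult_le_compat_l; [apply Cmod_ge_0|exact H2]. }
destruct (Cmod_ge_0 V) as [HV|HV].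
- apply Rmult_le_reg_l with (Cmod V); [exact HV|]. lra.
- rewrite <- HV. apply Rmult_le_pos; [|apply Cmod_ge_0].
  eapply Rle_trans; [apply Cmod_ge_0|exact H2].
Qed.

Lemma constant_of_zero_derivative (g : C -> C) (a b : C) :
  (forall t : R, (0 <= t <= 1) -> cder g (seg a b t) 0) -> g b = g a.
Proof.
intros H. apply Ceq_minus, Cmod_eq_0.
assert (K := mean_value_bound g (fun _ => 0) a b 0 0).
assert (Z : (Cmod (g b - g a - 0 * (b - a)) <= 0 * Cmod (b - a))%R).
{ apply K. intros t Ht. split; [now apply H|]. replace (RtoC 0 - RtoC 0) with (RtoC 0) by ring.
  rewrite Cmod_0; lra. }
replace (g b - g a - 0 * (b - a)) with (g b - g a) in Z by ring.
generalize (Cmod_ge_0 (g b - g a)); lra.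
Qed.

Lemma ccont_along_R (f : C -> C) (t : R) : ccont f (RtoC t) -> ccont (fun t => f (RtoC t)) t.
Proof. intros H. exact (ccont_comp f (fun s : R => RtoC s) t (ccont_RtoC (fun s : R => s) t (continuous_id t)) H). Qed.

(** * Integrals over the unit interval *)

(** Tube lemma: by compactness of the unit interval, a property that holds near every
    [(x, t)] holds for all [t] at once when the first variable is close to [x]. *)
Lemma locally_tube {U : UniformSpace} (x : U) (P : U -> R -> Prop) :
  (forall t : R, (0 <= t <= 1) -> locally (x, t) (fun p : U * R => P (fst p) (snd p))) ->
  locally x (fun y => forall t : R, (0 <= t <= 1) -> P y t).
Proof.
intros H.
assert (H' : forall t : R, exists d : posreal,
   (0 <= t <= 1) -> forall y s, ball x d y -> (Rabs (s - t) < d)%R -> P y s).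
{ intros t. destruct (classic (0 <= t <= 1)) as [Ht|Ht].
  - destruct (H t Ht) as [d Hd]. exists d. intros _ y s Hy Hs. exact (Hd (y, s) (conj Hy Hs)).
  - now exists (mkposreal 1 Rlt_0_1). }
set (delta := fun t => proj1_sig (constructive_indefinite_description _ (H' t))).
assert (Hdelta : forall t, (0 <= t <= 1) ->
   forall y s, ball x (delta t) y -> (Rabs (s - t) < delta t)%R -> P y s)
  by (intros t; exact (proj2_sig (constructive_indefinite_description _ (H' t)))).
destruct (compactness_value_1d 0 1 delta) as [d Hd].
exists d; intros y Hy s Hs.
apply NNPP; intros N; apply (Hd s Hs); intros (t & Ht & A & B).
apply N, (Hdelta t Ht); [|exact A].
now apply ball_le with d.
Qed.

Definition cont01 (phi : R -> C) : Prop := forall t : R, (0 <= t <= 1) -> ccont phi t.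
Definition CInt (phi : R -> C) : C := RInt (V := CR_complete) phi 0 1.
Notation is_CInt phi l := (is_RInt (V := CR_space) phi 0 1 (l : C)).

Lemma CInt_correct (phi : R -> C) : cont01 phi -> is_CInt phi (CInt phi).
Proof.
intros H.
apply (RInt_correct (V := CR_complete)).
apply (ex_RInt_continuous (V := CR_complete)).
intros t Ht; apply H. rewrite Rmin_left, Rmax_right in Ht; lra.
Qed.

Lemma CInt_unique (phi : R -> C) (l : C) : is_CInt phi l -> CInt phi = l.
Proof. exact (is_RInt_unique (V := CR_complete) phi 0 1 l). Qed.

Lemma CInt_ext (phi psi : R -> C) :
  (forall t : R, (0 <= t <= 1) -> phi t = psi t) -> CInt phi = CInt psi.
Proof.
intros H; refine (RInt_ext (V := CR_complete) phi psi 0 1 _).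
intros t Ht; rewrite Rmin_left, Rmax_right in Ht by lra; apply H; lra.
Qed.

Lemma CInt_const (c : C) : CInt (fun _ => c) = c.
Proof.
apply CInt_unique.
generalize (is_RInt_const (V := CR_space) 0 1 c).
rewrite Rminus_0_r. intros H.
assert (E : scal (V := C_R_ModuleSpace) 1%R c = c) by (rewrite scal_R_Cmult; apply Cmult_1_l).
refine (eq_ind _ (fun l => is_CInt (fun _ : R => c) l) H _ E).
Qed.

Lemma CInt_plus (phi psi : R -> C) :
  cont01 phi -> cont01 psi -> CInt (fun t => phi t + psi t) = CInt phi + CInt psi.
Proof.
intros H1 H2; apply CInt_unique.
apply (is_RInt_plus (V := CR_space)); now apply CInt_correct.
Qed.

Lemma CInt_scal (c : C) (phi : R -> C) :
  cont01 phi -> CInt (fun t => c * phi t) = c * CInt phi.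
Proof.
intros H; apply CInt_unique.
assert (H' := CInt_correct phi H).
assert (A := is_RInt_fct_extend_fst (U := R_space) (V := R_space) _ _ _ _ H').
assert (B := is_RInt_fct_extend_snd (U := R_space) (V := R_space) _ _ _ _ H').
apply (is_RInt_fct_extend_pair (U := R_space) (V := R_space)).
- apply (is_RInt_minus (V := R_space)); now apply (is_RInt_scal (V := R_space)).
- apply (is_RInt_plus (V := R_space)).
  + now apply (is_RInt_scal (V := R_space) (fun t => snd (phi t))).
  + now apply (is_RInt_scal (V := R_space) (fun t => fst (phi t))).
Qed.

Lemma CInt_minus (phi psi : R -> C) :
  cont01 phi -> cont01 psi -> CInt (fun t => phi t - psi t) = CInt phi - CInt psi.
Proof.
intros H1 H2; apply CInt_unique.
apply (is_RInt_minus (V := CR_space)); now apply CInt_correct.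
Qed.

Lemma CInt_bound (phi : R -> C) (M : R) :
  cont01 phi -> (forall t : R, (0 <= t <= 1) -> (Cmod (phi t) <= M)%R) ->
  (Cmod (CInt phi) <= M)%R.
Proof.
intros H HM. rewrite Cmod_norm.
replace M with ((1 - 0) * M)%R by ring.
apply (norm_RInt_le_const (V := CR_space) phi 0 1); [lra| |now apply CInt_correct].
intros t Ht. rewrite <- Cmod_norm. now apply HM.
Qed.

Lemma CInt_FTC (Phi phi : R -> C) :
  (forall t : R, (0 <= t <= 1) ->
     is_derive (K := R_AbsRing) (V := CR_space) Phi t (phi t)) ->
  cont01 phi -> CInt phi = Phi 1%R - Phi 0%R.
Proof.
intros H Hc; apply CInt_unique.
apply (is_RInt_derive (V := CR_complete)); intros t Ht;
rewrite Rmin_left, Rmax_right in Ht by lra; [now apply H|now apply Hc].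
Qed.

Lemma CInt_affine (phi : R -> C) (u v : R) :
  (forall t, (0 <= t <= 1) -> (0 <= u * t + v <= 1)%R) -> cont01 phi ->
  RtoC u * CInt (fun t => phi (u * t + v)%R)
   = RInt (V := CR_complete) phi v (u + v).
Proof.
intros H Hc.
rewrite <- CInt_scal.
2:{ intros t Ht. apply (continuous_comp (fun t : R => (u * t + v)%R) phi); [|now apply Hc, H].
  apply (continuous_plus (V := R_space)); [|apply continuous_const].
  apply (continuous_scal_r (V := R_space) u (fun x : R => x)), continuous_id. }
generalize (RInt_comp_lin (V := CR_complete) phi u v 0 1).
replace (u * 0 + v)%R with v by ring. replace (u * 1 + v)%R with (u + v)%R by ring.
intros <-.
- refine (RInt_ext (V := CR_complete) _ _ 0 1 _). intros t _. symmetry. apply (scal_R_Cmult u).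
- apply (ex_RInt_continuous (V := CR_complete)). intros t Ht. apply Hc.
  assert (A := H 0%R ltac:(lra)). assert (B := H 1%R ltac:(lra)).
  revert Ht. apply Rmin_case; apply Rmax_case; lra.
Qed.

Lemma CInt_reverse (phi : R -> C) :
  cont01 phi -> CInt (fun t => phi (1 - t)%R) = CInt phi.
Proof.
intros H.
assert (A := CInt_affine phi (-1) 1 ltac:(intros; lra) H).
replace (-1 + 1)%R with 0%R in A by ring.
rewrite <- (opp_RInt_swap (V := CR_complete)) in A.
2:{ exists (CInt phi). now apply CInt_correct. }
change (RtoC (-1) * CInt (fun t => phi (-1 * t + 1)%R) = - CInt phi) in A.
rewrite (CInt_ext _ (fun t => phi (-1 * t + 1)%R)).
2:{ intros t _. f_equal. ring. }
replace (CInt (fun t => phi (-1 * t + 1)%R)) with (- (RtoC (-1) * CInt (fun t => phi (-1 * t + 1)%R))).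
{ rewrite A. ring. }
rewrite RtoC_m1. ring.
Qed.

Lemma CInt_halves (phi : R -> C) :
  cont01 phi ->
  2 * CInt phi = CInt (fun t => phi (t / 2)%R) + CInt (fun t => phi ((1 + t) / 2)%R).
Proof.
intros H.
assert (A := CInt_affine phi (/ 2) 0 ltac:(intros; lra) H).
assert (B := CInt_affine phi (/ 2) (/ 2) ltac:(intros; lra) H).
replace (/ 2 + 0)%R with (/2)%R in A by ring.
replace (/ 2 + / 2)%R with 1%R in B by field.
assert (E : CInt phi = RtoC (/2) * CInt (fun t => phi (/ 2 * t + 0)%R) + RtoC (/2) * CInt (fun t => phi (/ 2 * t + / 2)%R)).
{ rewrite A, B. symmetry. 
  apply (RInt_Chasles (V := CR_complete));
  apply (ex_RInt_continuous (V := CR_complete)); intros t Ht; apply H;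
  rewrite Rmin_left, Rmax_right in Ht; lra. }
rewrite E, RtoC_inv by lra.
rewrite (CInt_ext (fun t => phi (t / 2)%R) (fun t => phi (/ 2 * t + 0)%R)) by (intros; f_equal; field).
rewrite (CInt_ext (fun t => phi ((1 + t) / 2)%R) (fun t => phi (/ 2 * t + /2)%R)) by (intros; f_equal; field).
field.
Qed.

(** * Exchanging two integrals *)

Lemma continuous_section (F : R -> R -> R) (y t : R) :
  (forall u v, continuity_2d_pt F u v) -> continuous (F y) t.
Proof.
intros H. apply continuity_pt_filterlim.
intros eps He. destruct (H y t (mkposreal eps He)) as [d Hd].
exists d; split; [apply cond_pos|]. intros s [_ Hs]. apply Hd; [|exact Hs].
rewrite Rminus_diag, Rabs_R0. apply cond_pos.
Qed.

Lemma ex_RInt_section (F : R -> R -> R) (y a b : R) :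
  (forall u v, continuity_2d_pt F u v) -> ex_RInt (F y) a b.
Proof.
intros H. apply (ex_RInt_continuous (V := R_complete)). intros t _. now apply continuous_section.
Qed.

Lemma continuous_RInt_param (F : R -> R -> R) (x : R) :
  (forall u v, continuity_2d_pt F u v) ->
  continuous (fun y => RInt (F y) 0 1) x.
Proof.
intros H.
assert (Hi : forall y, ex_RInt (F y) 0 1) by (intros y; now apply ex_RInt_section).
apply filterlim_locally; intros eps.
assert (L : locally x (fun y => forall t, (0 <= t <= 1) -> (Rabs (F y t - F x t) <= eps / 2)%R)).
{ apply locally_tube. intros t _.
  assert (He : (0 < eps / 4)%R) by (destruct eps; simpl; lra).
  destruct (H x t (mkposreal _ He)) as [d Hd]. simpl in Hd.
  exists d. intros [y s] [Hy Hs]. simpl in *.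
  assert (A := Hd y s Hy Hs).
  assert (B := Hd x s). rewrite Rminus_diag, Rabs_R0 in B. specialize (B (cond_pos d) Hs).
  replace (F y s - F x s)%R with ((F y s - F x t) - (F x s - F x t))%R by ring.
  eapply Rle_trans; [apply Rabs_triang|]. rewrite Rabs_Ropp. lra. }
revert L; apply filter_imp; intros y Hy.
change (Rabs (RInt (F y) 0 1 - RInt (F x) 0 1) < eps)%R.
apply Rle_lt_trans with (eps / 2)%R; [|destruct eps; simpl; lra].
rewrite <- (RInt_minus (V := R_complete)) by apply Hi.
replace (eps / 2)%R with ((1 - 0) * (eps / 2))%R by ring.
apply abs_RInt_le_const; [lra| |exact Hy].
apply (ex_RInt_minus (V := R_space)); apply Hi.
Qed.

(** Both sides are the increment over the unit interval of
    [s -> RInt (fun t => RInt (F t) 0 s) 0 1], whose derivative is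
    [RInt (fun t => F t s) 0 1]. *)
Lemma RInt_Fubini (F : R -> R -> R) :
  (forall u v, continuity_2d_pt F u v) ->
  RInt (fun t => RInt (fun u => F t u) 0 1) 0 1 = RInt (fun u => RInt (fun t => F t u) 0 1) 0 1.
Proof.
intros H.
assert (Hi : forall y a b, ex_RInt (F y) a b) by (intros y a b; now apply ex_RInt_section).
assert (Hs : forall u v, continuity_2d_pt (fun s t => F t s) u v).
{ intros u v eps. destruct (H v u eps) as [d Hd]. exists d; intros a b Ha Hb. now apply Hd. }
assert (Hprim : forall t s, is_derive (fun s => RInt (F t) 0 s) s (F t s)).
{ intros t s. apply (is_derive_RInt (V := R_space) (F t) _ 0 s); [|now apply continuous_section].
  apply filter_forall; intros y. apply (RInt_correct (V := R_complete)), Hi. }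
assert (HD : forall s t, Derive (fun s => RInt (F t) 0 s) s = F t s)
  by (intros; apply is_derive_unique, Hprim).
assert (HK : forall s, is_derive (fun s => RInt (fun t => RInt (F t) 0 s) 0 1) s
               (RInt (fun t => F t s) 0 1)).
{ intros s.
  rewrite <- (RInt_ext (V := R_complete) (fun t => Derive (fun s => RInt (F t) 0 s) s))
    by (intros; apply HD).
  apply (is_derive_RInt_param (fun s t => RInt (F t) 0 s)).
  - apply filter_forall; intros y t _. eexists; apply Hprim.
  - intros t _. apply (continuity_2d_pt_ext (fun u v => F v u)); [intros; now rewrite HD|]. apply Hs.
  - apply filter_forall; intros y.
    apply (ex_RInt_continuous (V := R_complete)); intros z _.
    apply (continuous_ext (fun t => RInt (fun u => y * F t (y * u))%R 0 1)).
    { intros t. generalize (RInt_comp_lin (V := R_complete) (F t) y 0 0 1 (Hi _ _ _)).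
      rewrite Rmult_0_r, Rmult_1_r, !Rplus_0_r. intros <-.
      apply (RInt_ext (V := R_complete)); intros u _.
      now rewrite Rplus_0_r. }
    apply (continuous_RInt_param (fun t u => (y * F t (y * u))%R)).
    intros u v. apply continuity_2d_pt_mult; [apply continuity_2d_pt_const|].
    intros eps. destruct (H u (y * v)%R eps) as [d Hd].
    assert (P : (0 < d / (1 + Rabs y))%R).
    { apply Rdiv_lt_0_compat; [apply cond_pos|generalize (Rabs_pos y); lra]. }
    assert (P' : (d / (1 + Rabs y) <= d)%R).
    { apply Rmult_le_reg_r with (1 + Rabs y)%R; [generalize (Rabs_pos y); lra|].
      unfold Rdiv; rewrite Rmult_assoc, Rinv_l, Rmult_1_r by (generalize (Rabs_pos y); lra).
      generalize (cond_pos d) (Rabs_pos y); nra. }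
    exists (mkposreal _ P); intros a b Ha Hb; simpl in Ha, Hb. apply Hd; [lra|].
    rewrite <- Rmult_minus_distr_l, Rabs_mult.
    apply Rle_lt_trans with ((1 + Rabs y) * Rabs (b - v))%R.
    { apply Rmult_le_compat_r; [apply Rabs_pos|lra]. }
    apply Rmult_lt_compat_l with (r := (1 + Rabs y)%R) in Hb; [|generalize (Rabs_pos y); lra].
    replace ((1 + Rabs y) * (d / (1 + Rabs y)))%R with (pos d) in Hb; [exact Hb|].
    field. generalize (Rabs_pos y); lra. }
symmetry. apply (is_RInt_unique (V := R_complete)).
replace (RInt (fun t => RInt (fun u => F t u) 0 1) 0 1) with
  (minus (RInt (fun t => RInt (F t) 0 1) 0 1) (RInt (fun t => RInt (F t) 0 0) 0 1)).
{ apply (is_RInt_derive (V := R_complete) (fun s => RInt (fun t => RInt (F t) 0 s) 0 1)).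
  - intros s _; apply HK.
  - intros s _. apply (continuous_RInt_param (fun s t => F t s)), Hs. }
rewrite (RInt_ext (V := R_complete) (fun t => RInt (F t) 0 0) (fun _ => 0%R))
  by (intros; apply (RInt_point (V := R_complete))).
rewrite RInt_const. rewrite (scal_zero_r (V := R_ModuleSpace)). apply (minus_zero_r (G := R_AbelianGroup)).
Qed.

Definition ccont2 (phi : R -> R -> C) : Prop := forall s t : R, forall eps : R, (0 < eps) ->
  exists d : R, (0 < d) /\ forall s' t' : R, (Rabs (s' - s) < d)%R -> (Rabs (t' - t) < d)%R ->
  (Cmod (phi s' t' - phi s t) < eps)%R.

Lemma CInt_pair (phi : R -> C) : cont01 phi ->
  CInt phi = (RInt (fun t => fst (phi t)) 0 1, RInt (fun t => snd (phi t)) 0 1).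
Proof.
intros H.
assert (H' := CInt_correct phi H).
assert (A := is_RInt_unique (V := R_complete) _ _ _ _
  (is_RInt_fct_extend_fst (U := R_space) (V := R_space) _ _ _ _ H')).
assert (B := is_RInt_unique (V := R_complete) _ _ _ _
  (is_RInt_fct_extend_snd (U := R_space) (V := R_space) _ _ _ _ H')).
rewrite (surjective_pairing (CInt phi)). exact (f_equal2 (@pair R R) (eq_sym A) (eq_sym B)).
Qed.

Lemma CInt_Fubini (phi : R -> R -> C) : ccont2 phi ->
  CInt (fun t => CInt (fun s => phi t s)) = CInt (fun s => CInt (fun t => phi t s)).
Proof.
intros H.
assert (H1 : forall u v, continuity_2d_pt (fun t s => fst (phi t s)) u v).
{ intros u v eps. destruct (H u v eps (cond_pos eps)) as (d & Hd & K).
  exists (mkposreal d Hd); intros a b Ha Hb. simpl in *. eapply Rle_lt_trans; [|exact (K a b Ha Hb)].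
  exact (re_le_Cmod (phi a b - phi u v)). }
assert (H2 : forall u v, continuity_2d_pt (fun t s => snd (phi t s)) u v).
{ intros u v eps. destruct (H u v eps (cond_pos eps)) as (d & Hd & K).
  exists (mkposreal d Hd); intros a b Ha Hb. simpl in *. eapply Rle_lt_trans; [|exact (K a b Ha Hb)].
  eapply Rle_trans; [|exact (Rmax_Cmod (phi a b - phi u v))]. apply Rmax_r. }
assert (S : forall F : R -> R -> R, (forall u v, continuity_2d_pt F u v) ->
              forall u v, continuity_2d_pt (fun s t => F t s) u v).
{ intros F HF u v eps. destruct (HF v u eps) as [d Hd]. exists d; intros a b Ha Hb. now apply Hd. }
assert (C1 : forall t, cont01 (phi t)).
{ intros t s _. apply ccont_pair; [exact (continuous_section _ t s H1)|exact (continuous_section _ t s H2)]. }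
assert (C2 : forall s, cont01 (fun t => phi t s)).
{ intros s t _. apply ccont_pair; [exact (continuous_section _ s t (S _ H1))|exact (continuous_section _ s t (S _ H2))]. }
assert (D1 : cont01 (fun t => CInt (phi t))).
{ intros t _. apply (continuous_ext (fun t => (RInt (fun s => fst (phi t s)) 0 1, RInt (fun s => snd (phi t s)) 0 1) : C)).
  { intros; symmetry; now apply CInt_pair. }
  apply ccont_pair; now apply continuous_RInt_param. }
assert (D2 : cont01 (fun s => CInt (fun t => phi t s))).
{ intros s _. apply (continuous_ext (fun s => (RInt (fun t => fst (phi t s)) 0 1, RInt (fun t => snd (phi t s)) 0 1) : C)).
  { intros; symmetry; now apply (CInt_pair (fun t => phi t x)). }
  apply ccont_pair;
  [apply (continuous_RInt_param (fun s t => fst (phi t s)))|apply (continuous_RInt_param (fun s t => snd (phi t s)))];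
  now apply S. }
rewrite CInt_pair by exact D1. rewrite CInt_pair by exact D2.
apply (f_equal2 (@pair R R)).
- rewrite (RInt_ext (V := R_complete) _ (fun t => RInt (fun s => fst (phi t s)) 0 1))
    by (intros; now rewrite CInt_pair).
  rewrite (RInt_ext (V := R_complete) (fun t => fst (CInt (fun t0 => phi t0 t))) (fun s => RInt (fun t => fst (phi t s)) 0 1))
    by (intros; now rewrite CInt_pair).
  now apply RInt_Fubini.
- rewrite (RInt_ext (V := R_complete) _ (fun t => RInt (fun s => snd (phi t s)) 0 1))
    by (intros; now rewrite CInt_pair).
  rewrite (RInt_ext (V := R_complete) (fun t => snd (CInt (fun t0 => phi t0 t))) (fun s => RInt (fun t => snd (phi t s)) 0 1))
    by (intros; now rewrite CInt_pair).
  now apply RInt_Fubini.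
Qed.

(** * Goursat's theorem and primitives on discs *)

Lemma dependent_choice {A : Type} (Inv : nat -> A -> Prop) (Rel : nat -> A -> A -> Prop) :
  (exists x, Inv 0%nat x) ->
  (forall n x, Inv n x -> exists y, Inv (S n) y /\ Rel n x y) ->
  exists s : nat -> A, forall n, Inv n (s n) /\ Rel n (s n) (s (S n)).
Proof.
intros H0 HS.
set (next := fun n (p : {x | Inv n x}) =>
  constructive_indefinite_description _ (HS n (proj1_sig p) (proj2_sig p))).
set (seq := nat_rect (fun n => {x | Inv n x}) (constructive_indefinite_description _ H0)
   (fun n p => exist (Inv (S n)) (proj1_sig (next n p)) (proj1 (proj2_sig (next n p))))).
exists (fun n => proj1_sig (seq n)); intros n; split; [exact (proj2_sig (seq n))|].
exact (proj2 (proj2_sig (next n (seq n)))).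
Qed.

Lemma seg_in_ball (c a b : C) (r t : R) :
  (Cmod (a - c) <= r)%R -> (Cmod (b - c) <= r)%R -> (0 <= t <= 1) ->
  (Cmod (seg a b t - c) <= r)%R.
Proof.
intros Ha Hb Ht.
replace (seg a b t - c) with (RtoC (1 - t) * (a - c) + RtoC t * (b - c))
  by (unfold seg; rewrite RtoC_minus; ring).
eapply Rle_trans; [apply Cmod_triangle|].
rewrite !Cmod_mult, !Cmod_R, !Rabs_pos_eq by lra.
assert ((1 - t) * Cmod (a - c) <= (1 - t) * r)%R by (apply Rmult_le_compat_l; lra).
assert (t * Cmod (b - c) <= t * r)%R by (apply Rmult_le_compat_l; lra).
lra.
Qed.

Lemma seg_in_open_ball (c a b : C) (r t : R) :
  (Cmod (a - c) < r)%R -> (Cmod (b - c) < r)%R -> (0 <= t <= 1) ->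
  (Cmod (seg a b t - c) < r)%R.
Proof.
intros Ha Hb Ht.
eapply Rle_lt_trans; [apply (seg_in_ball c a b (Rmax (Cmod (a - c)) (Cmod (b - c)))); 
 [apply Rmax_l|apply Rmax_r|exact Ht]|].
now apply Rmax_lub_lt.
Qed.

Lemma seg_0 (a b : C) : seg a b 0 = a.
Proof. unfold seg; ring. Qed.
Lemma seg_1 (a b : C) : seg a b 1 = b.
Proof. unfold seg; ring. Qed.

Lemma ccont_seg (a b : C) (t : R) : ccont (seg a b) t.
Proof.
unfold seg. apply ccont_plus; [apply ccont_const|].
apply ccont_mult; [apply ccont_RtoC, continuous_id|apply ccont_const].
Qed.

Definition seg_int (f : C -> C) (a b : C) : C := (b - a) * CInt (fun t => f (seg a b t)).
Definition seg_cont (f : C -> C) (a b : C) : Prop :=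
  forall t : R, (0 <= t <= 1) -> ccont f (seg a b t).

Lemma seg_cont01 (f : C -> C) (a b : C) : seg_cont f a b -> cont01 (fun t => f (seg a b t)).
Proof. intros H t Ht. apply (ccont_comp f (seg a b)); [apply ccont_seg|now apply H]. Qed.

Lemma seg_int_bound (f : C -> C) (a b : C) (M : R) : seg_cont f a b ->
  (forall t : R, (0 <= t <= 1) -> (Cmod (f (seg a b t)) <= M)%R) ->
  (Cmod (seg_int f a b) <= M * Cmod (b - a))%R.
Proof.
intros H HM; unfold seg_int. rewrite Cmod_mult, Rmult_comm.
apply Rmult_le_compat_r; [apply Cmod_ge_0|]. apply CInt_bound; [now apply seg_cont01|exact HM].
Qed.

Lemma seg_int_reverse (f : C -> C) (a b : C) : seg_cont f a b ->
  seg_int f b a = - seg_int f a b.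
Proof.
intros H; unfold seg_int.
rewrite <- (CInt_reverse (fun t => f (seg a b t))) by now apply seg_cont01.
rewrite (CInt_ext (fun t => f (seg b a t)) (fun t => f (seg a b (1 - t)))).
- ring.
- intros t _. f_equal. unfold seg. rewrite RtoC_minus. ring.
Qed.

Definition mid (a b : C) : C := (a + b) / 2.

Lemma seg_mid_l (a b : C) (t : R) : seg a (mid a b) t = seg a b (t / 2).
Proof. unfold seg, mid. rewrite RtoC_div by lra. field. Qed.
Lemma seg_mid_r (a b : C) (t : R) : seg (mid a b) b t = seg a b ((1 + t) / 2).
Proof. unfold seg, mid. rewrite RtoC_div, RtoC_plus by lra. field. Qed.

Lemma seg_int_mid (f : C -> C) (a b : C) : seg_cont f a b ->
  seg_int f a b = seg_int f a (mid a b) + seg_int f (mid a b) b.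
Proof.
intros H; unfold seg_int.
rewrite (CInt_ext (fun t => f (seg a (mid a b) t)) (fun t => f (seg a b (t / 2))))
  by (intros; now rewrite seg_mid_l).
rewrite (CInt_ext (fun t => f (seg (mid a b) b t)) (fun t => f (seg a b ((1 + t) / 2))))
  by (intros; now rewrite seg_mid_r).
assert (E := CInt_halves _ (seg_cont01 f a b H)).
transitivity ((b - a) / 2 * (2 * CInt (fun t => f (seg a b t)))); [field|].
rewrite E. unfold mid. field.
Qed.

Lemma seg_int_plus (f g : C -> C) (a b : C) : seg_cont f a b -> seg_cont g a b ->
  seg_int (fun z => f z + g z) a b = seg_int f a b + seg_int g a b.
Proof.
intros Hf Hg; unfold seg_int. rewrite CInt_plus by now apply seg_cont01. ring.
Qed.

Lemma seg_int_FTC (F f : C -> C) (a b : C) :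
  (forall t : R, (0 <= t <= 1) -> cder F (seg a b t) (f (seg a b t))) ->
  seg_cont f a b -> seg_int f a b = F b - F a.
Proof.
intros H Hc; unfold seg_int.
rewrite <- CInt_scal by now apply seg_cont01.
rewrite (CInt_FTC (fun t => F (seg a b t))).
- now rewrite seg_0, seg_1.
- intros t Ht. now apply is_derive_seg, H.
- intros t Ht. apply ccont_mult; [apply ccont_const|now apply seg_cont01].
Qed.

Definition tri_int (f : C -> C) (a b c : C) : C :=
  seg_int f a b + seg_int f b c + seg_int f c a.
Definition sides (a b c : C) (d : R) : Prop :=
  (Cmod (b - a) <= d)%R /\ (Cmod (c - b) <= d)%R /\ (Cmod (a - c) <= d)%R.

Lemma half_bound (x y : C) (d : R) : y = x / 2 -> (Cmod x <= d)%R -> (Cmod y <= d / 2)%R.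
Proof.
intros -> H. rewrite Cmod_div, Cmod_R, Rabs_pos_eq; [lra|lra|].
intros K; apply RtoC_inj in K; lra.
Qed.

Lemma mid_in_ball (c a b : C) (r : R) :
  (Cmod (a - c) <= r)%R -> (Cmod (b - c) <= r)%R -> (Cmod (mid a b - c) <= r)%R.
Proof.
intros Ha Hb. replace (mid a b) with (seg a b (/ 2)).
- apply seg_in_ball; trivial; lra.
- unfold seg, mid. rewrite RtoC_inv by lra. field.
Qed.

Section Subdivision.
Variables (f : C -> C) (c0 : C) (rad : R).
Hypothesis Hf : forall z, (Cmod (z - c0) < rad)%R -> exists l, cder f z l.

Lemma ball_ccont (z : C) : (Cmod (z - c0) < rad)%R -> ccont f z.
Proof. intros Hz. destruct (Hf z Hz) as [l Hl]. eapply cder_ccont; exact Hl. Qed.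

Lemma ball_seg_cont (a b : C) : (Cmod (a - c0) < rad)%R -> (Cmod (b - c0) < rad)%R -> seg_cont f a b.
Proof. intros Ha Hb t Ht. now apply ball_ccont, seg_in_open_ball. Qed.

(** The inner segments of the subdivision by midpoints are run through twice, in
    opposite directions. *)
Lemma tri_int_subdivide (a b c : C) :
  (Cmod (a - c0) < rad)%R -> (Cmod (b - c0) < rad)%R -> (Cmod (c - c0) < rad)%R ->
  tri_int f a b c = tri_int f a (mid a b) (mid c a) + tri_int f (mid a b) b (mid b c)
    + tri_int f (mid c a) (mid b c) c + tri_int f (mid a b) (mid b c) (mid c a).
Proof.
intros Ha Hb Hc.
assert (M : forall x y, (Cmod (x - c0) < rad)%R -> (Cmod (y - c0) < rad)%R -> (Cmod (mid x y - c0) < rad)%R).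
{ intros x y Hx Hy. replace (mid x y) with (seg x y (/ 2)).
  - apply seg_in_open_ball; trivial; lra.
  - unfold seg, mid. rewrite RtoC_inv by lra. field. }
unfold tri_int.
rewrite (seg_int_mid f a b), (seg_int_mid f b c), (seg_int_mid f c a) by now apply ball_seg_cont.
rewrite (seg_int_reverse f (mid c a) (mid a b)), (seg_int_reverse f (mid a b) (mid b c)),
  (seg_int_reverse f (mid b c) (mid c a)) by (apply ball_seg_cont; now apply M).
ring.
Qed.

Lemma tri_int_step (a b c : C) (d r : R) : (r < rad) ->
  (Cmod (a - c0) <= r)%R -> (Cmod (b - c0) <= r)%R -> (Cmod (c - c0) <= r)%R -> sides a b c d ->
  exists a' b' c', ((Cmod (a' - c0) <= r)%R /\ (Cmod (b' - c0) <= r)%R /\ (Cmod (c' - c0) <= r)%R) /\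
    sides a' b' c' (d / 2) /\ (Cmod (a' - a) <= d)%R /\
    (Cmod (tri_int f a b c) <= 4 * Cmod (tri_int f a' b' c'))%R.
Proof.
intros Hr Ha Hb Hc (S1 & S2 & S3).
assert (E := tri_int_subdivide a b c ltac:(lra) ltac:(lra) ltac:(lra)).
set (T1 := tri_int f a (mid a b) (mid c a)) in *. set (T2 := tri_int f (mid a b) b (mid b c)) in *.
set (T3 := tri_int f (mid c a) (mid b c) c) in *. set (T4 := tri_int f (mid a b) (mid b c) (mid c a)) in *.
assert (L : (Cmod (tri_int f a b c) <= Cmod T1 + Cmod T2 + Cmod T3 + Cmod T4)%R).
{ rewrite E. eapply Rle_trans; [apply Cmod_triangle|]. apply Rplus_le_compat_r.
  eapply Rle_trans; [apply Cmod_triangle|]. apply Rplus_le_compat_r. apply Cmod_triangle. }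
assert (d0 : (0 <= d)) by (eapply Rle_trans; [apply Cmod_ge_0|exact S1]).
assert (S1' : (Cmod (- (b - a)) <= d)%R) by now rewrite Cmod_opp.
assert (S2' : (Cmod (- (c - b)) <= d)%R) by now rewrite Cmod_opp.
assert (S3' : (Cmod (- (a - c)) <= d)%R) by now rewrite Cmod_opp.
assert (Z : (Cmod (a - a) <= d)%R) by now rewrite Cmod_minus_self.
assert (D1 : (Cmod (mid a b - a) <= d)%R).
{ apply mid_in_ball; assumption. }
assert (D2 : (Cmod (mid c a - a) <= d)%R).
{ apply mid_in_ball; [|assumption]. replace (c - a) with (- (a - c)) by ring. assumption. }
assert (Q : (Cmod (tri_int f a b c) <= 4 * Cmod T1 \/ Cmod (tri_int f a b c) <= 4 * Cmod T2 \/
  Cmod (tri_int f a b c) <= 4 * Cmod T3 \/ Cmod (tri_int f a b c) <= 4 * Cmod T4)%R) by lra.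
destruct Q as [Q|[Q|[Q|Q]]];
 [exists a, (mid a b), (mid c a)|exists (mid a b), b, (mid b c)
 |exists (mid c a), (mid b c), c|exists (mid a b), (mid b c), (mid c a)];
 (split; [repeat split; try assumption; now apply mid_in_ball|]);
 (split; [|split; [assumption|exact Q]]); unfold sides; repeat split;
 match goal with |- (Cmod ?y <= _)%R => first
  [ apply (half_bound (b - a) y d); [unfold mid; field|assumption]
  | apply (half_bound (c - b) y d); [unfold mid; field|assumption]
  | apply (half_bound (a - c) y d); [unfold mid; field|assumption]
  | apply (half_bound (- (b - a)) y d); [unfold mid; field|assumption]
  | apply (half_bound (- (c - b)) y d); [unfold mid; field|assumption]
  | apply (half_bound (- (a - c)) y d); [unfold mid; field|assumption] ] end.
Qed.
End Subdivision.

Lemma div_pow2_small (k eps : R) : (0 <= k) -> (0 < eps) -> exists N : nat, (k / 2 ^ N < eps)%R.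
Proof.
intros Hk He.
destruct (pow_lt_1_zero (/ 2) ltac:(rewrite Rabs_pos_eq; lra) (eps / (k + 1)))%R as [N HN].
{ apply Rdiv_lt_0_compat; lra. }
assert (P2 : (0 < / 2 ^ N)%R) by (apply Rinv_0_lt_compat, pow_lt; lra).
exists N. specialize (HN N (Nat.le_refl N)). rewrite pow_inv, Rabs_pos_eq in HN by lra.
apply Rle_lt_trans with ((k + 1) * / 2 ^ N)%R; [unfold Rdiv; apply Rmult_le_compat_r; lra|].
apply Rmult_lt_compat_l with (r := (k + 1)%R) in HN; [|lra].
replace ((k + 1) * (eps / (k + 1)))%R with eps in HN by (field; lra). exact HN.
Qed.

(** In Goursat's proof the triangles shrink by a factor 2 at each step, so their first
    vertices form a Cauchy sequence with an explicit rate. *)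
Lemma geometric_limit (a : nat -> C) (d : R) :
  (forall n, Cmod (a (S n) - a n) <= d / 2 ^ n)%R ->
  exists p : C, forall n, (Cmod (a n - p) <= 2 * d / 2 ^ n)%R.
Proof.
intros H.
assert (P2 : forall n, (0 < 2 ^ n)%R) by (intros; apply pow_lt; lra).
assert (d0 : (0 <= d)).
{ specialize (H 0%nat). simpl in H. generalize (Cmod_ge_0 (a 1%nat - a 0%nat)). lra. }
assert (K : forall n k, (Cmod (a (n + k)%nat - a n) <= 2 * d / 2 ^ n - 2 * d / 2 ^ (n + k))%R).
{ intros n; induction k as [|k IH].
  - rewrite Nat.add_0_r. replace (a n - a n) with (RtoC 0) by ring. rewrite Cmod_0. lra.
  - rewrite Nat.add_succ_r.
    replace (a (S (n + k)) - a n) with ((a (S (n + k)) - a (n + k)%nat) + (a (n + k)%nat - a n)) by ring.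
    eapply Rle_trans; [apply Cmod_triangle|]. specialize (H (n + k)%nat).
    simpl. replace (2 * d / (2 * 2 ^ (n + k)))%R with (d / 2 ^ (n + k))%R.
    2:{ field. apply Rgt_not_eq, P2. }
    replace (2 * d / 2 ^ (n + k))%R with (d / 2 ^ (n + k) + d / 2 ^ (n + k))%R in IH.
    2:{ field. apply Rgt_not_eq, P2. }
    lra. }
assert (K2 : forall n m, (n <= m)%nat -> (Cmod (a m - a n) <= 2 * d / 2 ^ n)%R).
{ intros n m Hm. replace m with (n + (m - n))%nat by lia.
  eapply Rle_trans; [apply K|].
  assert (0 <= 2 * d / 2 ^ (n + (m - n)))%R; [|lra].
  apply Rdiv_le_0_compat; [lra|apply P2]. }
assert (Cau : exists p : C, filterlim a eventually (locally (T := C_UniformSpace) p)).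
{ apply (filterlim_locally_cauchy (U := CR_complete)). intros eps.
  assert (e2 : (0 < eps / 2)%R) by (destruct eps; simpl; lra).
  destruct (div_pow2_small (2 * d) (eps / 2) ltac:(lra) e2) as [N HN].
  exists (fun n => (N <= n)%nat). split; [now exists N|]. intros n m Hn Hm.
  apply C_NormedModule_mixin_compat1. change (Cmod (a m - a n) < eps).
  replace (a m - a n) with ((a m - a N) + - (a n - a N)) by ring.
  eapply Rle_lt_trans; [apply Cmod_triangle|]. rewrite Cmod_opp.
  assert (A := K2 N n Hn). assert (B := K2 N m Hm). lra. }
destruct Cau as [p Hp]. exists p. intros n. apply le_epsilon; intros eps He.
destruct (Hp _ (proj2 (locally_Cmod p (fun w => (Cmod (w - p) < eps))) (ex_intro _ eps (conj He (fun w h => h))))) as [N HN].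
replace (a n - p) with (- (a (Nat.max n N) - a n) + (a (Nat.max n N) - p)) by ring.
eapply Rle_trans; [apply Cmod_triangle|]. rewrite Cmod_opp.
apply Rplus_le_compat; [apply K2; lia|]. left. apply HN. lia.
Qed.

Section GoursatTheorem.
Variables (f : C -> C) (c0 : C) (rad : R).
Hypothesis Hf : forall z, (Cmod (z - c0) < rad)%R -> exists l, cder f z l.

(** Repeated subdivision keeps at least a fourth of the integral, so the n-th triangle
    has side at most [d / 2 ^ n] and integral at least [eta / 4 ^ n]. Near the limit
    point [p] the function is [aff], which has a primitive, up to an error
    [e * Cmod (w - p)]; hence the n-th integral is at most [9 * e * (d / 2 ^ n) ^ 2],
    and [eta] is smaller than every positive number. *)
Lemma Goursat (a b c : C) :
  (Cmod (a - c0) < rad)%R -> (Cmod (b - c0) < rad)%R -> (Cmod (c - c0) < rad)%R ->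
  tri_int f a b c = 0.
Proof.
intros Ha Hb Hc.
set (r := Rmax (Cmod (a - c0)) (Rmax (Cmod (b - c0)) (Cmod (c - c0)))).
assert (Hr : (r < rad)) by (repeat apply Rmax_lub_lt; assumption).
set (d := Rmax (Cmod (b - a)) (Rmax (Cmod (c - b)) (Cmod (a - c)))).
set (eta := Cmod (tri_int f a b c)).
assert (P2 : forall n, (0 < 2 ^ n)%R) by (intros; apply pow_lt; lra).
assert (P4 : forall n, (4 ^ n = 2 ^ n * 2 ^ n)%R) by (intros; rewrite <- Rpow_mult_distr; f_equal; ring).
destruct (dependent_choice
  (fun n (p : C * C * C) => let '(a, b, c) := p in
     ((Cmod (a - c0) <= r)%R /\ (Cmod (b - c0) <= r)%R /\ (Cmod (c - c0) <= r)%R) /\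
     sides a b c (d / 2 ^ n) /\ (eta <= 4 ^ n * Cmod (tri_int f a b c))%R)
  (fun n p q => (Cmod (fst (fst q) - fst (fst p)) <= d / 2 ^ n)%R)) as [s Hs].
{ exists (a, b, c). simpl. repeat split; unfold Rdiv; try rewrite Rinv_1, Rmult_1_r.
  - apply Rmax_l.
  - eapply Rle_trans; [|apply Rmax_r]. apply Rmax_l.
  - eapply Rle_trans; [|apply Rmax_r]. apply Rmax_r.
  - apply Rmax_l.
  - eapply Rle_trans; [|apply Rmax_r]. apply Rmax_l.
  - eapply Rle_trans; [|apply Rmax_r]. apply Rmax_r.
  - unfold eta; lra. }
{ intros n [[x y] z] ((H1 & H2 & H3) & H4 & H5).
  destruct (tri_int_step f c0 rad Hf x y z _ r Hr H1 H2 H3 H4) as (x' & y' & z' & A & B & D & E).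
  exists (x', y', z'); split; [|exact D]. split; [exact A|]. split.
  - simpl. replace (d / (2 * 2 ^ n))%R with (d / 2 ^ n / 2)%R; [exact B|].
    field. apply Rgt_not_eq, P2.
  - eapply Rle_trans; [exact H5|]. simpl. rewrite (Rmult_comm 4), Rmult_assoc.
    apply Rmult_le_compat_l; [|exact E]. left; apply pow_lt; lra. }
destruct (geometric_limit (fun n => fst (fst (s n))) d) as [p Hp].
{ intros n. apply Hs. }
assert (d0 : (0 <= d)) by (eapply Rle_trans; [|apply Rmax_l]; apply Cmod_ge_0).
assert (Hpr : (Cmod (p - c0) <= r)%R).
{ apply le_epsilon; intros eps He. destruct (div_pow2_small (2 * d) eps ltac:(lra) He) as [N HN].
  destruct (Hs N) as [HI _]. specialize (Hp N). destruct (s N) as [[x y] z]. simpl in *.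
  destruct HI as ((A & _) & _).
  replace (p - c0) with ((x - c0) + - (x - p)) by ring.
  eapply Rle_trans; [apply Cmod_triangle|]. rewrite Cmod_opp. lra. }
destruct (Hf p ltac:(lra)) as [l Hl].
assert (Heta : (eta <= 0)).
{ apply le_epsilon; intros eps He. rewrite Rplus_0_l.
  (* 9: three sides, on each of which the distance to p is at most 3 * (d / 2 ^ n) *)
  set (e := (eps / (9 * (d * d) + 1))%R).
  assert (Q : (0 < 9 * (d * d) + 1)%R) by nra.
  assert (e0 : (0 < e)) by now apply Rdiv_lt_0_compat.
  destruct (proj1 (cder_eps f p l) Hl e e0) as (del & Hdel & HL).
  destruct (div_pow2_small (3 * d) del ltac:(lra) Hdel) as [n Hn].
  destruct (Hs n) as [HI _]. specialize (Hp n). destruct (s n) as [[x y] z]. simpl in Hp.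
  destruct HI as ((A1 & A2 & A3) & (B1 & B2 & B3) & E).
  set (dn := (d / 2 ^ n)%R) in *.
  replace (2 * d / 2 ^ n)%R with (2 * dn)%R in Hp by (unfold dn; field; apply Rgt_not_eq, P2).
  replace (3 * d / 2 ^ n)%R with (3 * dn)%R in Hn by (unfold dn; field; apply Rgt_not_eq, P2).
  assert (dn0 : (0 <= dn)) by (eapply Rle_trans; [|exact B1]; apply Cmod_ge_0).
  set (aff := fun w => f p + l * (w - p)).
  set (g := fun w => f w - aff w).
  assert (Haff : forall w, ccont aff w).
  { intros w. apply ccont_plus; [apply ccont_const|]. apply ccont_mult; [apply ccont_const|].
    apply ccont_minus; [apply continuous_id|apply ccont_const]. }
  assert (Hg : forall w, (Cmod (w - c0) < rad)%R -> ccont g w).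
  { intros w Hw. apply ccont_minus; [|apply Haff]. now apply (ball_ccont f c0 rad Hf). }
  assert (Vx : (Cmod (x - p) <= 3 * dn)%R) by lra.
  assert (Vy : (Cmod (y - p) <= 3 * dn)%R).
  { replace (y - p) with ((y - x) + (x - p)) by ring. eapply Rle_trans; [apply Cmod_triangle|]. lra. }
  assert (Vz : (Cmod (z - p) <= 3 * dn)%R).
  { replace (z - p) with (- (x - z) + (x - p)) by ring. eapply Rle_trans; [apply Cmod_triangle|].
    rewrite Cmod_opp. lra. }
  set (Aff := fun w => f p * w + l / 2 * ((w - p) * (w - p))).
  assert (HAff : forall w, cder Aff w (aff w)).
  { intros w. eapply cder_eq. apply cder_plus.
    - apply cder_mult; [apply cder_const|apply cder_id].
    - apply cder_mult; [apply cder_const|].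
      apply cder_mult; (apply cder_minus; [apply cder_id|apply cder_const]).
    - unfold aff. simpl. field. }
  assert (S : forall u v, (Cmod (u - c0) <= r)%R -> (Cmod (v - c0) <= r)%R ->
    (Cmod (u - p) <= 3 * dn)%R -> (Cmod (v - p) <= 3 * dn)%R -> (Cmod (v - u) <= dn)%R ->
    seg_int f u v = seg_int g u v + (Aff v - Aff u) /\ (Cmod (seg_int g u v) <= e * (3 * dn) * dn)%R).
  { intros u v Hu Hv Hu' Hv' Huv.
    assert (Cg : seg_cont g u v).
    { intros t Ht. apply Hg. apply seg_in_open_ball; [lra|lra|exact Ht]. }
    split.
    - rewrite <- (seg_int_FTC Aff aff u v); [|intros; apply HAff|intros t _; apply Haff].
      rewrite <- seg_int_plus; [|exact Cg|intros t _; apply Haff].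
      unfold seg_int. f_equal. apply CInt_ext. intros t _. unfold g. ring.
    - eapply Rle_trans; [apply (seg_int_bound g u v (e * (3 * dn))%R Cg)|].
      + intros t Ht. assert (Hb' := seg_in_ball p u v (3 * dn)%R t Hu' Hv' Ht).
        replace (g (seg u v t)) with (f (seg u v t) - f p - l * (seg u v t - p)) by (unfold g, aff; ring).
        eapply Rle_trans; [apply HL; lra|]. apply Rmult_le_compat_l; lra.
      + apply Rmult_le_compat_l; [|exact Huv]. apply Rmult_le_pos; lra. }
  destruct (S x y A1 A2 Vx Vy B1) as [E1 L1].
  destruct (S y z A2 A3 Vy Vz B2) as [E2 L2].
  destruct (S z x A3 A1 Vz Vx B3) as [E3 L3].
  assert (T : (Cmod (tri_int f x y z) <= 9 * e * (dn * dn))%R).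
  { unfold tri_int. rewrite E1, E2, E3.
    replace (seg_int g x y + (Aff y - Aff x) + (seg_int g y z + (Aff z - Aff y)) + (seg_int g z x + (Aff x - Aff z)))
      with (seg_int g x y + seg_int g y z + seg_int g z x) by ring.
    eapply Rle_trans; [apply Cmod_triangle|].
    eapply Rle_trans; [apply Rplus_le_compat_r, Cmod_triangle|]. lra. }
  eapply Rle_trans; [exact E|].
  apply Rle_trans with (4 ^ n * (9 * e * (dn * dn)))%R.
  { apply Rmult_le_compat_l; [left; apply pow_lt; lra|exact T]. }
  rewrite P4. unfold dn.
  replace (2 ^ n * 2 ^ n * (9 * e * (d / 2 ^ n * (d / 2 ^ n))))%R with (e * (9 * (d * d)))%R.
  2:{ field. apply Rgt_not_eq, P2. }
  apply Rle_trans with (e * (9 * (d * d) + 1))%R; [apply Rmult_le_compat_l; lra|].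
  unfold e. right. field. lra. }
apply Cmod_eq_0. generalize (Cmod_ge_0 (tri_int f a b c)). fold eta. lra.
Qed.

(** Goursat's theorem for the triangle [c0, z, w] turns the increment of the primitive
    into the integral over the segment from [z] to [w], where [f] is close to [f z]. *)
Lemma ball_primitive (z : C) : (Cmod (z - c0) < rad)%R -> cder (seg_int f c0) z (f z).
Proof.
intros Hz.
assert (Hc0 : (Cmod (c0 - c0) < rad)%R).
{ rewrite Cmod_minus_self.
  eapply Rle_lt_trans; [apply Cmod_ge_0|exact Hz]. }
apply cder_eps; intros eps He.
assert (Hcz := ball_ccont f c0 rad Hf z Hz).
destruct (proj1 (locally_Cmod _ _) (proj1 (ccont_eps _ _) Hcz eps He)) as (d & Hd & K).
exists (Rmin d (rad - Cmod (z - c0))); split; [apply Rmin_pos; lra|].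
intros w Hw.
assert (B1 := Rmin_l d (rad - Cmod (z - c0))). assert (B2 := Rmin_r d (rad - Cmod (z - c0))).
assert (Hwb : (Cmod (w - c0) < rad)%R).
{ replace (w - c0) with ((w - z) + (z - c0)) by ring. eapply Rle_lt_trans; [apply Cmod_triangle|]. lra. }
assert (G := Goursat c0 z w Hc0 Hz Hwb). unfold tri_int in G.
rewrite (seg_int_reverse f c0 w) in G by now apply (ball_seg_cont f c0 rad Hf).
assert (Cc : seg_cont (fun _ => - f z) z w) by (intros t _; apply ccont_const).
assert (Cf : seg_cont f z w) by now apply (ball_seg_cont f c0 rad Hf).
assert (E : seg_int f c0 w - seg_int f c0 z - f z * (w - z) = seg_int (fun u => f u + - f z) z w).
{ rewrite seg_int_plus by assumption. unfold seg_int at 4. rewrite CInt_const.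
  transitivity (seg_int f z w + (w - z) * - f z).
  - replace (seg_int f c0 w) with (seg_int f c0 w + (seg_int f c0 z + seg_int f z w + - seg_int f c0 w))
      by (rewrite G; ring). ring.
  - reflexivity. }
rewrite E. apply seg_int_bound.
- intros t Ht. apply ccont_plus; [now apply Cf|apply ccont_const].
- intros t Ht. left. apply K.
  eapply Rle_lt_trans; [apply (seg_in_ball z z w (Cmod (w - z))); [|lra|exact Ht]|lra].
  rewrite Cmod_minus_self. apply Cmod_ge_0.
Qed.
End GoursatTheorem.

(** * Integrals depending on a complex parameter *)

(** By the tube lemma [y * phi t] is small for all [t] at once when [y] is small
    enough. *)
Lemma cont01_bounded (phi : R -> C) : cont01 phi ->
  exists M : R, (0 < M) /\ forall t : R, (0 <= t <= 1) -> (Cmod (phi t) <= M)%R.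
Proof.
intros H.
assert (L : locally (T := R_UniformSpace) 0%R
  (fun y => forall t : R, (0 <= t <= 1) -> (Rabs y * Cmod (phi t) <= 1)%R)).
{ apply locally_tube. intros t Ht.
  assert (K : ccont (fun p : R * R => RtoC (fst p) * phi (snd p)) (0%R, t)).
  { apply ccont_mult; [apply ccont_RtoC, continuous_fst|].
    apply (continuous_comp snd phi); [apply continuous_snd|now apply H]. }
  generalize (proj1 (ccont_eps _ _) K 1%R Rlt_0_1). apply filter_imp. intros [y s] Hp. simpl in *.
  rewrite Cmult_0_l, Cminus_0_r, Cmod_mult, Cmod_R in Hp. lra. }
destruct L as [d Hd].
assert (d0 := cond_pos d).
exists (2 / d)%R. split; [apply Rdiv_lt_0_compat; lra|].
intros t Ht.
assert (K : (Rabs (d / 2) * Cmod (phi t) <= 1)%R).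
{ apply Hd; [|exact Ht]. change (Rabs (d / 2 - 0) < d)%R. rewrite Rminus_0_r, Rabs_pos_eq; lra. }
rewrite Rabs_pos_eq in K by lra.
apply Rmult_le_reg_l with (d / 2)%R; [lra|]. replace (d / 2 * (2 / d))%R with 1%R by (field; lra). exact K.
Qed.

(** Differentiation under the integral sign, for a parameter entering affinely. All
    integrals below have this form: translates [f (w + t)], convolutions
    [f (x - w - t) * g (w + t)], Cauchy kernels, and averages over segments. The tube
    lemma makes the continuity of [A'] uniform in [t], and the mean value inequality
    then bounds the difference quotient. *)
Lemma cder_under_int (A A' : C -> C) (al be B : R -> C) (z0 : C) :
  cont01 al -> cont01 be -> cont01 B ->
  (forall t : R, (0 <= t <= 1) ->
     locally (T := C_UniformSpace) (al t + be t * z0) (fun w => cder A w (A' w))) ->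
  (forall t : R, (0 <= t <= 1) -> ccont A' (al t + be t * z0)) ->
  cder (fun z => CInt (fun t => A (al t + be t * z) * B t)) z0
    (CInt (fun t => A' (al t + be t * z0) * (be t * B t))).
Proof.
intros Hal Hbe HB HA HA'.
destruct (cont01_bounded (fun t => be t * B t)) as (M & M0 & HM).
{ intros t Ht. apply ccont_mult; [now apply Hbe|now apply HB]. }
assert (Cp : forall z t, (0 <= t <= 1) -> ccont (fun t => al t + be t * z) t).
{ intros z t Ht. apply ccont_plus; [now apply Hal|]. apply ccont_mult; [now apply Hbe|apply ccont_const]. }
assert (U : forall eps, (0 < eps) -> exists d, (0 < d) /\ forall z, (Cmod (z - z0) < d)%R ->
   forall t : R, (0 <= t <= 1) -> cder A (al t + be t * z) (A' (al t + be t * z)) /\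
     (Cmod (A' (al t + be t * z) - A' (al t + be t * z0))%C <= eps)%R).
{ intros eps He. apply (locally_Cmod z0), locally_tube. intros t Ht.
  assert (e2 : (0 < eps / 2)%R) by lra.
  assert (J : ccont (fun p : C_UniformSpace * R => al (snd p) + be (snd p) * fst p) (z0, t)).
  { apply ccont_plus; [|apply ccont_mult; [|apply continuous_fst]];
    apply (continuous_comp snd); try apply continuous_snd; [now apply Hal|now apply Hbe]. }
  assert (J0 : ccont (fun p : C_UniformSpace * R => al (snd p) + be (snd p) * z0) (z0, t)).
  { apply ccont_plus; [|apply ccont_mult; [|apply ccont_const]];
    apply (continuous_comp snd); try apply continuous_snd; [now apply Hal|now apply Hbe]. }
  assert (KA := proj1 (ccont_eps _ _) (HA' t Ht) _ e2).
  assert (Q1 := J _ (HA t Ht)). assert (Q2 := J _ KA). assert (Q3 := J0 _ KA).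
  unfold filtermap in Q1, Q2, Q3.
  generalize (filter_and _ _ Q1 (filter_and _ _ Q2 Q3)). apply filter_imp.
  intros [z s] (A1 & A2 & A3). simpl in *. split; [exact A1|].
  replace (A' (al s + be s * z) - A' (al s + be s * z0)) with
   ((A' (al s + be s * z) - A' (al t + be t * z0)) + - (A' (al s + be s * z0) - A' (al t + be t * z0))) by ring.
  eapply Rle_trans; [apply Cmod_triangle|]. rewrite Cmod_opp. lra. }
assert (Hz0 : forall d, (0 < d) -> (Cmod (z0 - z0) < d)%R).
{ intros d Hd. now rewrite Cmod_minus_self. }
apply cder_eps; intros eps He.
assert (em : (0 < eps / M)%R) by now apply Rdiv_lt_0_compat.
destruct (U _ em) as (d & Hd & K).
exists d; split; [exact Hd|]. intros w Hw.
assert (C1 : forall z, (Cmod (z - z0) < d)%R -> cont01 (fun t => A (al t + be t * z) * B t)).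
{ intros z Hz t Ht. apply ccont_mult; [|now apply HB].
  apply (ccont_comp A (fun t => al t + be t * z)); [now apply Cp|].
  eapply cder_ccont. exact (proj1 (K z Hz t Ht)). }
assert (C2 : cont01 (fun t => A' (al t + be t * z0) * (be t * B t))).
{ intros t Ht. apply ccont_mult.
  - apply (ccont_comp A' (fun t => al t + be t * z0)); [now apply Cp|now apply HA'].
  - apply ccont_mult; [now apply Hbe|now apply HB]. }
assert (C3 : cont01 (fun t => (w - z0) * (A' (al t + be t * z0) * (be t * B t)))).
{ intros t Ht. apply ccont_mult; [apply ccont_const|now apply C2]. }
assert (C4 : cont01 (fun t => A (al t + be t * w) * B t - A (al t + be t * z0) * B t)).
{ intros t Ht. apply ccont_minus; apply C1; auto. }
rewrite <- CInt_minus by (apply C1; auto).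
rewrite (Cmult_comm (CInt _) (w - z0)), <- CInt_scal by exact C2.
rewrite <- CInt_minus by assumption.
apply CInt_bound.
{ intros t Ht. apply ccont_minus; [now apply C4|now apply C3]. }
intros t Ht.
replace (A (al t + be t * w) * B t - A (al t + be t * z0) * B t - (w - z0) * (A' (al t + be t * z0) * (be t * B t)))
  with ((A (al t + be t * w) - A (al t + be t * z0) - A' (al t + be t * z0) * ((al t + be t * w) - (al t + be t * z0))) * B t) by ring.
rewrite Cmod_mult.
assert (V : (Cmod (A (al t + be t * w) - A (al t + be t * z0) - A' (al t + be t * z0) * ((al t + be t * w) - (al t + be t * z0)))%C
    <= eps / M * Cmod ((al t + be t * w) - (al t + be t * z0))%C)%R).
{ apply (mean_value_bound A A'). intros s Hs.
  replace (seg (al t + be t * z0) (al t + be t * w) s) with (al t + be t * seg z0 w s) by (unfold seg; ring).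
  apply K; [|exact Ht]. apply seg_in_open_ball; auto. }
eapply Rle_trans; [apply Rmult_le_compat_r; [apply Cmod_ge_0|exact V]|].
replace (al t + be t * w - (al t + be t * z0)) with (be t * (w - z0)) by ring.
rewrite Cmod_mult.
replace (eps / M * (Cmod (be t) * Cmod (w - z0)) * Cmod (B t))%R with
  ((eps / M) * Cmod (w - z0) * (Cmod (be t) * Cmod (B t)))%R by ring.
rewrite <- Cmod_mult.
apply Rle_trans with (eps / M * Cmod (w - z0) * M)%R.
- apply Rmult_le_compat_l; [|now apply HM]. apply Rmult_le_pos; [lra|apply Cmod_ge_0].
- right; field; lra.
Qed.

(** * The function exp (2 pi i z) *)

Definition expi (z : C) : C :=
  (exp (- (2 * PI * Im z)) * cos (2 * PI * Re z), exp (- (2 * PI * Im z)) * sin (2 * PI * Re z))%R.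

Lemma expi_plus (z w : C) : expi (z + w) = expi z * expi w.
Proof.
unfold expi. rewrite re_plus, im_plus.
replace (- (2 * PI * (Im z + Im w)))%R with (- (2 * PI * Im z) + - (2 * PI * Im w))%R by ring.
rewrite exp_plus, Rmult_plus_distr_l, cos_plus, sin_plus.
unfold Cmult; simpl. apply (f_equal2 (@pair R R)); ring.
Qed.

Lemma expi_1 : expi 1 = 1.
Proof.
unfold expi, RtoC, Re, Im; simpl.
rewrite Rmult_0_r, Ropp_0, exp_0, Rmult_1_r, cos_2PI, sin_2PI.
apply (f_equal2 (@pair R R)); ring.
Qed.

Lemma expi_0 : expi 0 = 1.
Proof.
unfold expi, RtoC, Re, Im; simpl.
rewrite Rmult_0_r, Ropp_0, exp_0, cos_0, sin_0.
apply (f_equal2 (@pair R R)); ring.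
Qed.

Lemma expi_neq_0 (z : C) : expi z <> 0.
Proof.
intros H. assert (K : expi z * expi (- z) = 1).
{ rewrite <- expi_plus. replace (z + - z) with (RtoC 0) by ring. apply expi_0. }
rewrite H in K. apply C1_nz. rewrite <- K. ring.
Qed.

Lemma expi_period (z : C) : expi (z + 1) = expi z.
Proof. rewrite expi_plus, expi_1. ring. Qed.

Lemma Cmod_expi (z : C) : Cmod (expi z) = exp (- (2 * PI * Im z)).
Proof.
unfold expi, Cmod; simpl. set (E := exp _).
replace (E * cos (2 * PI * Re z) * (E * cos (2 * PI * Re z) * 1) +
   E * sin (2 * PI * Re z) * (E * sin (2 * PI * Re z) * 1))%R with
  (E * E * (Rsqr (sin (2 * PI * Re z)) + Rsqr (cos (2 * PI * Re z))))%R by (unfold Rsqr; ring).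
rewrite sin2_cos2, Rmult_1_r. apply sqrt_square. left; apply exp_pos.
Qed.

Lemma real_little_o (f : R -> R) (l : R) : is_derive f 0 l ->
  forall eps, (0 < eps) -> exists d, (0 < d) /\ forall h, (Rabs h < d)%R ->
   (Rabs (f h - f 0 - l * h) <= eps * Rabs h)%R.
Proof.
intros [_ H] eps He.
destruct (H 0%R (fun P HP => HP) (mkposreal eps He)) as [d Hd]; simpl in Hd.
exists d; split; [apply cond_pos|]. intros h Hh.
assert (Hb : ball (M := AbsRing_UniformSpace R_AbsRing) 0%R d h).
{ change (Rabs (h - 0) < d)%R. now rewrite Rminus_0_r. }
generalize (Hd h Hb). unfold norm, minus, plus, opp, scal; simpl; unfold mult, abs; simpl.
now rewrite Ropp_0, Rplus_0_r, (Rmult_comm l).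
Qed.

Definition two_pi_i : C := (0, 2 * PI)%R.

(** Split the value into [exp (- 2 pi y)] and [(cos (2 pi x), sin (2 pi x))] and expand
    both factors to first order. *)
Lemma expi_cder_0 : cder expi 0 two_pi_i.
Proof.
apply cder_eps. intros eps He. rewrite expi_0.
assert (p0 := PI_RGT_0).
assert (e6 : (0 < eps / 6)%R) by lra.
destruct (real_little_o (fun x => cos (2 * PI * x)) 0) with (eps := (eps / 6)%R) as (d1 & Hd1 & K1); [|lra|].
{ auto_derive; [trivial|]. rewrite Rmult_0_r, sin_0. ring. }
destruct (real_little_o (fun x => sin (2 * PI * x)) (2 * PI)) with (eps := (eps / 6)%R) as (d2 & Hd2 & K2); [|lra|].
{ auto_derive; [trivial|]. rewrite Rmult_0_r, cos_0. ring. }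
destruct (real_little_o (fun x => exp (- (2 * PI * x))) (- (2 * PI))) with (eps := (eps / 6)%R) as (d3 & Hd3 & K3); [|lra|].
{ auto_derive; [trivial|]. rewrite Rmult_0_r, Ropp_0, exp_0. ring. }
set (d4 := Rmin (/ (2 * PI)) (eps / 6 / (4 * PI * PI))%R).
assert (Hd4 : (0 < d4)).
{ apply Rmin_pos; [apply Rinv_0_lt_compat; lra|]. apply Rdiv_lt_0_compat; [lra|]. nra. }
exists (Rmin (Rmin d1 d2) (Rmin d3 d4)). split; [apply Rmin_pos; apply Rmin_pos; assumption|].
intros [x y] Hw.
assert (L : (Cmod (x, y) < Rmin (Rmin d1 d2) (Rmin d3 d4))%R).
{ rewrite Cminus_0_r in Hw. exact Hw. }
rewrite Cminus_0_r. clear Hw.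
set (h := Cmod (x, y)) in *.
assert (Hx : (Rabs x <= h)%R) by (eapply Rle_trans; [|exact (Rmax_Cmod (x, y))]; apply Rmax_l).
assert (Hy : (Rabs y <= h)%R) by (eapply Rle_trans; [|exact (Rmax_Cmod (x, y))]; apply Rmax_r).
assert (M1 := Rmin_l (Rmin d1 d2) (Rmin d3 d4)). assert (M2 := Rmin_r (Rmin d1 d2) (Rmin d3 d4)).
assert (M3 := Rmin_l d1 d2). assert (M4 := Rmin_r d1 d2).
assert (M5 := Rmin_l d3 d4). assert (M6 := Rmin_r d3 d4).
specialize (K1 x ltac:(lra)). specialize (K2 x ltac:(lra)). specialize (K3 y ltac:(lra)).
rewrite !Rmult_0_r in *. rewrite Ropp_0 in *. rewrite cos_0 in K1. rewrite sin_0 in K2. rewrite exp_0 in K3.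
set (X := (cos (2 * PI * x) - 1 - 0 * x)%R) in *.
set (Y := (sin (2 * PI * x) - 0 - 2 * PI * x)%R) in *.
set (W := (exp (- (2 * PI * y)) - 1 - - (2 * PI) * y)%R) in *.
assert (E : expi (x, y) - 1 - two_pi_i * (x, y) =
  (RtoC W * expi (RtoC x) + RtoC (1 - 2 * PI * y) * (X, Y)) + RtoC (- (2 * PI * y)) * (0, 2 * PI * x)%R).
{ unfold expi, two_pi_i, RtoC, Cminus, Cplus, Copp, Cmult, Re, Im, X, Y, W; simpl.
  rewrite Rmult_0_r, Ropp_0, exp_0. apply (f_equal2 (@pair R R)); ring. }
rewrite E. clear E.
assert (N4 : (h <= d4)) by lra.
assert (h0 : (0 <= h)) by apply Cmod_ge_0.
assert (Q1 : (2 * PI * h <= 1)%R).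
{ assert (T : (h <= / (2 * PI))%R) by (eapply Rle_trans; [exact N4|apply Rmin_l]).
  apply Rmult_le_compat_l with (r := (2 * PI)%R) in T; [|lra]. rewrite Rinv_r in T; lra. }
assert (Q2 : (4 * PI * PI * h <= eps / 6)%R).
{ assert (T : (h <= eps / 6 / (4 * PI * PI))%R) by (eapply Rle_trans; [exact N4|apply Rmin_r]).
  apply Rmult_le_compat_l with (r := (4 * PI * PI)%R) in T; [|nra].
  replace (4 * PI * PI * (eps / 6 / (4 * PI * PI)))%R with (eps / 6)%R in T by (field; lra). exact T. }
eapply Rle_trans; [apply Cmod_triangle|].
eapply Rle_trans; [apply Rplus_le_compat_r, Cmod_triangle|].
rewrite !Cmod_mult, Cmod_expi, !Cmod_R.
replace (Im (RtoC x)) with 0%R by reflexivity. rewrite Rmult_0_r, Ropp_0, exp_0, Rmult_1_r.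
assert (R1 : (Rabs W <= eps / 6 * h)%R) by nra.
assert (R2 : (Rabs (1 - 2 * PI * y) <= 2)%R).
{ apply Rabs_le. assert (Rabs (2 * PI * y) <= 1)%R.
  { rewrite Rabs_mult, (Rabs_pos_eq (2 * PI)) by lra. nra. }
  apply Rabs_le_between in H. lra. }
assert (R3 : (Cmod (X, Y) <= 2 * (eps / 6) * h)%R).
{ replace ((X, Y) : C) with (RtoC X + Ci * RtoC Y).
  2:{ unfold Cplus, Cmult, Ci, RtoC; simpl. apply (f_equal2 (@pair R R)); ring. }
  eapply Rle_trans; [apply Cmod_triangle|]. rewrite Cmod_mult, Cmod_Ci, !Cmod_R, Rmult_1_l.
  nra. }
assert (R4 : (Cmod (0, 2 * PI * x)%R <= 2 * PI * h)%R).
{ replace ((0, 2 * PI * x)%R : C) with (Ci * RtoC (2 * PI * x)).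
  2:{ unfold Cmult, Ci, RtoC; simpl. apply (f_equal2 (@pair R R)); ring. }
  rewrite Cmod_mult, Cmod_Ci, Cmod_R, Rmult_1_l, Rabs_mult, Rabs_pos_eq by lra. nra. }
assert (R5 : (Rabs (- (2 * PI * y)) <= 2 * PI * h)%R).
{ rewrite Rabs_Ropp, Rabs_mult, (Rabs_pos_eq (2 * PI)) by lra. nra. }
assert (S1 : (Rabs (1 - 2 * PI * y) * Cmod (X, Y) <= 2 * (2 * (eps / 6) * h))%R)
 by (apply Rmult_le_compat; auto using Rabs_pos, Cmod_ge_0).
assert (S2 : (Rabs (- (2 * PI * y)) * Cmod (0, 2 * PI * x)%R <= 2 * PI * h * (2 * PI * h))%R)
 by (apply Rmult_le_compat; auto using Rabs_pos, Cmod_ge_0).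
assert (S3 : (2 * PI * h * (2 * PI * h) <= eps / 6 * h)%R).
{ replace (2 * PI * h * (2 * PI * h))%R with (4 * PI * PI * h * h)%R by ring. now apply Rmult_le_compat_r. }
lra.
Qed.

Lemma expi_cder (z : C) : cder expi z (two_pi_i * expi z).
Proof.
apply (cder_ext (fun w => expi z * expi (w - z))).
{ intros w. rewrite <- expi_plus. f_equal. ring. }
eapply cder_eq.
- apply cder_mult; [apply cder_const|].
  apply (cder_comp expi (fun w => w - z)).
  + replace (z - z) with (RtoC 0) by ring. exact expi_cder_0.
  + apply cder_minus; [apply cder_id|apply cder_const].
- simpl. ring.
Qed.

Lemma two_pi_i_neq_0 : two_pi_i <> 0.
Proof. intros H. injection H. generalize PI_RGT_0. lra. Qed.

Lemma expi_eq_1 (z : C) : expi z = 1 -> exists k : Z, z = RtoC (IZR k).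
Proof.
intros H.
assert (M := Cmod_expi z). rewrite H, Cmod_1 in M. 
assert (Hi : Im z = 0%R).
{ symmetry in M. rewrite <- exp_0 in M. apply exp_inv in M. generalize PI_RGT_0; nra. }
assert (Hc : cos (2 * PI * Re z) = 1%R).
{ apply (f_equal fst) in H. unfold expi in H. simpl in H.
  rewrite Hi, Rmult_0_r, Ropp_0, exp_0, Rmult_1_l in H. exact H. }
assert (Hs : sin (PI * Re z) = 0%R).
{ replace (2 * PI * Re z)%R with (2 * (PI * Re z))%R in Hc by ring.
  rewrite cos_2a_sin in Hc. nra. }
apply sin_eq_0_0 in Hs. destruct Hs as [k Hk]. exists k.
assert (Hr : Re z = IZR k).
{ apply Rmult_eq_reg_l with PI; [|apply Rgt_not_eq, PI_RGT_0]. rewrite Hk. ring. }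
rewrite <- Hr. destruct z as [x y]. unfold Re, Im, RtoC in *. simpl in *. now rewrite Hi.
Qed.

Lemma CInt_FTC_real (H h : C -> C) :
  (forall t : R, (0 <= t <= 1) -> cder H (RtoC t) (h (RtoC t))) ->
  (forall t : R, (0 <= t <= 1) -> ccont h (RtoC t)) ->
  CInt (fun t => h (RtoC t)) = H 1 - H 0.
Proof.
intros H1 H2.
assert (E : forall t, seg 0 1 t = RtoC t) by (intros; unfold seg; ring).
rewrite <- (seg_int_FTC H h 0 1).
- unfold seg_int. rewrite (CInt_ext (fun t => h (seg 0 1 t)) (fun t => h (RtoC t))) by (intros; now rewrite E). ring.
- intros t Ht. rewrite E. now apply H1.
- intros t Ht. rewrite E. now apply H2.
Qed.

Lemma cder_pow (f : C -> C) (z l : C) (n : nat) : cder f z l ->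
  cder (fun w => f w ^ S n) z (RtoC (INR (S n)) * f z ^ n * l).
Proof.
intros H. induction n as [|n IH].
- apply (cder_ext f); [intros; simpl; ring|]. eapply cder_eq; [exact H|]. simpl. ring.
- apply (cder_ext (fun w => f w * f w ^ S n)); [reflexivity|].
  eapply cder_eq; [apply cder_mult; [exact H|exact IH]|].
  rewrite (S_INR (S n)), RtoC_plus. simpl Cpow. ring.
Qed.

Lemma cder_inv_pow (z : C) (n : nat) : z <> 0 ->
  cder (fun w => (/ w) ^ S n) z (- RtoC (INR (S n)) * (/ z) ^ S (S n)).
Proof.
intros Hz. eapply cder_eq; [apply cder_pow; now apply cder_inv|]. simpl Cpow. field. exact Hz.
Qed.

Lemma ccont_pow {T : UniformSpace} (f : T -> C) (x : T) (n : nat) :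
  ccont f x -> ccont (fun y => f y ^ n) x.
Proof.
intros H; induction n; [apply ccont_const|]. simpl. now apply ccont_mult.
Qed.

Lemma locally_neq_0 (z : C) : z <> 0 -> locally (T := C_UniformSpace) z (fun w => (w : C) <> 0).
Proof.
intros H. apply locally_Cmod. exists (Cmod z). split; [now apply Cmod_gt_0|].
intros w Hw ->. replace (0 - z) with (- z) in Hw by ring. rewrite Cmod_opp in Hw. lra.
Qed.

Lemma locally_in_ball (c z : C) (r : R) : (Cmod (z - c) < r)%R ->
  locally (T := C_UniformSpace) z (fun w => (Cmod (w - c) < r)%R).
Proof.
intros H. apply locally_Cmod. exists (r - Cmod (z - c))%R. split; [lra|].
intros w Hw. replace (w - c) with ((w - z) + (z - c)) by ring.
eapply Rle_lt_trans; [apply Cmod_triangle|]. lra.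
Qed.

(** * Cauchy's formula on circles *)

Section Cauchy.
Variables (F F' : C -> C) (z0 : C) (r rad : R).
Hypothesis Hr : (0 < r < rad).
Hypothesis HF : forall z, (Cmod (z - z0) < rad)%R -> cder F z (F' z).
Hypothesis HF' : forall z, (Cmod (z - z0) < rad)%R -> ccont F' z.

Definition circ (z : C) : C := z0 + RtoC r * expi z.
Definition dcirc (z : C) : C := RtoC r * (two_pi_i * expi z).

Lemma circ_cder (z : C) : cder circ z (dcirc z).
Proof.
eapply cder_eq; [apply cder_plus; [apply cder_const|apply cder_mult; [apply cder_const|apply expi_cder]]|].
unfold dcirc. simpl. ring.
Qed.

Lemma circ_ccont (z : C) : ccont circ z.
Proof. eapply cder_ccont, circ_cder. Qed.

Lemma dcirc_ccont (z : C) : ccont dcirc z.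
Proof.
unfold dcirc. apply ccont_mult; [apply ccont_const|]. apply ccont_mult; [apply ccont_const|].
eapply cder_ccont, expi_cder.
Qed.

Lemma Cmod_circ (t : R) : Cmod (circ (RtoC t) - z0) = r.
Proof.
unfold circ. replace (z0 + RtoC r * expi (RtoC t) - z0) with (RtoC r * expi (RtoC t)) by ring.
rewrite Cmod_mult, Cmod_expi, Cmod_R, Rabs_pos_eq by lra.
unfold RtoC, Im; simpl. now rewrite Rmult_0_r, Ropp_0, exp_0, Rmult_1_r.
Qed.

Lemma circ_neq (a : C) (t : R) : (Cmod (a - z0) < r)%R -> circ (RtoC t) - a <> 0.
Proof.
intros Ha E. assert (circ (RtoC t) = a). { replace a with (circ (RtoC t) - (circ (RtoC t) - a)) by ring. rewrite E. ring. }
generalize (Cmod_circ t). rewrite H. lra.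
Qed.

Lemma circ_inv_pow_cder (B : R -> C) (n : nat) (a : C) : cont01 B -> (Cmod (a - z0) < r)%R ->
  cder (fun a => CInt (fun t => (/ (circ (RtoC t) - a)) ^ S n * B t)) a
    (RtoC (INR (S n)) * CInt (fun t => (/ (circ (RtoC t) - a)) ^ S (S n) * B t)).
Proof.
intros HB Ha.
assert (E : forall t, circ (RtoC t) + - (1) * a = circ (RtoC t) - a) by (intros; ring).
eapply cder_eq.
- apply (cder_ext (fun a => CInt (fun t => (/ (circ (RtoC t) + - (1) * a)) ^ S n * B t))).
  { intros w; apply CInt_ext; intros t _. do 3 f_equal. ring. }
  apply (cder_under_int (fun w => (/ w) ^ S n) (fun w => - RtoC (INR (S n)) * (/ w) ^ S (S n))
    (fun t => circ (RtoC t)) (fun _ => - (1)) B).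
  + intros t _. apply ccont_along_R, circ_ccont.
  + intros t _. apply ccont_const.
  + exact HB.
  + intros t _. rewrite E. generalize (locally_neq_0 _ (circ_neq a t Ha)).
    apply filter_imp. intros w Hw. now apply cder_inv_pow.
  + intros t _. rewrite E. apply ccont_mult; [apply ccont_const|]. apply ccont_pow.
    apply ccont_inv; [apply continuous_id|now apply circ_neq].
- rewrite <- CInt_scal.
  + apply CInt_ext. intros t _. rewrite E. simpl. ring.
  + intros t Ht. apply ccont_mult; [|now apply HB]. apply ccont_pow, ccont_inv; [|now apply circ_neq].
    apply ccont_minus; [apply ccont_along_R, circ_ccont|apply ccont_const].
Qed.

Lemma dcirc_cont01 : cont01 (fun t => dcirc (RtoC t)).
Proof. intros t _. apply ccont_along_R, dcirc_ccont. Qed.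

(** The integral does not depend on [a]: its derivative is the integral over a closed
    curve of the derivative of [- / (circ z - a)]. At the centre it is computed
    directly. *)
Lemma winding_number (a : C) : (Cmod (a - z0) < r)%R ->
  CInt (fun t => (/ (circ (RtoC t) - a)) ^ 1 * dcirc (RtoC t)) = two_pi_i.
Proof.
intros Ha.
rewrite (constant_of_zero_derivative (fun a => CInt (fun t => (/ (circ (RtoC t) - a)) ^ 1 * dcirc (RtoC t))) z0 a).
- rewrite <- (CInt_const two_pi_i). apply CInt_ext. intros t _.
  unfold circ, dcirc. simpl.
  replace (z0 + RtoC r * expi (RtoC t) - z0) with (RtoC r * expi (RtoC t)) by ring.
  field. split; [apply expi_neq_0|]. intros K; apply RtoC_inj in K; lra.
- intros s Hs.
  assert (Hb : (Cmod (seg z0 a s - z0) < r)%R).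
  { apply seg_in_open_ball; [|exact Ha|exact Hs]. rewrite Cmod_minus_self; lra. }
  set (b := seg z0 a s) in *.
  eapply cder_eq; [apply circ_inv_pow_cder; [apply dcirc_cont01|exact Hb]|].
  cbv beta. rewrite (CInt_FTC_real (fun z => - / (circ z - b)) (fun z => (/ (circ z - b)) ^ 2 * dcirc z)).
  + unfold circ. rewrite expi_0, expi_1. ring.
  + intros t _. eapply cder_eq.
    * apply cder_opp. apply (cder_comp (fun w => / w) (fun z => circ z - b)); [now apply cder_inv, circ_neq|].
      apply cder_minus; [apply circ_cder|apply cder_const].
    * simpl. field. now apply circ_neq.
  + intros t _. apply ccont_mult; [|apply dcirc_ccont].
    apply ccont_pow, ccont_inv; [|now apply circ_neq].
    apply ccont_minus; [apply circ_ccont|apply ccont_const].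
Qed.

Lemma circ_in_ball (t : R) : (Cmod (circ (RtoC t) - z0) < rad)%R.
Proof. rewrite Cmod_circ. lra. Qed.

(** Contract the values of [F] to the point [a]: with [F] evaluated at [a + s * (w - a)]
    the integral has, as a function of [s], the derivative
    [CInt (F' (a + s * (w - a)) * dw)], the integral of an exact form over a closed
    curve, so the values at [s = 1] and at [s = 0] agree. Continuity of [F'] is assumed;
    Goursat's theorem removes this assumption afterwards, because it provides a
    primitive with continuous derivative. *)
Lemma Cauchy_formula (a : C) : (Cmod (a - z0) < r)%R ->
  CInt (fun t => (/ (circ (RtoC t) - a)) ^ 1 * (F (circ (RtoC t)) * dcirc (RtoC t))) = two_pi_i * F a.
Proof.
intros Ha.
set (B := fun t => dcirc (RtoC t) / (circ (RtoC t) - a)).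
assert (HB : cont01 B).
{ intros t _. unfold B, Cdiv. apply ccont_mult; [apply ccont_along_R, dcirc_ccont|].
  apply ccont_inv; [|now apply circ_neq]. apply ccont_minus; [apply ccont_along_R, circ_ccont|apply ccont_const]. }
set (g := fun s => CInt (fun t => F (a + (circ (RtoC t) - a) * s) * B t)).
assert (Es : forall t s, a + (circ (RtoC t) - a) * RtoC s = seg a (circ (RtoC t)) s)
  by (intros; unfold seg; ring).
assert (Ins : forall t s, (0 <= s <= 1) -> (Cmod (seg a (circ (RtoC t)) s - z0) < rad)%R).
{ intros t s Hs. apply seg_in_open_ball; [lra|apply circ_in_ball|exact Hs]. }
assert (Hg : g 1 = g 0).
{ apply constant_of_zero_derivative. intros s Hs.
  assert (E01 : seg 0 1 s = RtoC s) by (unfold seg; ring). rewrite E01. clear E01.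
  eapply cder_eq.
  - apply (cder_under_int F F' (fun _ => a) (fun t => circ (RtoC t) - a) B).
    + intros t _; apply ccont_const.
    + intros t _. apply ccont_minus; [apply ccont_along_R, circ_ccont|apply ccont_const].
    + exact HB.
    + intros t _. rewrite Es. generalize (locally_in_ball _ _ _ (Ins t s Hs)).
      apply filter_imp. intros w; apply HF.
    + intros t _. rewrite Es. now apply HF', Ins.
  - transitivity (CInt (fun t => F' (a + (circ (RtoC t) - a) * RtoC s) * dcirc (RtoC t))).
    { apply CInt_ext. intros t _. unfold B. field. now apply circ_neq. }
    destruct (Req_dec s 0) as [->|Hs0].
    + rewrite (CInt_FTC_real (fun z => F' a * circ z) (fun z => F' (a + (circ z - a) * 0) * dcirc z)).
      * unfold circ. rewrite expi_0, expi_1. ring.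
      * intros t _. eapply cder_eq; [apply cder_mult; [apply cder_const|apply circ_cder]|].
        replace (a + (circ (RtoC t) - a) * 0) with a by ring. simpl. ring.
      * intros t _. apply ccont_mult; [|apply dcirc_ccont].
        apply (ccont_comp F' (fun z => a + (circ z - a) * 0)).
        { apply ccont_plus; [apply ccont_const|]. apply ccont_mult; [|apply ccont_const].
          apply ccont_minus; [apply circ_ccont|apply ccont_const]. }
        replace (a + (circ (RtoC t) - a) * 0) with a by ring. apply HF'. lra.
    + assert (Hs1 : RtoC s <> 0) by (intros K; apply RtoC_inj in K; lra).
      rewrite (CInt_FTC_real (fun z => F (a + (circ z - a) * RtoC s) / RtoC s) (fun z => F' (a + (circ z - a) * RtoC s) * dcirc z)).
      * unfold circ. rewrite expi_0, expi_1. ring.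
      * intros t _. eapply cder_eq.
        { apply cder_mult; [|apply cder_const].
          apply (cder_comp F (fun z => a + (circ z - a) * RtoC s)).
          - rewrite Es. now apply HF, Ins.
          - apply cder_plus; [apply cder_const|]. apply cder_mult; [|apply cder_const].
            apply cder_minus; [apply circ_cder|apply cder_const]. }
        rewrite Es. simpl. field. exact Hs1.
      * intros t _. apply ccont_mult; [|apply dcirc_ccont].
        apply (ccont_comp F' (fun z => a + (circ z - a) * RtoC s)).
        { apply ccont_plus; [apply ccont_const|]. apply ccont_mult; [|apply ccont_const].
          apply ccont_minus; [apply circ_ccont|apply ccont_const]. }
        rewrite Es. now apply HF', Ins. }
transitivity (g 1).
{ apply CInt_ext. intros t _. replace (a + (circ (RtoC t) - a) * 1) with (circ (RtoC t)) by ring.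
  unfold B, Cdiv. simpl. ring. }
rewrite Hg. rewrite <- (winding_number a Ha), Cmult_comm, <- CInt_scal.
- apply CInt_ext. intros t _. replace (a + (circ (RtoC t) - a) * 0) with a by ring.
  unfold B, Cdiv. simpl. ring.
- intros t _. apply ccont_mult; [|apply ccont_along_R, dcirc_ccont].
  apply ccont_pow, ccont_inv; [|now apply circ_neq].
  apply ccont_minus; [apply ccont_along_R, circ_ccont|apply ccont_const].
Qed.

Lemma circ_F_cont01 : cont01 (fun t => F (circ (RtoC t)) * dcirc (RtoC t)).
Proof.
intros t Ht. apply ccont_mult; [|now apply dcirc_cont01].
apply (ccont_comp F (fun t => circ (RtoC t))); [apply ccont_along_R, circ_ccont|].
eapply cder_ccont, HF, circ_in_ball.
Qed.

Definition cauchy_int (n : nat) (a : C) : C :=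
  CInt (fun t => (/ (circ (RtoC t) - a)) ^ S n * (F (circ (RtoC t)) * dcirc (RtoC t))).

Lemma cauchy_int_cder (n : nat) (a : C) : (Cmod (a - z0) < r)%R ->
  cder (cauchy_int n) a (RtoC (INR (S n)) * cauchy_int (S n) a).
Proof. intros Ha. apply circ_inv_pow_cder; [apply circ_F_cont01|exact Ha]. Qed.

Lemma F_eq_cauchy (a : C) : (Cmod (a - z0) < r)%R -> F a = / two_pi_i * cauchy_int 0 a.
Proof.
intros Ha. unfold cauchy_int. rewrite Cauchy_formula by exact Ha. field. apply two_pi_i_neq_0.
Qed.

Lemma F'_eq_cauchy (a : C) : (Cmod (a - z0) < r)%R -> F' a = / two_pi_i * cauchy_int 1 a.
Proof.
intros Ha. apply (cder_unique F a); [apply HF; lra|].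
apply (cder_ext_loc (fun a => / two_pi_i * cauchy_int 0 a)).
- generalize (locally_in_ball z0 a r Ha). apply filter_imp. intros w Hw. symmetry; now apply F_eq_cauchy.
- eapply cder_eq; [apply cder_mult; [apply cder_const|apply cauchy_int_cder; exact Ha]|]. simpl. ring.
Qed.

(** A function with continuous derivative is twice differentiable, since it is given by
    Cauchy's formula, whose kernel can be differentiated any number of times. *)
Lemma F'_cder_cauchy (a : C) : (Cmod (a - z0) < r)%R -> cder F' a (/ two_pi_i * (2 * cauchy_int 2 a)).
Proof.
intros Ha.
apply (cder_ext_loc (fun a => / two_pi_i * cauchy_int 1 a)).
- generalize (locally_in_ball z0 a r Ha). apply filter_imp. intros w Hw. symmetry; now apply F'_eq_cauchy.
- eapply cder_eq; [apply cder_mult; [apply cder_const|apply cauchy_int_cder; exact Ha]|]. simpl.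
  replace (1 + 1)%R with 2%R by ring. ring.
Qed.
End Cauchy.

Lemma C_derive_cder (f : C -> C) (z l : C) : cder f z l -> cder f z (C_derive f z).
Proof.
intros H. replace (C_derive f z) with l; [exact H|]. symmetry. apply is_C_derive_unique. exact H.
Qed.

Lemma C_derive_eq (f : C -> C) (z l : C) : cder f z l -> C_derive f z = l.
Proof. apply is_C_derive_unique. Qed.

(** A differentiable function is the derivative of its primitive [F], and Cauchy's
    formula for [F] expresses it and its derivative by differentiable integrals. *)
Lemma C_derive_differentiable (f : C -> C) (z0 : C) (rad : R) :
  (forall z, (Cmod (z - z0) < rad)%R -> exists l, cder f z l) ->
  forall z, (Cmod (z - z0) < rad)%R -> exists l, cder (C_derive f) z l.
Proof.
intros Hf z Hz.
set (r := ((Cmod (z - z0) + rad) / 2)%R).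
assert (Hr : (0 < r < rad)) by (unfold r; generalize (Cmod_ge_0 (z - z0)); lra).
assert (Hzr : (Cmod (z - z0) < r)%R) by (unfold r; lra).
set (F := seg_int f z0).
assert (HF : forall w, (Cmod (w - z0) < rad)%R -> cder F w (f w)) by exact (ball_primitive f z0 rad Hf).
assert (HF' : forall w, (Cmod (w - z0) < rad)%R -> ccont f w) by exact (ball_ccont f z0 rad Hf).
assert (K : forall w, (Cmod (w - z0) < r)%R ->
   cder f w (/ two_pi_i * (2 * cauchy_int F z0 r 2 w))).
{ intros w Hw. exact (F'_cder_cauchy F f z0 r rad Hr HF HF' w Hw). }
eexists. apply (cder_ext_loc (fun w => / two_pi_i * (2 * cauchy_int F z0 r 2 w))).
- generalize (locally_in_ball z0 z r Hzr). apply filter_imp. intros w Hw. symmetry. now apply C_derive_eq, K.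
- apply cder_mult; [apply cder_const|]. apply cder_mult; [apply cder_const|].
  exact (cauchy_int_cder F f z0 r rad Hr HF 2 z Hzr).
Qed.

(** * Neighbourhoods and holomorphic functions *)

Notation near z P := (locally (T := C_UniformSpace) (z : C) P).
Notation near' z P := (locally' (T := C_UniformSpace) (z : C) P).

Lemma near_imp (z : C) (P Q : C -> Prop) : (forall w, P w -> Q w) -> near z P -> near z Q.
Proof. apply filter_imp. Qed.

Lemma near_near (z : C) (P : C -> Prop) : near z P -> near z (fun w => near w P).
Proof. apply (locally_locally (T := C_UniformSpace)). Qed.

Lemma near_near' (z : C) (P : C -> Prop) : near z P -> near' z P.
Proof. unfold locally', within. apply filter_imp; intros w H _; exact H. Qed.

Lemma near'_near (z : C) (P : C -> Prop) : near' z P -> near' z (fun w => near w P).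
Proof.
intros H. apply locally'_Cmod in H. destruct H as (d & Hd & H).
apply locally'_Cmod. exists d; split; [exact Hd|]. intros w Hw Hne.
assert (w - z <> 0) by now apply Cminus_eq_contra.
apply locally_Cmod. exists (Rmin (d - Cmod (w - z)) (Cmod (w - z))). split.
{ apply Rmin_pos; [lra|now apply Cmod_gt_0]. }
intros v Hv. apply H.
- replace (v - z) with ((v - w) + (w - z)) by ring. eapply Rle_lt_trans; [apply Cmod_triangle|].
  assert (X := Rmin_l (d - Cmod (w - z)) (Cmod (w - z))). lra.
- intros ->. assert (X := Rmin_r (d - Cmod (w - z)) (Cmod (w - z))).
  replace (z - w) with (- (w - z)) in Hv by ring. rewrite Cmod_opp in Hv. lra.
Qed.

Lemma near_of_near' (z : C) (P : C -> Prop) : near' z P -> P z -> near z P.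
Proof.
intros H Hz. unfold locally', within in H. revert H. apply near_imp. intros w Hw.
destruct (Ceq_dec w z) as [->|Hn]; [exact Hz|now apply Hw].
Qed.

Lemma near'_exists (z : C) (P : C -> Prop) (eps : R) : near' z P -> (0 < eps) ->
  exists w, w <> z /\ (Cmod (w - z) < eps)%R /\ P w.
Proof.
intros H He. apply locally'_Cmod in H. destruct H as (d & Hd & H).
set (m := (Rmin d eps / 2)%R).
assert (M0 : (0 < Rmin d eps)%R) by now apply Rmin_pos.
assert (E : Cmod (z + RtoC m - z) = m).
{ replace (z + RtoC m - z) with (RtoC m) by ring. rewrite Cmod_R, Rabs_pos_eq; unfold m; lra. }
assert (X := Rmin_l d eps). assert (Y := Rmin_r d eps).
assert (Hne : z + RtoC m <> z).
{ intros K. rewrite K in E. replace (z - z) with (RtoC 0) in E by ring. rewrite Cmod_0 in E. unfold m in E. lra. }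
exists (z + RtoC m). split; [exact Hne|].
split; [rewrite E; unfold m; lra|]. apply H; [rewrite E; unfold m; lra|exact Hne].
Qed.

Lemma near'_and (z : C) (P Q : C -> Prop) : near' z P -> near' z Q -> near' z (fun w => P w /\ Q w).
Proof. apply (filter_and (F := locally' (T := C_UniformSpace) z)). Qed.

Lemma near'_imp (z : C) (P Q : C -> Prop) : (forall w, w <> z -> P w -> Q w) -> near' z P -> near' z Q.
Proof. intros H; unfold locally', within; apply filter_imp; intros w Hw Hn; now apply H, Hw. Qed.

Lemma near'_forall (z : C) (P : C -> Prop) : (forall w, P w) -> near' z P.
Proof. intros H; unfold locally', within; apply filter_forall; intros w _; apply H. Qed.

Lemma ccont_unique' (f g : C -> C) (z : C) :
  ccont f z -> ccont g z -> near' z (fun w => f w = g w) -> f z = g z.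
Proof.
intros Hf Hg H.
apply Ceq_minus, Cmod_eq_0. apply Rle_antisym; [|apply Cmod_ge_0].
apply le_epsilon. intros eps He. rewrite Rplus_0_l.
assert (e2 : (0 < eps / 2)%R) by lra.
assert (A := near_near' _ _ (proj1 (ccont_eps f z) Hf _ e2)).
assert (B := near_near' _ _ (proj1 (ccont_eps g z) Hg _ e2)).
destruct (near'_exists _ _ 1 (near'_and _ _ _ H (near'_and _ _ _ A B)) Rlt_0_1) as (w & _ & _ & E & X & Y).
rewrite E in X.
replace (f z - g z) with (- (g w - f z) + (g w - g z)) by ring.
eapply Rle_trans; [apply Cmod_triangle|]. rewrite Cmod_opp. lra.
Qed.

Lemma hol_ball (f : C -> C) (z0 : C) : holomorphic_at f z0 <->
  exists r : R, (0 < r) /\ forall z, (Cmod (z - z0) < r)%R -> exists l, cder f z l.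
Proof. apply (locally_Cmod z0). Qed.

Lemma hol_near (f : C -> C) (z : C) : holomorphic_at f z -> near z (holomorphic_at f).
Proof. apply near_near. Qed.

Lemma hol_cder (f : C -> C) (z : C) : holomorphic_at f z -> cder f z (C_derive f z).
Proof.
intros H. apply hol_ball in H. destruct H as (r & Hr & H).
destruct (H z) as [l Hl]; [|eapply C_derive_cder; exact Hl].
now rewrite Cmod_minus_self.
Qed.

Lemma hol_of_cder (f g : C -> C) (z : C) : near z (fun w => cder f w (g w)) -> holomorphic_at f z.
Proof. unfold holomorphic_at. apply near_imp. intros w Hw. now exists (g w). Qed.

Lemma hol_near_cder (f : C -> C) (z : C) : holomorphic_at f z -> near z (fun w => cder f w (C_derive f w)).
Proof. intros H. generalize (hol_near f z H). apply near_imp. intros w Hw; now apply hol_cder. Qed.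

Lemma hol_ccont (f : C -> C) (z : C) : holomorphic_at f z -> ccont f z.
Proof. intros H. eapply cder_ccont, hol_cder, H. Qed.

Lemma hol_derive (f : C -> C) (z : C) : holomorphic_at f z -> holomorphic_at (C_derive f) z.
Proof.
intros H. apply hol_ball in H. destruct H as (r & Hr & H).
apply hol_ball. exists r; split; [exact Hr|]. exact (C_derive_differentiable f z r H).
Qed.

Lemma hol_ext (f g : C -> C) (z : C) : near z (fun w => f w = g w) -> holomorphic_at f z -> holomorphic_at g z.
Proof.
intros E H. unfold holomorphic_at in *. generalize (filter_and _ _ (near_near _ _ E) H). apply filter_imp.
intros w [A [l Hl]]. exists l. exact (cder_ext_loc f g w l A Hl).
Qed.

Lemma C_derive_ext (f g : C -> C) (z : C) : near z (fun w => f w = g w) -> holomorphic_at f z ->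
  C_derive g z = C_derive f z.
Proof. intros E H. apply C_derive_eq. exact (cder_ext_loc f g z _ E (hol_cder f z H)). Qed.

Lemma hol_const (c z : C) : holomorphic_at (fun _ => c) z.
Proof. unfold holomorphic_at. apply filter_forall. intros w. eexists; apply cder_const. Qed.
Lemma hol_id (z : C) : holomorphic_at (fun w => w) z.
Proof. unfold holomorphic_at. apply filter_forall. intros w. eexists; apply cder_id. Qed.

Lemma hol_plus (f g : C -> C) (z : C) : holomorphic_at f z -> holomorphic_at g z ->
  holomorphic_at (fun w => f w + g w) z.
Proof.
intros Hf Hg. unfold holomorphic_at in *. generalize (filter_and _ _ Hf Hg). apply filter_imp.
intros w [[a Ha] [b Hb]]. eexists; eapply cder_plus; [exact Ha|exact Hb].
Qed.
Lemma hol_minus (f g : C -> C) (z : C) : holomorphic_at f z -> holomorphic_at g z ->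
  holomorphic_at (fun w => f w - g w) z.
Proof.
intros Hf Hg. unfold holomorphic_at in *. generalize (filter_and _ _ Hf Hg). apply filter_imp.
intros w [[a Ha] [b Hb]]. eexists; eapply cder_minus; [exact Ha|exact Hb].
Qed.
Lemma hol_mult (f g : C -> C) (z : C) : holomorphic_at f z -> holomorphic_at g z ->
  holomorphic_at (fun w => f w * g w) z.
Proof.
intros Hf Hg. unfold holomorphic_at in *. generalize (filter_and _ _ Hf Hg). apply filter_imp.
intros w [[a Ha] [b Hb]]. eexists; eapply cder_mult; [exact Ha|exact Hb].
Qed.
Lemma hol_comp (f g : C -> C) (z : C) : holomorphic_at f (g z) -> holomorphic_at g z ->
  holomorphic_at (fun w => f (g w)) z.
Proof.
intros Hf Hg.
assert (A : near z (fun w => ex_derive (K := C_AbsRing) (V := C_NormedModule) f (g w)))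
  by exact (hol_ccont g z Hg _ Hf).
unfold holomorphic_at in *. generalize (filter_and _ _ A Hg). apply filter_imp.
intros w [[a Ha] [b Hb]]. eexists; eapply cder_comp; [exact Ha|exact Hb].
Qed.
Lemma hol_inv (f : C -> C) (z : C) : holomorphic_at f z -> f z <> 0 -> holomorphic_at (fun w => / f w) z.
Proof.
intros Hf Hz. apply (hol_comp (fun w => / w) f); [|exact Hf].
unfold holomorphic_at. generalize (locally_neq_0 _ Hz). apply near_imp. intros w Hw. eexists; now apply cder_inv.
Qed.
Lemma hol_pow (f : C -> C) (z : C) (n : nat) : holomorphic_at f z -> holomorphic_at (fun w => f w ^ n) z.
Proof.
intros H. induction n; [exact (hol_const 1 z)|]. exact (hol_mult f (fun w => f w ^ n) z H IHn).
Qed.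

Lemma near_shift (z c : C) (P : C -> Prop) : near (z + c) P -> near z (fun w => P (w + c)).
Proof.
intros H. apply locally_Cmod in H. destruct H as (d & Hd & H). apply locally_Cmod.
exists d; split; [exact Hd|]. intros w Hw. apply H. now replace (w + c - (z + c)) with (w - z) by ring.
Qed.

Lemma near'_shift (z c : C) (P : C -> Prop) : near' (z + c) P -> near' z (fun w => P (w + c)).
Proof.
intros H.
assert (E : forall u v : C, u + c = v + c -> u = v).
{ intros u v K. replace u with (u + c - c) by ring. rewrite K. ring. }
unfold locally', within in *. apply near_shift in H. revert H. apply near_imp. intros w Hw Hn. apply Hw.
intros K. exact (Hn (E _ _ K)).
Qed.

Lemma hol_shift (f : C -> C) (z c : C) : holomorphic_at f (z + c) -> holomorphic_at (fun w => f (w + c)) z.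
Proof. intros H. apply (hol_comp f (fun w => w + c)); [exact H|]. apply hol_plus; [apply hol_id|apply hol_const]. Qed.

(** * Zeros of holomorphic functions *)

(** Hadamard's lemma: [q z] is the average of the derivative of [f] over the segment
    from [z0] to [z], hence holomorphic by differentiation under the integral sign. *)
Lemma ball_factor (f : C -> C) (z0 : C) (rad : R) :
  (forall z, (Cmod (z - z0) < rad)%R -> exists l, cder f z l) ->
  exists q : C -> C, (forall z, (Cmod (z - z0) < rad)%R -> exists l, cder q z l) /\
    forall z, (Cmod (z - z0) < rad)%R -> f z = f z0 + (z - z0) * q z.
Proof.
intros Hf.
assert (Hf1 := C_derive_differentiable f z0 rad Hf).
assert (Hf2 := C_derive_differentiable _ z0 rad Hf1).
assert (Ins : forall z t, (Cmod (z - z0) < rad)%R -> (0 <= t <= 1) -> (Cmod (seg z0 z t - z0) < rad)%R).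
{ intros z t Hz Ht. apply seg_in_open_ball; trivial.
  rewrite Cmod_minus_self. eapply Rle_lt_trans; [apply Cmod_ge_0|exact Hz]. }
exists (fun z => CInt (fun t => C_derive f (RtoC (1 - t) * z0 + RtoC t * z) * 1)).
assert (Es : forall t z, RtoC (1 - t) * z0 + RtoC t * z = seg z0 z t)
 by (intros; unfold seg; rewrite RtoC_minus; ring).
split.
- intros z Hz. eexists.
  apply (cder_under_int (C_derive f) (C_derive (C_derive f)) (fun t => RtoC (1 - t) * z0) RtoC (fun _ => 1)).
  + intros t _. apply ccont_mult; [|apply ccont_const]. apply ccont_RtoC.
    apply (continuous_minus (V := R_space)); [apply continuous_const|apply continuous_id].
  + intros t _. apply ccont_RtoC_id.
  + intros t _. apply ccont_const.
  + intros t Ht. rewrite Es. generalize (locally_in_ball _ _ _ (Ins z t Hz Ht)). apply filter_imp.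
    intros w Hw. destruct (Hf1 w Hw) as [l Hl]. eapply C_derive_cder; exact Hl.
  + intros t Ht. rewrite Es. destruct (Hf2 _ (Ins z t Hz Ht)) as [l Hl]. eapply cder_ccont; exact Hl.
- intros z Hz.
  assert (E := seg_int_FTC f (C_derive f) z0 z).
  unfold seg_int in E.
  rewrite (CInt_ext (fun t => C_derive f (RtoC (1 - t) * z0 + RtoC t * z) * 1) (fun t => C_derive f (seg z0 z t)))
    by (intros; rewrite Es; ring).
  rewrite E; [ring| |].
  + intros t Ht. destruct (Hf _ (Ins z t Hz Ht)) as [l Hl]. eapply C_derive_cder; exact Hl.
  + intros t Ht. destruct (Hf1 _ (Ins z t Hz Ht)) as [l Hl]. eapply cder_ccont; exact Hl.
Qed.

Lemma hol_factor (f : C -> C) (z0 : C) : holomorphic_at f z0 ->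
  exists q : C -> C, holomorphic_at q z0 /\ near z0 (fun z => f z = f z0 + (z - z0) * q z).
Proof.
intros H. apply hol_ball in H. destruct H as (r & Hr & H).
destruct (ball_factor f z0 r H) as (q & H1 & H2). exists q. split.
- apply hol_ball. now exists r.
- apply locally_Cmod. now exists r.
Qed.

(** Split off factors [z - z0] as long as the cofactor vanishes at [z0]. If this never
    stops, then [f z = (z - z0) ^ n * s n z] for all [n], Cauchy's formula on a circle
    of radius [r] bounds [s n] by [2 * M / r ^ n] on the disc of radius [r / 2], and [f]
    is bounded there by [2 * M / 2 ^ n] for all [n]. *)
Lemma hol_zero_order (f : C -> C) (z0 : C) : holomorphic_at f z0 ->
  near z0 (fun z => f z = 0) \/
  exists (n : nat) (q : C -> C), holomorphic_at q z0 /\ q z0 <> 0 /\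
    near z0 (fun z => f z = (z - z0) ^ n * q z).
Proof.
intros H. apply hol_ball in H. destruct H as (rad & Hrad & Hf).
set (Inv := fun (n : nat) (q : C -> C) => (forall z, (Cmod (z - z0) < rad)%R -> exists l, cder q z l) /\
    forall z, (Cmod (z - z0) < rad)%R -> f z = (z - z0) ^ n * q z).
destruct (classic (exists n q, Inv n q /\ q z0 <> 0)) as [(n & q & (A & B) & D)|N].
{ right. exists n, q. split; [apply hol_ball; now exists rad|]. split; [exact D|].
  apply locally_Cmod. now exists rad. }
left.
destruct (dependent_choice Inv (fun _ _ _ => True)) as [s Hs].
{ exists f. split; [exact Hf|]. intros; simpl; ring. }
{ intros n q Hq. assert (q z0 = 0). { apply NNPP. intros K. apply N. now exists n, q. }
  destruct Hq as [A B]. destruct (ball_factor q z0 rad A) as (q' & A' & B').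
  exists q'. split; [|trivial]. split; [exact A'|]. intros z Hz. rewrite B, B', H by exact Hz. simpl. ring. }
set (r := (rad / 2)%R). assert (Hr : (0 < r < rad)) by (unfold r; lra).
destruct (cont01_bounded (fun t => f (circ z0 r (RtoC t)))) as (M & M0 & HM).
{ intros t _. apply (ccont_along_R (fun z => f (circ z0 r z))).
  apply (ccont_comp f (circ z0 r)); [apply circ_ccont|].
  destruct (Hf (circ z0 r (RtoC t))) as [l Hl]; [now rewrite (Cmod_circ z0 r rad Hr)|]. eapply cder_ccont; exact Hl. }
apply locally_Cmod. exists (r / 2)%R. split; [lra|]. intros a Ha.
apply Cmod_eq_0, Rle_antisym; [|apply Cmod_ge_0]. apply le_epsilon. intros eps He. rewrite Rplus_0_l.
assert (P2 : forall n, (0 < 2 ^ n)%R) by (intros; apply pow_lt; lra).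
assert (Bound : forall n, (Cmod (f a) <= 2 * M / 2 ^ n)%R).
{ intros n. destruct (Hs n) as [[A B] _].
  assert (rn : (0 < r ^ n)%R) by (apply pow_lt; lra).
  assert (HF : forall z, (Cmod (z - z0) < rad)%R -> cder (s n) z (C_derive (s n) z)).
  { intros z Hz. destruct (A z Hz) as [l Hl]. eapply C_derive_cder; exact Hl. }
  assert (HF' : forall z, (Cmod (z - z0) < rad)%R -> ccont (C_derive (s n)) z).
  { intros z Hz. destruct (C_derive_differentiable _ z0 rad A z Hz) as [l Hl]. eapply cder_ccont; exact Hl. }
  assert (Har : (Cmod (a - z0) < r)%R) by lra.
  assert (E := Cauchy_formula (s n) (C_derive (s n)) z0 r rad Hr HF HF' a Har).
  set (tp := Cmod two_pi_i).
  assert (tp0 : (0 < tp)) by (apply Cmod_gt_0, two_pi_i_neq_0).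
  assert (Q : (tp * Cmod (s n a) <= tp * (2 * M / r ^ n))%R).
  { unfold tp at 1. rewrite <- Cmod_mult, <- E.
    apply CInt_bound.
    - intros t Ht. apply ccont_mult.
      + apply ccont_pow, ccont_inv; [|now apply (circ_neq z0 r rad Hr)].
        apply ccont_minus; [apply (ccont_along_R (circ z0 r)), circ_ccont|apply ccont_const].
      + now apply (circ_F_cont01 (s n) (C_derive (s n)) z0 r rad Hr HF).
    - intros t Ht. set (w := circ z0 r (RtoC t)).
      assert (Hw : Cmod (w - z0) = r) by apply (Cmod_circ z0 r rad Hr).
      assert (Hwa : (r / 2 <= Cmod (w - a))%R).
      { assert (r <= Cmod (w - a) + Cmod (a - z0))%R; [|lra]. rewrite <- Hw.
        replace (w - z0) with ((w - a) + (a - z0)) by ring. apply Cmod_triangle. }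
      assert (Hne : w - a <> 0) by (apply Cmod_gt_0; lra).
      rewrite !Cmod_mult. simpl Cpow. rewrite Cmult_1_r, Cmod_inv by exact Hne.
      assert (D : Cmod (dcirc r (RtoC t)) = (r * tp)%R).
      { unfold dcirc. rewrite !Cmod_mult, Cmod_R, Rabs_pos_eq, Cmod_expi by lra. fold tp.
        replace (Im (RtoC t)) with 0%R by reflexivity. rewrite Rmult_0_r, Ropp_0, exp_0. ring. }
      rewrite D.
      assert (S1 : (Cmod (s n w) <= M / r ^ n)%R).
      { assert (X := B w ltac:(lra)). assert (Y := HM t Ht). fold w in Y. rewrite X, Cmod_mult, Cmod_pow, Hw in Y.
        apply Rmult_le_reg_l with (r ^ n)%R; [exact rn|].
        replace (r ^ n * (M / r ^ n))%R with M by (field; lra). exact Y. }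
      assert (S2 : (/ Cmod (w - a) <= 2 / r)%R).
      { replace (2 / r)%R with (/ (r / 2))%R by (field; lra). apply Rinv_le_contravar; lra. }
      apply Rle_trans with (2 / r * (M / r ^ n * (r * tp)))%R.
      + apply Rmult_le_compat; [left; apply Rinv_0_lt_compat; lra| |exact S2|].
        * apply Rmult_le_pos; [apply Cmod_ge_0|]. apply Rmult_le_pos; lra.
        * apply Rmult_le_compat_r; [apply Rmult_le_pos; lra|exact S1].
      + right. field. lra. }
  apply Rmult_le_reg_l in Q; [|exact tp0].
  rewrite (B a) by lra. rewrite Cmod_mult, Cmod_pow.
  apply Rle_trans with ((r / 2) ^ n * (2 * M / r ^ n))%R.
  - apply Rmult_le_compat; [apply pow_le, Cmod_ge_0|apply Cmod_ge_0| |exact Q].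
    apply pow_incr. split; [apply Cmod_ge_0|lra].
  - right. unfold Rdiv at 1. rewrite Rpow_mult_distr, pow_inv. field.
    split; apply Rgt_not_eq; [apply P2|exact rn]. }
destruct (div_pow2_small (2 * M) eps ltac:(lra) He) as [n Hn].
eapply Rle_trans; [apply (Bound n)|lra].
Qed.

(** * Regular and meromorphic functions *)

Lemma regular_ext (f g : C -> C) (z : C) : near' z (fun w => f w = g w) -> regular_at f z -> regular_at g z.
Proof.
intros E (h & H1 & H2). exists h. split; [exact H1|].
generalize (near'_and _ _ _ E H2). apply near'_imp. intros w _ [A B]. now rewrite <- A.
Qed.

Lemma meromorphic_ext (f g : C -> C) (z : C) : near' z (fun w => f w = g w) -> meromorphic_at f z -> meromorphic_at g z.
Proof.
intros E (n & H). exists n. revert H. apply regular_ext. revert E. apply near'_imp. intros w _ ->. reflexivity.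
Qed.

Lemma hol_regular (f : C -> C) (z : C) : holomorphic_at f z -> regular_at f z.
Proof. intros H. exists f. split; [exact H|now apply near'_forall]. Qed.

Lemma regular_plus (f g : C -> C) (z : C) : regular_at f z -> regular_at g z -> regular_at (fun w => f w + g w) z.
Proof.
intros (h & H1 & H2) (k & K1 & K2). exists (fun w => h w + k w). split; [now apply hol_plus|].
generalize (near'_and _ _ _ H2 K2). apply near'_imp. intros w _ [-> ->]. reflexivity.
Qed.

Lemma regular_mult (f g : C -> C) (z : C) : regular_at f z -> regular_at g z -> regular_at (fun w => f w * g w) z.
Proof.
intros (h & H1 & H2) (k & K1 & K2). exists (fun w => h w * k w). split; [now apply hol_mult|].
generalize (near'_and _ _ _ H2 K2). apply near'_imp. intros w _ [-> ->]. reflexivity.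
Qed.

Lemma hol_pow_sub (z0 z : C) (n : nat) : holomorphic_at (fun w => (w - z0) ^ n) z.
Proof. apply hol_pow, hol_minus; [apply hol_id|apply hol_const]. Qed.

Lemma regular_meromorphic (f : C -> C) (z : C) : regular_at f z -> meromorphic_at f z.
Proof. intros H. exists 0%nat. revert H. apply regular_ext, near'_forall. intros; simpl; ring. Qed.

Lemma meromorphic_plus (f g : C -> C) (z : C) : meromorphic_at f z -> meromorphic_at g z ->
  meromorphic_at (fun w => f w + g w) z.
Proof.
intros (n & H) (m & K). exists (n + m)%nat.
apply (regular_ext (fun w => (w - z) ^ m * ((w - z) ^ n * f w) + (w - z) ^ n * ((w - z) ^ m * g w))).
{ apply near'_forall. intros w. rewrite Cpow_add_r. ring. }
apply regular_plus; apply regular_mult; trivial; apply hol_regular, hol_pow_sub.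
Qed.

Lemma meromorphic_mult (f g : C -> C) (z : C) : meromorphic_at f z -> meromorphic_at g z ->
  meromorphic_at (fun w => f w * g w) z.
Proof.
intros (n & H) (m & K). exists (n + m)%nat.
apply (regular_ext (fun w => ((w - z) ^ n * f w) * ((w - z) ^ m * g w))).
{ apply near'_forall. intros w. rewrite Cpow_add_r. ring. }
now apply regular_mult.
Qed.

Lemma meromorphic_const (c z : C) : meromorphic_at (fun _ => c) z.
Proof. apply regular_meromorphic, hol_regular, hol_const. Qed.

Lemma meromorphic_scal (c : C) (f : C -> C) (z : C) : meromorphic_at f z -> meromorphic_at (fun w => c * f w) z.
Proof. apply meromorphic_mult, meromorphic_const. Qed.

Lemma meromorphic_minus (f g : C -> C) (z : C) : meromorphic_at f z -> meromorphic_at g z ->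
  meromorphic_at (fun w => f w - g w) z.
Proof.
intros H K. apply (meromorphic_ext (fun w => f w + - (1) * g w)).
{ apply near'_forall. intros; ring. }
now apply meromorphic_plus, meromorphic_scal.
Qed.

Lemma regular_shift (f : C -> C) (z c : C) : regular_at f (z + c) -> regular_at (fun w => f (w + c)) z.
Proof.
intros (h & H1 & H2). exists (fun w => h (w + c)). split; [now apply hol_shift|].
apply (near'_shift z c (fun w => f w = h w)), H2.
Qed.

Lemma meromorphic_shift (f : C -> C) (z c : C) : meromorphic_at f (z + c) -> meromorphic_at (fun w => f (w + c)) z.
Proof.
intros (n & H). exists n. apply regular_shift in H. revert H. apply regular_ext, near'_forall.
intros w. replace (w + c - (z + c)) with (w - z) by ring. reflexivity.
Qed.

Lemma neq_sub (w z : C) : w <> z -> w - z <> 0.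
Proof. apply Cminus_eq_contra. Qed.

Lemma meromorphic_form (f : C -> C) (z : C) : meromorphic_at f z ->
  exists (n : nat) (h : C -> C), holomorphic_at h z /\ near' z (fun w => f w = (/ (w - z)) ^ n * h w).
Proof.
intros (n & h & H1 & H2). exists n, h. split; [exact H1|].
revert H2. apply near'_imp. intros w Hw E. rewrite <- E.
rewrite Cpow_inv by now apply neq_sub. field. now apply Cpow_nz, neq_sub.
Qed.

Lemma meromorphic_hol_near' (f : C -> C) (z : C) : meromorphic_at f z -> near' z (holomorphic_at f).
Proof.
intros H. destruct (meromorphic_form f z H) as (n & h & H1 & H2).
generalize (near'_and _ _ _ (near'_near _ _ H2) (near_near' _ _ (hol_near h z H1))).
apply near'_imp. intros w Hw [A B].
apply (hol_ext (fun w => (/ (w - z)) ^ n * h w)).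
- revert A. apply near_imp. intros v ->. reflexivity.
- apply hol_mult; [|exact B]. apply hol_pow, hol_inv; [|now apply neq_sub].
  apply hol_minus; [apply hol_id|apply hol_const].
Qed.

Lemma meromorphic_derive (f : C -> C) (z : C) : meromorphic_at f z -> meromorphic_at (C_derive f) z.
Proof.
intros H. destruct (meromorphic_form f z H) as (n & h & H1 & H2).
exists (S n). exists (fun w => (w - z) * C_derive h w - RtoC (INR n) * h w). split.
{ apply hol_minus; apply hol_mult; trivial; [|now apply hol_derive|apply hol_const].
  apply hol_minus; [apply hol_id|apply hol_const]. }
generalize (near'_and _ _ _ (near'_near _ _ H2) (near_near' _ _ (hol_near h z H1))).
apply near'_imp. intros w Hw [A B].
assert (Hne := neq_sub w z Hw).
assert (Hp : (w - z) ^ n <> 0) by now apply Cpow_nz.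
assert (D : cder (fun w => (/ (w - z)) ^ n * h w) w (- RtoC (INR n) * (/ (w - z)) ^ S n * h w + (/ (w - z)) ^ n * C_derive h w)).
{ apply cder_mult; [|now apply hol_cder].
  destruct n as [|n].
  - eapply cder_eq; [exact (cder_const 1 w)|]. simpl INR. ring.
  - eapply cder_eq; [apply (cder_comp (fun w => (/ w) ^ S n) (fun w => w - z))|].
    + now apply cder_inv_pow.
    + apply cder_minus; [apply cder_id|apply cder_const].
    + simpl. ring. }
rewrite (C_derive_eq f w _ (cder_ext_loc (fun w => (/ (w - z)) ^ n * h w) f w _
   (filter_imp _ _ (fun v E => eq_sym E) A) D)).
simpl Cpow. rewrite Cpow_inv by exact Hne. field. now split.
Qed.

(** Zeros cannot accumulate unless the function vanishes identically near the point;
    multiplying by a power of [w - z] reduces this to the holomorphic case. *)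
Lemma meromorphic_zero_dichotomy (f : C -> C) (z : C) : meromorphic_at f z ->
  near' z (fun w => f w = 0) \/ near' z (fun w => f w <> 0).
Proof.
intros (n & h & H1 & H2).
destruct (hol_zero_order h z H1) as [Z|(m & q & Q1 & Q2 & Q3)].
- left. generalize (near'_and _ _ _ H2 (near_near' _ _ Z)). apply near'_imp.
  intros w Hw [A B]. rewrite B in A. assert (P := Cpow_nz (w - z) n (neq_sub w z Hw)).
  replace (f w) with (/ (w - z) ^ n * ((w - z) ^ n * f w)) by (field; exact P). rewrite A. ring.
- right. 
  assert (Q4 : near z (fun w => q w <> 0)) by exact (hol_ccont q z Q1 _ (locally_neq_0 _ Q2)).
  generalize (near'_and _ _ _ H2 (near'_and _ _ _ (near_near' _ _ Q3) (near_near' _ _ Q4))). apply near'_imp.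
  intros w Hw (A & B & D) E. rewrite E, B in A.
  apply (Cmult_neq_0 ((w - z) ^ m) (q w)); [now apply Cpow_nz, neq_sub|exact D|].
  rewrite <- A. ring.
Qed.

(** * The identity theorem *)

Lemma interval_connected (P : R -> Prop) : P 0%R ->
  (forall s, (0 <= s <= 1) -> exists d, (0 < d) /\
     forall s', (0 <= s' <= 1) -> (Rabs (s' - s) < d)%R -> (P s <-> P s')) ->
  P 1%R.
Proof.
intros P0 H.
set (E := fun x => (0 <= x <= 1) /\ P x).
destruct (completeness E) as [m [Hm1 Hm2]].
{ exists 1%R. intros x [Hx _]; lra. }
{ exists 0%R. split; [lra|exact P0]. }
assert (m01 : (0 <= m <= 1)).
{ split; [apply Hm1; split; [lra|exact P0]|]. apply Hm2. intros x [Hx _]; lra. }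
destruct (H m m01) as (d & Hd & K).
assert (Pm : P m).
{ apply NNPP. intros N.
  assert (B : (m <= m - d)%R); [|lra]. apply Hm2. intros x [Hx Px].
  destruct (Rle_lt_dec x (m - d)) as [L|L]; [exact L|]. exfalso. apply N, (K x Hx); [|exact Px].
  assert (x <= m) by (apply Hm1; split; assumption). apply Rabs_def1; lra. }
destruct (Rle_lt_dec 1 m) as [L|L]; [replace 1%R with m by lra; exact Pm|].
exfalso. set (x := Rmin 1 (m + d / 2)).
assert (X1 := Rmin_l 1 (m + d / 2)). assert (X2 := Rmin_r 1 (m + d / 2)).
assert (X3 : (m < x)) by (apply Rmin_glb_lt; lra).
assert (x <= m); [|lra]. apply Hm1. unfold x in *. split; [lra|].
apply (K (Rmin 1 (m + d / 2))); [lra|apply Rabs_def1; lra|exact Pm].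
Qed.

Lemma near_seg (a b : C) (s : R) (P : C -> Prop) : near (seg a b s) P -> 
  exists d, (0 < d) /\ forall s', (Rabs (s' - s) < d)%R -> P (seg a b s').
Proof.
intros H. destruct (ccont_seg a b s _ H) as [d Hd]. exists d. split; [apply cond_pos|]. intros s' Hs'. now apply Hd.
Qed.

Lemma seg_inj (a b : C) (s s' : R) : a <> b -> seg a b s' = seg a b s -> s' = s.
Proof.
intros N E. unfold seg in E.
assert (K : (RtoC s' - RtoC s) * (b - a) = 0).
{ replace ((RtoC s' - RtoC s) * (b - a)) with ((a + RtoC s' * (b - a)) - (a + RtoC s * (b - a))) by ring.
  rewrite E. ring. }
assert (b - a <> 0) by (apply neq_sub; congruence).
destruct (Req_dec s' s) as [|M]; [assumption|]. exfalso.
apply (Cmult_neq_0 _ _) in K; [exact K| |exact H].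
rewrite <- RtoC_minus. intros L. apply RtoC_inj in L. lra.
Qed.

(** By the dichotomy, vanishing near a point and not vanishing near a point are both
    open conditions along the segment from [a] to [b], and the unit interval is
    connected. *)
Theorem identity_theorem (f : C -> C) (a b : C) :
  (forall t : R, (0 <= t <= 1) -> meromorphic_at f (seg a b t)) ->
  near' a (fun w => f w = 0) -> near' b (fun w => f w = 0).
Proof.
intros Hm Ha. destruct (Ceq_dec a b) as [<-|Hab]; [exact Ha|].
rewrite <- (seg_1 a b). apply (interval_connected (fun s => near' (seg a b s) (fun w => f w = 0))).
{ rewrite seg_0. exact Ha. }
intros s Hs.
assert (Ex : forall z P, near z P -> near' z (fun w => ~ P w) -> False).
{ intros z P A B. destruct (near'_exists z _ 1 (near'_and _ _ _ (near_near' _ _ A) B) Rlt_0_1) as (w & _ & _ & X & Y).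
  contradiction. }
destruct (meromorphic_zero_dichotomy f _ (Hm s Hs)) as [D|D].
- destruct (near_seg a b s _ (near'_near _ _ D)) as (d & Hd & K). exists d. split; [exact Hd|].
  intros s' _ Hs'. split; [|intros _; exact D]. intros _.
  destruct (Req_dec s' s) as [->|Hne]; [exact D|].
  apply near_near'. apply (K s' Hs'). intros E. apply Hne. now apply (seg_inj a b).
- destruct (near_seg a b s _ (near'_near _ _ D)) as (d & Hd & K). exists d. split; [exact Hd|].
  intros s' _ Hs'.
  assert (N0 : ~ near' (seg a b s) (fun w => f w = 0)).
  { intros X. destruct (near'_exists _ _ 1 (near'_and _ _ _ X D) Rlt_0_1) as (w & _ & _ & Y & Z). contradiction. }
  destruct (Req_dec s' s) as [->|Hne]; [tauto|].
  split; [intros X; contradiction|]. intros X. exfalso.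
  assert (Y : near (seg a b s') (fun w => f w <> 0)).
  { apply (K s' Hs'). intros E. apply Hne. now apply (seg_inj a b). }
  destruct (near'_exists _ _ 1 (near'_and _ _ _ X (near_near' _ _ Y)) Rlt_0_1) as (w & _ & _ & U & V). contradiction.
Qed.

(** * Integrals over one period in a strip *)

Definition strip (f : C -> C) (a b : R) : Prop :=
  forall z : C, (a < Im z < b)%R -> holomorphic_at f z /\ f (z + 1) = f z.

Lemma Im_minus (z w : C) : Im (z - w) = (Im z - Im w)%R.
Proof. unfold Im; simpl; ring. Qed.
Lemma Im_plus_R (z : C) (t : R) : Im (z + RtoC t) = Im z.
Proof. unfold Im; simpl; ring. Qed.
Lemma Im_seg (a b : C) (t : R) : Im (seg a b t) = ((1 - t) * Im a + t * Im b)%R.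
Proof. unfold seg, Im; simpl; ring. Qed.

Lemma near_Im (z : C) (a b : R) : (a < Im z < b)%R -> near z (fun w => (a < Im w < b)%R).
Proof.
intros H. apply locally_Cmod. exists (Rmin (Im z - a) (b - Im z)). split; [apply Rmin_pos; lra|].
intros w Hw. assert (X : (Rabs (Im w - Im z) <= Cmod (w - z))%R).
{ rewrite <- Im_minus. eapply Rle_trans; [|apply Rmax_Cmod]. apply Rmax_r. }
assert (A := Rmin_l (Im z - a) (b - Im z)). assert (B := Rmin_r (Im z - a) (b - Im z)).
apply Rabs_le_between in X. lra.
Qed.

Lemma convex_between (a b x y t : R) : (a < x < b) -> (a < y < b) -> (0 <= t <= 1) ->
  (a < (1 - t) * x + t * y < b)%R.
Proof. intros. destruct (Rle_lt_dec t 0) as [?|?]; [replace t with 0%R by lra; lra|]. split; nra. Qed.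

Lemma cont01_line (f : C -> C) (w : C) : (forall t : R, (0 <= t <= 1) -> ccont f (w + RtoC t)) ->
  cont01 (fun t => f (w + RtoC t)).
Proof.
intros H t Ht. apply (ccont_comp f (fun t => w + RtoC t)); [|now apply H].
apply ccont_plus; [apply ccont_const|]. apply ccont_RtoC_id.
Qed.

Definition line_int (phi : C -> C) (w : C) : C := CInt (fun t => phi (w + RtoC t)).

(** The derivative with respect to the base point is the integral of the derivative over
    a period, which is zero. So the contour may be moved horizontally and vertically
    inside the strip. *)
Lemma line_int_const (phi : C -> C) (a b : R) (w w' : C) : strip phi a b ->
  (a < Im w < b)%R -> (a < Im w' < b)%R -> line_int phi w = line_int phi w'.
Proof.
intros H Hw Hw'. apply constant_of_zero_derivative. intros s Hs.
assert (Hv : (a < Im (seg w' w s) < b)%R) by (rewrite Im_seg; now apply convex_between).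
set (v := seg w' w s) in *.
assert (Ht : forall t, (a < Im (RtoC t + 1 * v) < b)%R).
{ intros t. replace (RtoC t + 1 * v) with (v + RtoC t) by ring. now rewrite Im_plus_R. }
eapply cder_eq.
- apply (cder_ext (fun z => CInt (fun t => phi (RtoC t + 1 * z) * 1))).
  { intros z. apply CInt_ext. intros t _. replace (RtoC t + 1 * z) with (z + RtoC t) by ring. ring. }
  apply (cder_under_int phi (C_derive phi) RtoC (fun _ => 1) (fun _ => 1)).
  + intros t _. apply ccont_RtoC_id.
  + intros t _. apply ccont_const.
  + intros t _. apply ccont_const.
  + intros t _. apply hol_near_cder, H, Ht.
  + intros t _. apply hol_ccont, hol_derive, H, Ht.
- transitivity (CInt (fun t => C_derive phi (RtoC t + v))).
  { apply CInt_ext. intros t _. replace (RtoC t + 1 * v) with (RtoC t + v) by ring. ring. }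
  assert (Ht' : forall t, (a < Im (RtoC t + v) < b)%R).
  { intros t. replace (RtoC t + v) with (v + RtoC t) by ring. now rewrite Im_plus_R. }
  rewrite (CInt_FTC_real (fun z => phi (z + v)) (fun z => C_derive phi (z + v))).
  + replace (0 + v) with v by ring. replace (1 + v) with (v + 1) by ring.
    rewrite (proj2 (H v Hv)). ring.
  + intros t _. eapply cder_eq.
    * apply (cder_comp phi (fun z => z + v)); [apply hol_cder, H, Ht'|].
      apply cder_plus; [apply cder_id|apply cder_const].
    * simpl. ring.
  + intros t _. apply (ccont_comp (C_derive phi) (fun z => z + v)).
    * apply ccont_plus; [apply continuous_id|apply ccont_const].
    * apply hol_ccont, hol_derive, H, Ht'.
Qed.

(** The convolution integral with the contour through [w], at height [Im w]. *)
Definition conv_line (f g : C -> C) (w x : C) : C :=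
  line_int (fun z => f (x - z) * g z) w.

Definition on_line (f g : C -> C) (w x : C) : Prop :=
  forall t : R, (0 <= t <= 1) -> ccont f (x - (w + RtoC t)) /\ ccont g (w + RtoC t).

Lemma on_line_cont01 (f g : C -> C) (w x : C) : on_line f g w x ->
  cont01 (fun t => f (x - (w + RtoC t)) * g (w + RtoC t)).
Proof.
intros H. apply (cont01_line (fun z => f (x - z) * g z) w). intros t Ht.
destruct (H t Ht) as [A B]. apply ccont_mult; [|exact B].
apply (ccont_comp f (fun z => x - z)); [|exact A].
apply ccont_minus; [apply ccont_const|apply continuous_id].
Qed.

Lemma Im_line (w x : C) (t : R) : Im (x - (w + RtoC t)) = (Im x - Im w)%R.
Proof. now rewrite Im_minus, Im_plus_R. Qed.

Lemma strip_on_line (f g : C -> C) (a b c d : R) (w x : C) : strip f a b -> strip g c d ->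
  (a < Im x - Im w < b)%R -> (c < Im w < d)%R -> on_line f g w x.
Proof.
intros Hf Hg H1 H2 t _. split.
- apply hol_ccont, Hf. now rewrite Im_line.
- apply hol_ccont, Hg. now rewrite Im_plus_R.
Qed.

Lemma conv_line_indep (f g : C -> C) (a b c d : R) (w w' x : C) : strip f a b -> strip g c d ->
  (a < Im x - Im w < b)%R -> (c < Im w < d)%R -> (a < Im x - Im w' < b)%R -> (c < Im w' < d)%R ->
  conv_line f g w x = conv_line f g w' x.
Proof.
intros Hf Hg H1 H2 H3 H4.
apply (line_int_const _ (Rmax (Im x - b) c) (Rmin (Im x - a) d)).
- intros z Hz.
  assert (A1 := Rmax_l (Im x - b) c). assert (A2 := Rmax_r (Im x - b) c).
  assert (A3 := Rmin_l (Im x - a) d). assert (A4 := Rmin_r (Im x - a) d).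
  destruct (Hg z ltac:(lra)) as [G1 G2].
  destruct (Hf (x - z)) as [F1 _]; [rewrite Im_minus; lra|].
  destruct (Hf (x - (z + 1))) as [_ F2].
  { replace (x - (z + 1)) with (x - z + RtoC (-1)).
    - rewrite Im_plus_R, Im_minus; lra.
    - rewrite RtoC_m1. ring. }
  split.
  + apply hol_mult; [|exact G1]. apply (hol_comp f (fun z => x - z)); [exact F1|].
    apply hol_minus; [apply hol_const|apply hol_id].
  + rewrite G2, <- F2. do 2 f_equal. ring.
- split; [apply Rmax_lub_lt|apply Rmin_glb_lt]; lra.
- split; [apply Rmax_lub_lt|apply Rmin_glb_lt]; lra.
Qed.

(** Substitute [x - z] for [z] in the integral, which maps the contour through [w] to
    the one through [x - w - 1]. *)
Lemma conv_line_comm (f g : C -> C) (a b c d : R) (w w' x : C) : strip f a b -> strip g c d ->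
  (a < Im x - Im w < b)%R -> (c < Im w < d)%R -> (a < Im w' < b)%R -> (c < Im x - Im w' < d)%R ->
  conv_line f g w x = conv_line g f w' x.
Proof.
intros Hf Hg H1 H2 H3 H4.
transitivity (conv_line g f (x - w + RtoC (-1)) x).
- unfold conv_line, line_int. rewrite <- CInt_reverse.
  + apply CInt_ext. intros t _. rewrite RtoC_minus.
    rewrite RtoC_m1.
    rewrite Cmult_comm. do 2 f_equal; ring.
  + apply on_line_cont01. now apply (strip_on_line f g a b c d).
- apply (conv_line_indep g f c d a b); trivial; rewrite ?Im_plus_R, Im_minus; lra.
Qed.

Lemma conv_line_lin_l (f g h : C -> C) (p q : C) (w x : C) : on_line f h w x -> on_line g h w x ->
  conv_line (fun z => p * f z + q * g z) h w x = p * conv_line f h w x + q * conv_line g h w x.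
Proof.
intros H1 H2. apply on_line_cont01 in H1. apply on_line_cont01 in H2. unfold conv_line, line_int.
rewrite <- !CInt_scal by assumption. rewrite <- CInt_plus.
- apply CInt_ext. intros; ring.
- intros t Ht. apply ccont_mult; [apply ccont_const|now apply H1].
- intros t Ht. apply ccont_mult; [apply ccont_const|now apply H2].
Qed.

Lemma conv_line_cder (f g : C -> C) (w x : C) :
  (forall t : R, holomorphic_at f (x - (w + RtoC t))) -> (forall t : R, ccont g (w + RtoC t)) ->
  cder (conv_line f g w) x (conv_line (C_derive f) g w x).
Proof.
intros Hf Hg.
assert (E : forall t x, - (w + RtoC t) + 1 * x = x - (w + RtoC t)) by (intros; ring).
assert (Hl : forall t : R, ccont (fun t : R => w + RtoC t) t).
{ intros t. apply ccont_plus; [apply ccont_const|]. apply ccont_RtoC_id. }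
eapply cder_eq.
- apply (cder_ext (fun x => CInt (fun t => f (- (w + RtoC t) + 1 * x) * g (w + RtoC t)))).
  { intros z. apply CInt_ext. intros t _. now rewrite E. }
  apply (cder_under_int f (C_derive f) (fun t => - (w + RtoC t)) (fun _ => 1) (fun t => g (w + RtoC t))).
  + intros t _. now apply ccont_opp.
  + intros t _. apply ccont_const.
  + intros t _. now apply (ccont_comp g (fun t => w + RtoC t)).
  + intros t _. rewrite E. apply hol_near_cder, Hf.
  + intros t _. rewrite E. apply hol_ccont, hol_derive, Hf.
- apply CInt_ext. intros t _. rewrite E. ring.
Qed.

(** The height of the contour is a fixed proportion of [Im x]. With [lam = B / (A + B)]
    it stays in the common domain when [f] and [g] are holomorphic on strips of heights
    [A] and [B], for all [x] with [0 < Im x < A + B]. *)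
Definition conv_at (lam : R) (f g : C -> C) (x : C) : C := conv_line f g (0, (lam * Im x)%R) x.

Lemma strip_conv_at (lam A B : R) (f g : C -> C) : (0 < A) -> (0 < B) -> (lam * (A + B) = B)%R ->
  strip f 0 A -> strip g 0 B -> strip (conv_at lam f g) 0 (A + B).
Proof.
intros HA HB Hl Hf Hg x Hx.
assert (L : (0 < lam < 1)) by nra.
assert (K : forall y : C, (0 < Im y < A + B)%R -> (0 < lam * Im y < B)%R /\ (0 < Im y - lam * Im y < A)%R).
{ intros y Hy. split; nra. }
destruct (K x Hx) as [K1 K2].
set (w := (0, (lam * Im x)%R) : C).
split.
- apply (hol_ext (conv_line f g w)).
  + assert (N : near x (fun y => (0 < Im y < A + B)%R /\ (lam * Im x < Im y < lam * Im x + A)%R)).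
    { apply filter_and; apply near_Im; lra. }
    revert N. apply near_imp. intros y [Hy1 Hy2]. destruct (K y Hy1).
    apply (conv_line_indep f g 0 A 0 B); trivial; unfold w, Im in *; simpl in *; lra.
  + apply (hol_of_cder _ (conv_line (C_derive f) g w)).
    generalize (near_Im x (lam * Im x) (lam * Im x + A) ltac:(lra)). apply near_imp. intros y Hy.
    apply conv_line_cder; intros t.
    * apply Hf. rewrite Im_line. unfold w, Im in *; simpl in *; lra.
    * apply hol_ccont, Hg. rewrite Im_plus_R. unfold w, Im in *; simpl in *; lra.
- unfold conv_at. replace (Im (x + 1)) with (Im x) by (unfold Im; simpl; ring). fold w.
  apply CInt_ext. intros t _. f_equal.
  replace (x + 1 - (w + RtoC t)) with (x - (w + RtoC t) + 1) by ring.
  apply Hf. rewrite Im_line. unfold w, Im in *; simpl in *; lra.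
Qed.

Lemma conv_integral_conv_line (f g : C -> C) (x : C) : conv_integral f g x = conv_at (/ 2) f g x.
Proof.
unfold conv_integral, conv_at, conv_line, line_int, CInt. apply (RInt_ext (V := CR_complete)).
intros t _. cbv zeta.
assert (E : ((t, (Im x / 2)%R) : C) = (0, (/ 2 * Im x)%R) + RtoC t).
{ unfold Cplus, RtoC; simpl. apply (f_equal2 (@pair R R)); field. }
now rewrite E.
Qed.

(** * Insensitivity to isolated values *)

(** An integral over a short interval with end point [t] does not see the value at [t];
    the connectedness of the unit interval glues these short intervals together. *)
Lemma RInt_isolated (phi psi : R -> C) :
  (forall t : R, (0 <= t <= 1) -> exists d, (0 < d) /\
     forall s, (Rabs (s - t) < d)%R -> s <> t -> phi s = psi s) ->
  cont01 psi -> CInt phi = CInt psi.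
Proof.
intros H Hc. apply CInt_unique.
assert (Hi : forall a b, (0 <= a <= 1) -> (0 <= b <= 1) -> ex_RInt (V := CR_space) psi a b).
{ intros a b Ha Hb. apply (ex_RInt_continuous (V := CR_complete)). intros z Hz. apply Hc.
  revert Hz. apply Rmin_case; apply Rmax_case; lra. }
set (I := fun a b => RInt (V := CR_complete) psi a b).
assert (HI : forall a b, (0 <= a <= 1) -> (0 <= b <= 1) -> is_RInt (V := CR_space) psi a b (I a b)).
{ intros a b Ha Hb. apply (RInt_correct (V := CR_complete)). now apply Hi. }
change (is_RInt (V := CR_space) phi 0 1 (I 0%R 1%R)).
apply (interval_connected (fun s => is_RInt (V := CR_space) phi 0 s (I 0%R s))).
{ unfold I. rewrite (RInt_point (V := CR_complete)). apply (is_RInt_point (V := CR_space)). }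
intros s Hs. destruct (H s Hs) as (d & Hd & K). exists d. split; [exact Hd|].
intros s' Hs' Hss'.
assert (A : forall a b, (a = s /\ b = s' \/ a = s' /\ b = s) -> is_RInt (V := CR_space) phi a b (I a b)).
{ intros a b Hab. apply (is_RInt_ext (V := CR_space) psi).
  - intros x Hx. symmetry. apply K.
    + apply Rabs_def2 in Hss'. revert Hx. destruct Hab as [[-> ->]|[-> ->]];
      apply Rmin_case; apply Rmax_case; intros; apply Rabs_def1; lra.
    + revert Hx. destruct Hab as [[-> ->]|[-> ->]]; apply Rmin_case; apply Rmax_case; lra.
  - apply HI; destruct Hab as [[-> ->]|[-> ->]]; assumption. }
assert (Ch : forall a b, (0 <= a <= 1) -> (0 <= b <= 1) -> plus (G := CR_space) (I 0%R a) (I a b) = I 0%R b).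
{ intros a b Ha Hb. apply (RInt_Chasles (V := CR_complete)); apply Hi; lra. }
split; intros P.
- rewrite <- (Ch s s') by assumption. apply (is_RInt_Chasles (V := CR_space)) with s; [exact P|]. apply A. now left.
- rewrite <- (Ch s' s) by assumption. apply (is_RInt_Chasles (V := CR_space)) with s'; [exact P|]. apply A. now right.
Qed.

Lemma isolated_along (f g : C -> C) (c : C) (sg : R) (t : R) : (sg = 1 \/ sg = -1)%R ->
  near' (c + RtoC (sg * t)) (fun z => f z = g z) ->
  exists d, (0 < d) /\ forall s, (Rabs (s - t) < d)%R -> s <> t -> f (c + RtoC (sg * s)) = g (c + RtoC (sg * s)).
Proof.
intros Hsg H. apply locally'_Cmod in H. destruct H as (d & Hd & H). exists d. split; [exact Hd|].
intros s Hs Hne.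
assert (E : Cmod (c + RtoC (sg * s) - (c + RtoC (sg * t))) = Rabs (s - t)).
{ replace (c + RtoC (sg * s) - (c + RtoC (sg * t))) with (RtoC (sg * (s - t))).
  - rewrite Cmod_R, Rabs_mult. destruct Hsg as [-> | ->]; [rewrite Rabs_R1|rewrite (Rabs_left (-1)) by lra]; ring.
  - rewrite Rmult_minus_distr_l, RtoC_minus. ring. }
apply H; [now rewrite E|].
intros K. rewrite K in E. replace (c + RtoC (sg * t) - (c + RtoC (sg * t))) with (RtoC 0) in E by ring.
rewrite Cmod_0 in E. apply Hne. symmetry in E. apply Rabs_eq_0 in E. lra.
Qed.

Lemma conv_integral_meq (f f0 g g0 : C -> C) (A : R) (x : C) : meq f f0 -> meq g g0 ->
  strip f0 0 A -> strip g0 0 A -> (0 < Im x < 2 * A)%R ->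
  conv_integral f g x = conv_integral f0 g0 x.
Proof.
intros Hf Hg Sf Sg Hx. rewrite !conv_integral_conv_line. unfold conv_at, conv_line, line_int.
set (w := (0, (/ 2 * Im x)%R) : C).
assert (Iw : Im w = (Im x / 2)%R) by (unfold w, Im; simpl; field).
apply RInt_isolated.
- intros t Ht.
  destruct (isolated_along f f0 (x - w) (-1) t (or_intror eq_refl) (Hf _)) as (d1 & Hd1 & K1).
  destruct (isolated_along g g0 w 1 t (or_introl eq_refl) (Hg _)) as (d2 & Hd2 & K2).
  exists (Rmin d1 d2). split; [now apply Rmin_pos|]. intros s Hs Hne.
  assert (A1 := Rmin_l d1 d2). assert (A2 := Rmin_r d1 d2).
  specialize (K1 s ltac:(lra) Hne). specialize (K2 s ltac:(lra) Hne).
  rewrite Rmult_1_l in K2. rewrite K2.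
  replace (x - w + RtoC (-1 * s)) with (x - (w + RtoC s)) in K1; [now rewrite K1|].
  rewrite RtoC_mult. rewrite RtoC_m1. ring.
- apply on_line_cont01, (strip_on_line f0 g0 0 A 0 A); trivial; lra.
Qed.

(** * Equality of meromorphic functions *)

Lemma meq_sym (f g : C -> C) : meq f g -> meq g f.
Proof. intros H z. generalize (H z). apply near'_imp. intros; congruence. Qed.
Lemma meq_trans (f g h : C -> C) : meq f g -> meq g h -> meq f h.
Proof. intros H K z. generalize (near'_and _ _ _ (H z) (K z)). apply near'_imp. intros w _ []; congruence. Qed.

(** Every point is joined to the strip by a segment, so the identity theorem applies. *)
Lemma meromorphic_strip_eq (f g : C -> C) (b : R) : (0 < b) -> meromorphic f -> meromorphic g ->
  (forall x, (0 < Im x < b)%R -> f x = g x) -> meq f g.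
Proof.
intros Hb Hf Hg H z.
assert (Z : near' z (fun w => f w - g w = 0)).
{ apply (identity_theorem (fun w => f w - g w) (0, (b / 2)%R) z); [intros; now apply meromorphic_minus|].
  apply near_near'. assert (K : (0 < Im (0, b / 2) < b)%R) by (unfold Im; simpl; lra).
  generalize (near_Im _ 0 b K). apply near_imp. intros w Hw. rewrite H by exact Hw. ring. }
revert Z. apply near'_imp. intros w _ Hw. now apply Ceq_minus.
Qed.

(** * The lattice and good representatives *)

Section Lattice.
Variable tau : C.
Hypothesis Htau : (0 < Im tau)%R.
Let L := in_lattice tau.

Lemma lattice_plus (z w : C) : L z -> L w -> L (z + w).
Proof.
intros (a & b & ->) (c & d & ->). exists (a + c)%Z, (b + d)%Z. rewrite !plus_IZR, !RtoC_plus. ring.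
Qed.
Lemma lattice_opp (z : C) : L z -> L (- z).
Proof. intros (a & b & ->). exists (- a)%Z, (- b)%Z. rewrite !opp_IZR, !RtoC_opp. ring. Qed.
Lemma lattice_Z (n : Z) : L (RtoC (IZR n)).
Proof. exists n, 0%Z. ring. Qed.
Lemma lattice_1 : L 1. Proof. exact (lattice_Z 1). Qed.
Lemma lattice_tau : L tau. Proof. exists 0%Z, 1%Z. ring. Qed.
Lemma not_lattice_shift (z c : C) : L c -> ~ L z -> ~ L (z + c).
Proof.
intros Hc Hz H. apply Hz. replace z with (z + c + - c) by ring. apply lattice_plus; [exact H|now apply lattice_opp].
Qed.
Lemma lattice_Im (z : C) : L z -> exists b : Z, Im z = (IZR b * Im tau)%R /\ (b = 0%Z -> exists a : Z, z = RtoC (IZR a)).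
Proof.
intros (a & b & ->). exists b. split.
- unfold Im; simpl. ring.
- intros ->. exists a. ring.
Qed.

Lemma lattice_small (z : C) : L z -> (- Im tau < Im z < Im tau)%R -> exists a : Z, z = RtoC (IZR a).
Proof.
intros Hz Hi. destruct (lattice_Im z Hz) as (b & Hb & K). apply K.
rewrite Hb in Hi.
assert ((IZR (-1) < IZR b < IZR 1)%R) by (split; apply Rmult_lt_reg_r with (Im tau); lra).
assert (-1 < b < 1)%Z by (split; now apply lt_IZR). lia.
Qed.

Lemma not_lattice_strip (z : C) : (- Im tau < Im z < Im tau)%R -> Im z <> 0%R -> ~ L z.
Proof.
intros Hz Hn H. destruct (lattice_small z H Hz) as [a ->]. now apply Hn.
Qed.

Lemma IZR_abs_lt_1 (a : Z) : (Rabs (IZR a) < 1)%R -> a = 0%Z.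
Proof.
intros H. apply Rabs_def2 in H. assert (-1 < a < 1)%Z; [|lia].
split; apply lt_IZR; lra.
Qed.

Lemma lattice_near' (z : C) : near' z (fun w => ~ L w).
Proof.
set (d := (Rmin 1 (Im tau) / 2)%R).
assert (D0 : (0 < Rmin 1 (Im tau))%R) by (apply Rmin_pos; lra).
assert (D1 := Rmin_l 1 (Im tau)). assert (D2 := Rmin_r 1 (Im tau)).
assert (Sep : forall p q, L p -> L q -> (Cmod (p - q) < Rmin 1 (Im tau))%R -> p = q).
{ intros p q Hp Hq Hd.
  assert (Hpq : L (p - q)) by (apply lattice_plus; [exact Hp|now apply lattice_opp]).
  assert (X : (Rabs (Im (p - q)) <= Cmod (p - q))%R) by (eapply Rle_trans; [|apply Rmax_Cmod]; apply Rmax_r).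
  apply Rabs_le_between in X.
  destruct (lattice_small _ Hpq ltac:(lra)) as [a Ha].
  rewrite Ha, Cmod_R in Hd. assert (a = 0%Z) by (apply IZR_abs_lt_1; lra). subst a.
  apply Ceq_minus. exact Ha. }
destruct (classic (exists p, L p /\ p <> z /\ (Cmod (p - z) < d)%R)) as [(p & Hp & Hpz & Hpd)|N].
- apply locally'_Cmod. exists (Cmod (p - z)). split; [now apply Cmod_gt_0, neq_sub|].
  intros w Hw _ Hl. assert (w = p).
  { apply Sep; trivial. replace (w - p) with ((w - z) + - (p - z)) by ring.
    eapply Rle_lt_trans; [apply Cmod_triangle|]. rewrite Cmod_opp. unfold d in *. lra. }
  subst w. lra.
- apply locally'_Cmod. exists d. split; [unfold d; lra|]. intros w Hw Hne Hl. apply N. now exists w.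
Qed.

Lemma not_lattice_near (z : C) : ~ L z -> near z (fun w => ~ L w).
Proof. intros H. apply near_of_near'; [apply lattice_near'|exact H]. Qed.

Lemma meq_off (f g : C -> C) : (forall z, ~ L z -> f z = g z) -> meq f g.
Proof. intros H z. generalize (lattice_near' z). apply near'_imp. intros; now apply H. Qed.

(** Functions whose only bad points lie in the lattice, and whose values elsewhere are
    the right ones, so that equations may be evaluated at every point outside the
    lattice. *)
Definition tame (f : C -> C) : Prop :=
  meromorphic f /\ forall z, ~ L z -> holomorphic_at f z /\ f (z + 1) = f z.

(** The representatives of the elements of SK with [Delta ^ k = 0]. *)
Definition SK_nice (k : nat) (f : C -> C) : Prop :=
  tame f /\ forall z, ~ L z -> Nat.iter k (Delta tau) f z = 0.

Lemma eq_of_meq (f g : C -> C) (z : C) : meq f g -> holomorphic_at f z -> holomorphic_at g z -> f z = g z.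
Proof. intros H Hf Hg. apply ccont_unique'; [now apply hol_ccont|now apply hol_ccont|apply H]. Qed.

Lemma tame_lin (p q : C) (f g : C -> C) : tame f -> tame g -> tame (fun z => p * f z + q * g z).
Proof.
intros [F1 F2] [G1 G2]. split.
- intros z. apply meromorphic_plus; apply meromorphic_scal; [apply F1|apply G1].
- intros z Hz. destruct (F2 z Hz) as [A B]. destruct (G2 z Hz) as [D E]. split.
  + apply hol_plus; apply hol_mult; trivial; apply hol_const.
  + now rewrite B, E.
Qed.

Lemma tame_shift (c : C) (f : C -> C) : L c -> tame f -> tame (fun z => f (z + c)).
Proof.
intros Hc [F1 F2]. split.
- intros z. apply meromorphic_shift, F1.
- intros z Hz. destruct (F2 (z + c) (not_lattice_shift z c Hc Hz)) as [A B]. split.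
  + now apply hol_shift.
  + rewrite <- B. f_equal. ring.
Qed.

Lemma C_derive_shift (f : C -> C) (z c : C) : holomorphic_at f (z + c) ->
  C_derive (fun w => f (w + c)) z = C_derive f (z + c).
Proof.
intros H. apply C_derive_eq. eapply cder_eq.
- apply (cder_comp f (fun w => w + c)); [now apply hol_cder|].
  apply cder_plus; [apply cder_id|apply cder_const].
- simpl. ring.
Qed.

Lemma tame_derive (f : C -> C) : tame f -> tame (C_derive f).
Proof.
intros [F1 F2]. split.
- intros z. apply meromorphic_derive, F1.
- intros z Hz. destruct (F2 z Hz) as [A B]. split; [now apply hol_derive|].
  assert (A1 := proj1 (F2 _ (not_lattice_shift z 1 lattice_1 Hz))).
  rewrite <- C_derive_shift by exact A1.
  apply C_derive_ext; [|exact A].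
  generalize (not_lattice_near z Hz). apply near_imp. intros w Hw. symmetry. now apply F2.
Qed.

Lemma iter_Delta_lin (k : nat) (p q : C) (f g : C -> C) (z : C) :
  Nat.iter k (Delta tau) (fun w => p * f w + q * g w) z =
  p * Nat.iter k (Delta tau) f z + q * Nat.iter k (Delta tau) g z.
Proof.
revert z; induction k as [|k IH]; intros z; simpl; [reflexivity|].
unfold Delta at 1 3 5. rewrite !IH. ring.
Qed.

Lemma iter_Delta_ext (k : nat) (f g : C -> C) : (forall z, ~ L z -> f z = g z) ->
  forall z, ~ L z -> Nat.iter k (Delta tau) f z = Nat.iter k (Delta tau) g z.
Proof.
intros H. induction k as [|k IH]; intros z Hz; simpl; [now apply H|].
unfold Delta at 1 3. rewrite !IH; trivial. apply not_lattice_shift; [apply lattice_tau|exact Hz].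
Qed.

Lemma iter_Delta_zero (k : nat) (z : C) : Nat.iter k (Delta tau) (fun _ => RtoC 0) z = 0.
Proof.
revert z; induction k as [|k IH]; intros z; simpl; [reflexivity|]. unfold Delta at 1. rewrite !IH. ring.
Qed.

Lemma Delta_tame (f : C -> C) : tame f -> tame (Delta tau f).
Proof.
intros H. assert (K := tame_lin 1 (- (1)) _ _ (tame_shift tau f lattice_tau H) H).
destruct K as [K1 K2]. split.
- intros z. generalize (K1 z). apply meromorphic_ext, near'_forall. intros w. unfold Delta. ring.
- intros z Hz. destruct (K2 z Hz) as [A B]. split.
  + revert A. apply hol_ext, filter_forall. intros w. unfold Delta. ring.
  + unfold Delta. replace (f (z + tau) - f z) with (1 * f (z + tau) + - (1) * f z) by ring.
    rewrite <- B. ring.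
Qed.

Lemma iter_Delta_tame (k : nat) (f : C -> C) : tame f -> tame (Nat.iter k (Delta tau) f).
Proof. intros H. induction k; simpl; [exact H|now apply Delta_tame]. Qed.

Lemma iter_Delta_derive (k : nat) (f : C -> C) : tame f -> forall z, ~ L z ->
  Nat.iter k (Delta tau) (C_derive f) z = C_derive (Nat.iter k (Delta tau) f) z.
Proof.
intros H. induction k as [|k IH]; intros z Hz; simpl; [reflexivity|].
assert (Hz' := not_lattice_shift z tau lattice_tau Hz).
unfold Delta at 1. rewrite !IH by assumption. symmetry. apply C_derive_eq.
destruct (iter_Delta_tame k f H) as [_ K].
set (g := Nat.iter k (Delta tau) f) in *.
eapply cder_eq.
- apply (cder_minus (fun w => g (w + tau)) g).
  + apply (cder_comp g (fun w => w + tau)); [apply hol_cder, K, Hz'|].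
    apply cder_plus; [apply cder_id|apply cder_const].
  + apply hol_cder, K, Hz.
- simpl. ring.
Qed.

Lemma SK_nice_mono (k m : nat) (f : C -> C) : (k <= m)%nat -> SK_nice k f -> SK_nice m f.
Proof.
intros Hm [H1 H2]. split; [exact H1|]. intros z Hz.
replace m with ((m - k) + k)%nat by lia. rewrite Nat.iter_add.
rewrite (iter_Delta_ext _ _ (fun _ => RtoC 0)); [apply iter_Delta_zero|exact H2|exact Hz].
Qed.

Lemma SK_nice_lin (k m : nat) (p q : C) (f g : C -> C) : SK_nice k f -> SK_nice m g ->
  SK_nice (Nat.max k m) (fun z => p * f z + q * g z).
Proof.
intros Hf Hg.
apply (SK_nice_mono _ (Nat.max k m)) in Hf; [|lia]. apply (SK_nice_mono _ (Nat.max k m)) in Hg; [|lia].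
split; [apply tame_lin; [apply Hf|apply Hg]|].
intros z Hz. rewrite iter_Delta_lin, (proj2 Hf), (proj2 Hg) by exact Hz. ring.
Qed.

Lemma SK_nice_derive (k : nat) (f : C -> C) : SK_nice k f -> SK_nice k (C_derive f).
Proof.
intros [H1 H2]. split; [now apply tame_derive|].
intros z Hz. rewrite iter_Delta_derive by assumption.
apply C_derive_eq. apply (cder_ext_loc (fun _ => RtoC 0)).
- generalize (not_lattice_near z Hz). apply near_imp. intros w Hw. symmetry. now apply H2.
- apply cder_const.
Qed.

Lemma SK_nice_Delta (k : nat) (f : C -> C) : SK_nice (S k) f -> SK_nice k (Delta tau f).
Proof.
intros [H1 H2]. split; [now apply Delta_tame|]. intros z Hz. rewrite <- (H2 z Hz), Nat.iter_succ_r. reflexivity.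
Qed.

Lemma tame_strip (f : C -> C) : tame f -> strip f 0 (Im tau).
Proof. intros [_ H] z Hz. apply H, not_lattice_strip; lra. Qed.

Lemma SK_nice_SK (k : nat) (f : C -> C) : SK_nice k f -> SK tau f.
Proof.
intros [[H1 H2] H3]. split; [exact H1|]. split.
- apply meq_off. intros z Hz. now apply H2.
- split.
  + intros z [_ Hz]. apply NNPP. intros N. apply Hz, hol_regular, H2, N.
  + exists k. apply meq_off. exact H3.
Qed.

Lemma meq_shift (c : C) (f g : C -> C) : meq f g -> meq (fun z => f (z + c)) (fun z => g (z + c)).
Proof. intros H z. apply (near'_shift z c (fun w => f w = g w)), H. Qed.

Lemma iter_Delta_meq (k : nat) (f g : C -> C) : meq f g -> meq (Nat.iter k (Delta tau) f) (Nat.iter k (Delta tau) g).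
Proof.
intros H. induction k as [|k IH]; simpl; [exact H|].
intros z. generalize (near'_and _ _ _ (meq_shift tau _ _ IH z) (IH z)). apply near'_imp.
intros w _ [A B]. unfold Delta at 1 3. now rewrite A, B.
Qed.

Lemma SK_meq (f g : C -> C) : meq f g -> SK tau f -> SK tau g.
Proof.
intros H (H1 & H2 & H3 & k & H4). assert (H' := meq_sym _ _ H).
split; [intros z; now apply (meromorphic_ext f), H1|].
split.
{ apply meq_trans with (fun x => f (x + 1)); [now apply meq_shift|]. now apply meq_trans with f. }
split.
- intros z [_ Hz]. apply H3. split; [apply H1|]. intros K. apply Hz. now apply (regular_ext f).
- exists k. apply meq_trans with (Nat.iter k (Delta tau) f); [now apply iter_Delta_meq|exact H4].
Qed.

(** Replace every value by the value of the regular extension, which does not depend on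
    the extension. *)
Lemma SK_normalise (f : C -> C) : SK tau f -> exists (f0 : C -> C) (k : nat),
  SK_nice k f0 /\ meq f f0 /\ forall z, regular_at f z -> holomorphic_at f0 z.
Proof.
intros (H1 & H2 & H3 & k & H4).
assert (V : forall z, exists v : C, forall h, holomorphic_at h z -> near' z (fun w => f w = h w) -> v = h z).
{ intros z. destruct (classic (exists h, holomorphic_at h z /\ near' z (fun w => f w = h w))) as [(h & A & B)|N].
  - exists (h z). intros h' A' B'. apply ccont_unique'; [now apply hol_ccont|now apply hol_ccont|].
    generalize (near'_and _ _ _ B B'). apply near'_imp. intros w _ []; congruence.
  - exists 0. intros h A B. exfalso. apply N. now exists h. }
set (f0 := fun z => proj1_sig (constructive_indefinite_description _ (V z))).
assert (Hf0 : forall z h, holomorphic_at h z -> near' z (fun w => f w = h w) -> f0 z = h z)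
 by (intros z; exact (proj2_sig (constructive_indefinite_description _ (V z)))).
assert (R : forall z, regular_at f z -> holomorphic_at f0 z).
{ intros z (h & A & B). apply (hol_ext h); [|exact A].
  apply near_of_near'; [|symmetry; now apply Hf0].
  generalize (near'_and _ _ _ (near'_near _ _ B) (near_near' _ _ (hol_near h z A))). apply near'_imp.
  intros w _ [D E]. symmetry. apply Hf0; [exact E|now apply near_near']. }
assert (M : meq f f0).
{ intros z. generalize (meromorphic_hol_near' f z (H1 z)). apply near'_imp. intros w _ Hw.
  symmetry. apply Hf0; [exact Hw|now apply near'_forall]. }
assert (N : forall z, ~ L z -> holomorphic_at f0 z).
{ intros z Hz. apply R, NNPP. intros K. apply Hz, H3. split; [apply H1|exact K]. }
assert (P : tame f0).
{ split.
  - intros z. apply (meromorphic_ext f); [apply M|apply H1].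
  - intros z Hz. split; [now apply N|].
    apply (eq_of_meq (fun z => f0 (z + 1)) f0); [|apply hol_shift, N, not_lattice_shift; [apply lattice_1|exact Hz]|now apply N].
    apply meq_trans with (fun x => f (x + 1)); [apply meq_shift; now apply meq_sym|].
    now apply meq_trans with f. }
exists f0, k. split; [|now split].
split; [exact P|]. intros z Hz.
apply (eq_of_meq (Nat.iter k (Delta tau) f0) (fun _ => RtoC 0)).
- apply meq_trans with (Nat.iter k (Delta tau) f); [apply iter_Delta_meq; now apply meq_sym|exact H4].
- now apply (proj2 (iter_Delta_tame k f0 P)).
- apply hol_const.
Qed.

(** * Moving the contour across a row of poles *)

(** If [phi] is regular at [x], then, by periodicity, changing its values on [x + Z] to
    one and the same number makes it holomorphic on the whole strip, while lines at
    other heights do not meet [x + Z]. *)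
Lemma line_int_across (phi : C -> C) (x : C) (a b : R) (w w' : C) :
  (forall z, (a < Im z < b)%R -> (forall n : Z, z <> x + RtoC (IZR n)) ->
      holomorphic_at phi z /\ phi (z + 1) = phi z) ->
  regular_at phi x -> (a < Im x < b)%R -> (a < Im w < b)%R -> (a < Im w' < b)%R ->
  Im w <> Im x -> Im w' <> Im x -> line_int phi w = line_int phi w'.
Proof.
intros H (h & H1 & H2) Hx Hw Hw' Nw Nw'.
(* the row of points to be filled in *)
set (Q := fun z => exists n : Z, z = x + RtoC (IZR n)).
set (phi0 := fun z => if excluded_middle_informative (Q z) then h x else phi z).
assert (E0 : forall z, ~ Q z -> phi0 z = phi z).
{ intros z Hz. unfold phi0. destruct (excluded_middle_informative (Q z)); [contradiction|reflexivity]. }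
assert (E1 : forall z, Q z -> phi0 z = h x).
{ intros z Hz. unfold phi0. destruct (excluded_middle_informative (Q z)); [reflexivity|contradiction]. }
assert (Q1 : forall z (n : Z), Q (z + RtoC (IZR n)) <-> Q z).
{ intros z n. split; intros [m Hm].
  - exists (m - n)%Z. rewrite minus_IZR, RtoC_minus.
    replace z with (z + RtoC (IZR n) - RtoC (IZR n)) by ring. rewrite Hm. ring.
  - exists (m + n)%Z. rewrite plus_IZR, RtoC_plus, Hm. ring. }
assert (ImQ : forall z, Q z -> Im z = Im x) by (intros z [n ->]; apply Im_plus_R).
assert (P1 : forall z, (a < Im z < b)%R -> phi0 (z + 1) = phi0 z).
{ intros z Hz. destruct (classic (Q z)) as [K|K].
  - rewrite !E1; trivial. now apply (Q1 z 1%Z).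
  - rewrite !E0; trivial; [|intros J; now apply K, (Q1 z 1%Z)].
    apply H; [exact Hz|]. intros n Hn. apply K. now exists n. }
assert (Pn : forall (n : nat) z, (a < Im z < b)%R -> phi0 (z + RtoC (INR n)) = phi0 z).
{ induction n as [|n IH]; intros z Hz.
  - f_equal. simpl. ring.
  - rewrite S_INR, RtoC_plus. replace (z + (RtoC (INR n) + 1)) with (z + RtoC (INR n) + 1) by ring.
    rewrite P1 by now rewrite Im_plus_R. now apply IH. }
assert (PZ : forall (n : Z) z, (a < Im z < b)%R -> phi0 (z + RtoC (IZR n)) = phi0 z).
{ intros n z Hz. destruct (Z_le_gt_dec 0 n) as [Hn|Hn].
  - rewrite <- (Z2Nat.id n), <- INR_IZR_INZ by exact Hn. now apply Pn.
  - rewrite <- (Pn (Z.to_nat (- n)) (z + RtoC (IZR n))) by now rewrite Im_plus_R.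
    f_equal. rewrite INR_IZR_INZ, Z2Nat.id, opp_IZR, RtoC_opp by lia. ring. }
assert (Qsep : forall z, near' z (fun w => ~ Q w)).
{ intros z. assert (K := lattice_near' (z - x)).
  assert (K' : near' z (fun w => ~ L (w - x))).
  { apply (near'_shift z (- x) (fun w => ~ L w)). exact K. }
  revert K'. apply near'_imp. intros v _ Hv [n Hn]. apply Hv. rewrite Hn.
  replace (x + RtoC (IZR n) - x) with (RtoC (IZR n)) by ring. apply lattice_Z. }
assert (Hx0 : near x (fun z => phi0 z = h z)).
{ apply near_of_near'.
  - generalize (near'_and _ _ _ H2 (Qsep x)). apply near'_imp. intros z _ [A B]. now rewrite E0.
  - apply E1. exists 0%Z. ring. }
assert (S : strip phi0 a b).
{ intros z Hz. split; [|now apply P1].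
  destruct (classic (Q z)) as [[n Hn]|K].
  - apply (hol_ext (fun v => h (v + RtoC (IZR (- n))))).
    + assert (K : near z (fun v => phi0 (v + RtoC (IZR (- n))) = h (v + RtoC (IZR (- n))))).
      { apply (near_shift z (RtoC (IZR (- n))) (fun v => phi0 v = h v)).
        replace (z + RtoC (IZR (- n))) with x; [exact Hx0|]. rewrite Hn, opp_IZR, RtoC_opp. ring. }
      generalize (filter_and _ _ K (near_Im z a b Hz)). apply near_imp.
      intros v [A B]. rewrite <- A. now apply PZ.
    + apply hol_shift. replace (z + RtoC (IZR (- n))) with x; [exact H1|].
      rewrite Hn, opp_IZR, RtoC_opp. ring.
  - apply (hol_ext phi).
    + apply near_of_near'.
      * generalize (Qsep z). apply near'_imp. intros v _ Hv. symmetry. now apply E0.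
      * symmetry. now apply E0.
    + apply H; [exact Hz|]. intros n Hn. apply K. now exists n. }
assert (Pl : forall w, Im w <> Im x -> line_int phi w = line_int phi0 w).
{ intros v Hv. apply CInt_ext. intros t _. symmetry. apply E0. intros K. apply ImQ in K. rewrite Im_plus_R in K. contradiction. }
rewrite !Pl by assumption. now apply (line_int_const phi0 a b).
Qed.

(** A function of period 1 with a simple pole at every integer and no others. Its
    derivatives supply all pole orders, and the principal part at 0 of any tame function
    is matched by a combination of them. *)
Definition pole_fun (z : C) : C := / (expi z - 1).

Lemma expi_minus_1_hol (z : C) : holomorphic_at (fun w => expi w - 1) z.
Proof.
apply hol_minus; [|apply hol_const]. apply (hol_of_cder expi (fun w => two_pi_i * expi w)), filter_forall. intros; apply expi_cder.
Qed.

Lemma pole_fun_hol (z : C) : (forall n : Z, z <> RtoC (IZR n)) -> holomorphic_at pole_fun z.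
Proof.
intros H. apply (hol_inv (fun w => expi w - 1)); [apply expi_minus_1_hol|].
intros K. destruct (expi_eq_1 z) as [n Hn]; [|exact (H n Hn)].
replace (expi z) with (expi z - 1 + 1) by ring. rewrite K. ring.
Qed.

Lemma pole_fun_period (z : C) : pole_fun (z + 1) = pole_fun z.
Proof. unfold pole_fun. now rewrite expi_period. Qed.

Lemma pole_fun_tame : tame pole_fun.
Proof.
split.
- intros z. destruct (hol_zero_order _ z (expi_minus_1_hol z)) as [Z|(n & q & Q1 & Q2 & Q3)].
  + apply (meromorphic_ext (fun _ => / (0))); [|apply meromorphic_const].
    apply near_near'. revert Z. apply near_imp. intros w Hw. unfold pole_fun. now rewrite Hw.
  + exists n. exists (fun w => / q w). split; [now apply hol_inv|].
    generalize (near'_and _ _ _ (near_near' _ _ Q3) (near_near' _ _ (hol_ccont q z Q1 _ (locally_neq_0 _ Q2)))).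
    apply near'_imp. intros w Hw [A B]. unfold pole_fun. rewrite A. field. split; [exact B|now apply Cpow_nz, neq_sub].
- intros z Hz. split; [|apply pole_fun_period]. apply pole_fun_hol. intros n ->. apply Hz, lattice_Z.
Qed.

Lemma pole_fun_simple_pole : exists s : C -> C, holomorphic_at s 0 /\ s 0 <> 0 /\ near 0 (fun z => expi z - 1 = z * s z).
Proof.
assert (He : holomorphic_at expi 0).
{ apply (hol_of_cder expi (fun w => two_pi_i * expi w)), filter_forall. intros; apply expi_cder. }
destruct (hol_factor expi 0 He) as (s & S1 & S2). exists s. split; [exact S1|]. split.
- assert (D : cder expi 0 (s 0)).
  { apply (cder_ext_loc (fun z => expi 0 + (z - 0) * s z)).
    - revert S2. apply near_imp. intros w Hw. now symmetry.
    - eapply cder_eq.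
      + apply cder_plus; [apply cder_const|]. apply cder_mult; [|now apply hol_cder].
        apply cder_minus; [apply cder_id|apply cder_const].
      + simpl. ring. }
  rewrite (cder_unique _ _ _ _ D (expi_cder 0)), expi_0, Cmult_1_r. apply two_pi_i_neq_0.
- revert S2. apply near_imp. intros w Hw. rewrite Hw, expi_0. ring.
Qed.

Variables (g : C -> C) (j : nat).
Hypothesis Hg : SK_nice j g.

(** [R x] is the change of the convolution integral when the contour moves across the
    point [x], that is, the residue of [f (x - z) * g z] there, up to a constant
    factor. *)
Definition crossing (f R : C -> C) : Prop := forall x w w' : C, (0 < Im x < Im tau)%R ->
  (0 < Im w' < Im x)%R -> (Im x < Im w < Im tau)%R -> conv_line f g w x = conv_line f g w' x + R x.

Definition crosses (f : C -> C) : Prop := exists R, SK_nice j R /\ crossing f R.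

Lemma tame_on_line (f : C -> C) (w x : C) : tame f -> (0 < Im x < Im tau)%R -> (0 < Im w < Im tau)%R ->
  Im w <> Im x -> on_line f g w x.
Proof.
intros [_ Hf] Hx Hw Hn t _. split.
- apply hol_ccont, Hf, not_lattice_strip; rewrite Im_line; lra.
- apply hol_ccont, (proj2 (proj1 Hg)), not_lattice_strip; rewrite Im_plus_R; lra.
Qed.

Lemma crosses_lin (p q : C) (f1 f2 : C -> C) : tame f1 -> tame f2 -> crosses f1 -> crosses f2 ->
  crosses (fun z => p * f1 z + q * f2 z).
Proof.
intros P1 P2 (R1 & N1 & K1) (R2 & N2 & K2).
exists (fun z => p * R1 z + q * R2 z). split.
- generalize (SK_nice_lin j j p q R1 R2 N1 N2). now rewrite Nat.max_id.
- intros x w w' Hx Hw' Hw. rewrite !conv_line_lin_l by (apply tame_on_line; trivial; lra).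
  rewrite (K1 x w w'), (K2 x w w') by assumption. ring.
Qed.

(** The residue term of the derivative is the derivative of the residue term, because
    both contours may be differentiated in [x]. *)
Lemma crosses_derive (f : C -> C) : tame f -> crosses f -> crosses (C_derive f).
Proof.
intros Pf (R & N & K). exists (C_derive R). split; [now apply SK_nice_derive|].
intros x w w' Hx Hw' Hw.
assert (D : forall v, (0 < Im v < Im tau)%R -> Im v <> Im x -> cder (conv_line f g v) x (conv_line (C_derive f) g v x)).
{ intros v Hv Hn. apply conv_line_cder; intros t.
  - apply Pf, not_lattice_strip; rewrite Im_line; lra.
  - apply hol_ccont, (proj2 (proj1 Hg)), not_lattice_strip; rewrite Im_plus_R; lra. }
apply (cder_unique (conv_line f g w) x); [apply D; lra|].
apply (cder_ext_loc (fun y => conv_line f g w' y + R y)).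
- generalize (near_Im x (Im w') (Im w) ltac:(lra)). apply near_imp. intros y Hy. symmetry. apply K; lra.
- apply cder_plus; [apply D; lra|]. apply hol_cder, N, not_lattice_strip; lra.
Qed.

Lemma crosses_regular (f : C -> C) : tame f -> regular_at f 0 -> crosses f.
Proof.
intros Pf (h & H1 & H2). exists (fun _ => RtoC 0). split.
- split; [|intros z _; apply iter_Delta_zero]. split; [intros z; apply meromorphic_const|].
  intros z _. split; [apply hol_const|reflexivity].
- intros x w w' Hx Hw' Hw. rewrite Cplus_0_r.
  assert (Hgx : forall z, (0 < Im z < Im tau)%R -> holomorphic_at g z /\ g (z + 1) = g z).
  { intros z Hz. apply (proj2 (proj1 Hg)), not_lattice_strip; lra. }
  apply (line_int_across _ x 0 (Im tau)); try lra.
  + intros z Hz Hn. destruct (Hgx z Hz) as [G1 G2].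
    assert (Nz : ~ L (x - z)).
    { intros Hl. destruct (lattice_small _ Hl) as [n E]; [rewrite Im_minus; lra|].
      apply (Hn (- n)%Z). rewrite opp_IZR, RtoC_opp, <- E. ring. }
    assert (Nz' : ~ L (x - z + - (1))) by (apply not_lattice_shift; [apply lattice_opp, lattice_1|exact Nz]).
    destruct (proj2 Pf _ Nz) as [F1 _]. destruct (proj2 Pf _ Nz') as [_ F2]. split.
    * apply hol_mult; [|exact G1]. apply (hol_comp f (fun z => x - z)); [exact F1|].
      apply hol_minus; [apply hol_const|apply hol_id].
    * rewrite G2. f_equal. replace (x - (z + 1)) with (x - z + - (1)) by ring. rewrite <- F2. f_equal. ring.
  + exists (fun z => h (x - z) * g z). split.
    * apply hol_mult; [|apply Hgx, Hx]. apply (hol_comp h (fun z => x - z)).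
      { replace (x - x) with (RtoC 0) by ring. exact H1. }
      apply hol_minus; [apply hol_const|apply hol_id].
    * apply locally'_Cmod in H2. destruct H2 as (d & Hd & H2). apply locally'_Cmod.
      exists d. split; [exact Hd|]. intros z Hz Hne. f_equal. apply H2.
      { replace (x - z - 0) with (- (z - x)) by ring. now rewrite Cmod_opp. }
      intros E. apply Hne. replace z with (x - (x - z)) by ring. rewrite E. ring.
Qed.

Lemma pole_fun_line_integral (x w : C) : (- Im tau < Im x - Im w < Im tau)%R -> Im w <> Im x ->
  CInt (fun t => pole_fun (x - (w + RtoC t))) =
  line_int (fun z => pole_fun (- z)) (0, if Rlt_dec (Im x) (Im w) then Im tau / 2 else - (Im tau / 2))%R.
Proof.
intros H1 H2.
transitivity (line_int (fun z => pole_fun (- z)) (w - x)).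
{ apply CInt_ext. intros t _. f_equal. ring. }
assert (S : forall a b, (a = 0 /\ b = Im tau \/ a = - Im tau /\ b = 0)%R -> strip (fun z => pole_fun (- z)) a b).
{ intros a b Hab z Hz. split.
  - apply (hol_comp pole_fun (fun z => - z)).
    + apply (proj2 pole_fun_tame), not_lattice_strip; rewrite im_opp; lra.
    + apply (hol_ext (fun z => 0 - z)); [apply filter_forall; intros; ring|].
      apply hol_minus; [apply hol_const|apply hol_id].
  - rewrite <- pole_fun_period. f_equal. ring. }
destruct (Rlt_dec (Im x) (Im w)).
- apply (line_int_const _ 0 (Im tau)); [apply S; now left| |]; rewrite ?Im_minus; unfold Im in *; simpl; lra.
- apply (line_int_const _ (- Im tau) 0); [apply S; now right| |]; rewrite ?Im_minus; unfold Im in *; simpl; lra.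
Qed.

(** The function [pole_fun (x - z) * (g z - g x)] is regular at [z = x], so it
    contributes nothing. What remains is [g x] times the change of the integral of
    [pole_fun] between the two sides of the real axis. This change is a constant,
    [kp - km]. *)
Lemma crosses_pole_fun : crosses pole_fun.
Proof.
set (kp := line_int (fun z => pole_fun (- z)) (0, Im tau / 2)%R).
set (km := line_int (fun z => pole_fun (- z)) (0, - (Im tau / 2))%R).
exists (fun z => (kp - km) * g z + 0 * g z). split.
{ generalize (SK_nice_lin j j (kp - km) 0 g g Hg Hg). now rewrite Nat.max_id. }
intros x w w' Hx Hw' Hw.
assert (Hgx : forall z, (0 < Im z < Im tau)%R -> holomorphic_at g z /\ g (z + 1) = g z).
{ intros z Hz. apply (proj2 (proj1 Hg)), not_lattice_strip; lra. }
assert (Dec : forall v, (0 < Im v < Im tau)%R -> Im v <> Im x ->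
   conv_line pole_fun g v x = line_int (fun z => pole_fun (x - z) * (g z - g x)) v + g x * CInt (fun t => pole_fun (x - (v + RtoC t)))).
{ intros v Hv Hn.
  assert (Cu : cont01 (fun t => pole_fun (x - (v + RtoC t)))).
  { apply (cont01_line (fun z => pole_fun (x - z))). intros t _. apply (ccont_comp pole_fun (fun z => x - z)).
    - apply ccont_minus; [apply ccont_const|apply continuous_id].
    - apply hol_ccont, (proj2 pole_fun_tame), not_lattice_strip; rewrite Im_line; lra. }
  assert (Cg : cont01 (fun t => g (v + RtoC t))).
  { apply cont01_line. intros t _. apply hol_ccont, Hgx. rewrite Im_plus_R; lra. }
  rewrite <- CInt_scal by exact Cu. unfold conv_line, line_int. rewrite <- CInt_plus.
  - apply CInt_ext. intros t _. ring.
  - intros t Ht. apply ccont_mult; [now apply Cu|]. apply ccont_minus; [now apply Cg|apply ccont_const].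
  - intros t Ht. apply ccont_mult; [apply ccont_const|now apply Cu]. }
rewrite !Dec by lra.
rewrite !pole_fun_line_integral by lra.
destruct (Rlt_dec (Im x) (Im w)); [|lra]. destruct (Rlt_dec (Im x) (Im w')); [lra|].
fold kp km.
rewrite (line_int_across (fun z => pole_fun (x - z) * (g z - g x)) x 0 (Im tau) w w'); try lra; [ring| |].
- intros z Hz Hn. destruct (Hgx z Hz) as [G1 G2]. split.
  + apply hol_mult; [|apply hol_minus; [exact G1|apply hol_const]].
    apply (hol_comp pole_fun (fun z => x - z)).
    * apply pole_fun_hol. intros k E. apply (Hn (- k)%Z). rewrite opp_IZR, RtoC_opp, <- E. ring.
    * apply hol_minus; [apply hol_const|apply hol_id].
  + rewrite G2. f_equal. rewrite <- pole_fun_period. f_equal. ring.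
- destruct pole_fun_simple_pole as (s & S1 & S2 & S3).
  destruct (hol_factor g x (proj1 (Hgx x Hx))) as (q & Q1 & Q2).
  assert (Hs : holomorphic_at (fun z => s (x - z)) x).
  { apply (hol_comp s (fun z => x - z)).
    - replace (x - x) with (RtoC 0) by ring. exact S1.
    - apply hol_minus; [apply hol_const|apply hol_id]. }
  exists (fun z => - (1) * q z * / s (x - z)). split.
  + apply hol_mult.
    * apply hol_mult; [apply hol_const|exact Q1].
    * apply (hol_inv (fun z => s (x - z))); [exact Hs|]. replace (x - x) with (RtoC 0) by ring. exact S2.
  + assert (Cx : ccont (fun z : C_UniformSpace => x - z) x) by (apply ccont_minus; [apply ccont_const|apply continuous_id]).
    assert (Z : x - x = 0) by ring.
    assert (N1 : near x (fun z => expi (x - z) - 1 = (x - z) * s (x - z))).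
    { apply (Cx (fun y => expi y - 1 = y * s y)). rewrite Z. exact S3. }
    assert (N2 : near x (fun z => s (x - z) <> 0)).
    { apply (Cx (fun y => s y <> 0)). rewrite Z. exact (hol_ccont s 0 S1 _ (locally_neq_0 _ S2)). }
    generalize (near'_and _ _ _ (near_near' _ _ Q2) (near'_and _ _ _ (near_near' _ _ N1) (near_near' _ _ N2))).
    apply near'_imp. intros z Hz (A & B & D). unfold pole_fun. rewrite B, A. field. split; [exact D|].
    apply neq_sub. congruence.
Qed.

(** Differentiating [v z / z ^ (n + 1)] gives a pole of order [n + 2] whose leading
    coefficient is [- (n + 1) * v 0]. *)
Lemma pole_fun_derivative_pole (n : nat) : tame (Nat.iter n C_derive pole_fun) /\ crosses (Nat.iter n C_derive pole_fun) /\
  exists v, holomorphic_at v 0 /\ v 0 <> 0 /\ near' 0 (fun z => (z - 0) ^ S n * Nat.iter n C_derive pole_fun z = v z).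
Proof.
induction n as [|n (IH1 & IH2 & v & V1 & V2 & V3)].
- simpl Nat.iter. split; [apply pole_fun_tame|]. split; [apply crosses_pole_fun|].
  destruct pole_fun_simple_pole as (s & S1 & S2 & S3). exists (fun z => / s z). split; [now apply hol_inv|]. split.
  + intros K. apply C1_nz. rewrite <- (Cinv_r (s 0)) by exact S2. rewrite K. ring.
  + generalize (near'_and _ _ _ (near_near' _ _ S3) (near_near' _ _ (hol_ccont s 0 S1 _ (locally_neq_0 _ S2)))).
    apply near'_imp. intros z Hz [A B]. unfold pole_fun. rewrite A. simpl Cpow. field. now split.
- simpl Nat.iter. split; [now apply tame_derive|]. split; [now apply crosses_derive|].
  set (U := Nat.iter n C_derive pole_fun) in *.
  exists (fun z => z * C_derive v z - RtoC (INR (S n)) * v z). split.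
  { apply hol_minus; apply hol_mult; trivial; [apply hol_id|now apply hol_derive|apply hol_const]. }
  split.
  { intros K. apply (Cmult_neq_0 (RtoC (INR (S n))) (v 0)); [|exact V2|].
    - intros E. apply RtoC_inj in E. now apply not_0_INR in E.
    - replace (RtoC (INR (S n)) * v 0) with (- (0 * C_derive v 0 - RtoC (INR (S n)) * v 0)) by ring. rewrite K. ring. }
  generalize (near'_and _ _ _ (near'_near _ _ V3) (near'_and _ _ _ (near_near' _ _ (hol_near v 0 V1)) (lattice_near' 0))).
  apply near'_imp. intros z Hz (A & B & D).
  assert (HU : cder U z (C_derive U z)) by (apply hol_cder, (proj2 IH1), D).
  assert (E : cder (fun z => (z - 0) ^ S n * U z) z (C_derive v z)).
  { apply (cder_ext_loc v); [|now apply hol_cder]. revert A. apply near_imp. intros y Hy. now symmetry. }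
  assert (F : cder (fun z => (z - 0) ^ S n * U z) z (RtoC (INR (S n)) * (z - 0) ^ n * (1 - 0) * U z + (z - 0) ^ S n * C_derive U z)).
  { apply cder_mult; [|exact HU]. apply (cder_pow (fun z => z - 0)). apply cder_minus; [apply cder_id|apply cder_const]. }
  assert (G := cder_unique _ _ _ _ E F).
  assert (A' : (z - 0) ^ S n * U z = v z) by exact (locally_singleton _ _ A).
  rewrite G, <- A'. simpl Cpow. ring.
Qed.

(** Induction on the order [n] of the pole at 0: subtract the multiple [c] of the
    derivative of [pole_fun] with the same leading coefficient. The residue term
    obtained in this way is a linear combination of derivatives of [g], so it lies in
    SK. *)
Lemma crosses_tame (f : C -> C) : tame f -> crosses f.
Proof.
intros Pf. destruct (proj1 Pf 0) as [n Hn]. revert f Pf Hn.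
induction n as [|n IH]; intros f Pf Hn.
{ apply crosses_regular; [exact Pf|]. revert Hn. apply regular_ext, near'_forall. intros w. simpl. ring. }
destruct Hn as (h & H1 & H2).
destruct (pole_fun_derivative_pole n) as (U1 & U2 & v & V1 & V2 & V3).
set (U := Nat.iter n C_derive pole_fun) in *.
(* the quotient of the leading coefficients of f and U at 0 *)
set (c := h 0 / v 0).
set (f1 := fun z => 1 * f z + - c * U z).
assert (P1 : tame f1) by now apply tame_lin.
assert (X : crosses f1).
{ apply IH; [exact P1|].
  destruct (hol_factor (fun z => h z - c * v z) 0) as (q & Q1 & Q2).
  { apply hol_minus; [exact H1|]. apply hol_mult; [apply hol_const|exact V1]. }
  exists q. split; [exact Q1|].
  generalize (near'_and _ _ _ H2 (near'_and _ _ _ V3 (near_near' _ _ Q2))). apply near'_imp.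
  intros z Hz (A & B & D).
  assert (E : h 0 - c * v 0 = 0) by (unfold c; field; exact V2).
  rewrite E, <- A, <- B in D. unfold f1.
  assert (Hz' : z - 0 <> 0) by now apply neq_sub.
  replace ((z - 0) ^ n * (1 * f z + - c * U z)) with (((z - 0) ^ S n * f z - c * ((z - 0) ^ S n * U z)) / (z - 0)).
  - rewrite D. field. exact Hz.
  - simpl Cpow. field. exact Hz. }
assert (Y := crosses_lin 1 c f1 U P1 U1 X U2).
destruct Y as (R & N & K). exists R. split; [exact N|].
intros x w w' Hx Hw' Hw.
assert (E : forall y, conv_line f g y x = conv_line (fun z => 1 * f1 z + c * U z) g y x).
{ intros y. apply CInt_ext. intros t _. unfold f1. f_equal. ring. }
rewrite !E. now apply K.
Qed.

End Lattice.

(** * Analytic continuation of the convolution *)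

Lemma ccont2_of_ccont (phi : R -> R -> C) :
  (forall p : R * R, ccont (fun p : R * R => phi (fst p) (snd p)) p) -> ccont2 phi.
Proof.
intros H s t eps He. destruct (proj1 (ccont_eps _ _) (H (s, t)) eps He) as [d Hd].
exists d. split; [apply cond_pos|]. intros s' t' Hs Ht. apply (Hd (s', t')). now split.
Qed.

Section Continuation.
Variable tau : C.
Hypothesis Htau : (0 < Im tau)%R.
Let T := Im tau.

Section Extension.
Variables (F E : C -> C) (m : nat).
Hypothesis HF : strip F 0 (2 * T).
Hypothesis HE : SK_nice tau m E.
Hypothesis Hstep : forall x : C, (0 < Im x < T)%R -> F (x + tau) = F x + E x.

Definition ntau (n : Z) : C := RtoC (IZR n) * tau.

Fixpoint sum_up (n : nat) (x : C) : C :=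
  match n with O => 0 | S k => sum_up k x + E (x + ntau (- Z.of_nat (S k))) end.
Fixpoint sum_down (n : nat) (x : C) : C :=
  match n with O => 0 | S k => sum_down k x - E (x + ntau (Z.of_nat k)) end.
(** The sum of [E (x - k tau)] for [1 <= k <= n], or minus the sum of [E (x + k tau)]
    for [0 <= k < - n] when [n] is negative: the difference of a solution of
    [Delta H = E] between [x] and [x - n tau]. *)
Definition sum_shifts (n : Z) (x : C) : C := sum_up (Z.to_nat n) x + sum_down (Z.to_nat (- n)) x.

Lemma sum_shifts_succ (n : Z) (x : C) : sum_shifts (n + 1) x = sum_shifts n x + E (x + ntau (- (n + 1))).
Proof.
unfold sum_shifts. destruct (Z_le_gt_dec 0 n) as [Hn|Hn].
- replace (Z.to_nat (- (n + 1))) with 0%nat by lia. replace (Z.to_nat (- n)) with 0%nat by lia.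
  replace (Z.to_nat (n + 1)) with (S (Z.to_nat n)) by lia. cbn [sum_up sum_down].
  replace (Z.of_nat (S (Z.to_nat n))) with (n + 1)%Z by lia. ring.
- replace (Z.to_nat (n + 1)) with 0%nat by lia. replace (Z.to_nat n) with 0%nat by lia.
  replace (Z.to_nat (- n)) with (S (Z.to_nat (- (n + 1)))) by lia. cbn [sum_up sum_down].
  replace (Z.of_nat (Z.to_nat (- (n + 1)))) with (- (n + 1))%Z by lia. ring.
Qed.

Lemma lattice_ntau (n : Z) : in_lattice tau (ntau n).
Proof. exists 0%Z, n. unfold ntau. ring. Qed.

Lemma tame_zero : tame tau (fun _ => RtoC 0).
Proof. split; [intros z; apply meromorphic_const|]. intros z _. split; [apply hol_const|reflexivity]. Qed.

Lemma tame_ext (f g : C -> C) : (forall z, f z = g z) -> tame tau f -> tame tau g.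
Proof.
intros H [F1 F2]. split.
- intros z. apply (meromorphic_ext f); [now apply near'_forall|apply F1].
- intros z Hz. destruct (F2 z Hz) as [A B]. split; [apply (hol_ext f); [now apply filter_forall|exact A]|].
  now rewrite <- !H.
Qed.

Lemma tame_sum_shifts (n : Z) : tame tau (sum_shifts n).
Proof.
assert (PE : forall c, in_lattice tau c -> tame tau (fun x => E (x + c))).
{ intros c Hc. apply tame_shift; [exact Hc|apply HE]. }
assert (U : forall k, tame tau (sum_up k)).
{ induction k as [|k IH]; [exact tame_zero|]. cbn [sum_up].
  apply (tame_ext (fun x => 1 * sum_up k x + 1 * E (x + ntau (- Z.of_nat (S k))))); [intros; ring|].
  apply tame_lin; [exact IH|apply PE, lattice_ntau]. }
assert (D : forall k, tame tau (sum_down k)).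
{ induction k as [|k IH]; [exact tame_zero|]. cbn [sum_down].
  apply (tame_ext (fun x => 1 * sum_down k x + - (1) * E (x + ntau (Z.of_nat k)))); [intros; ring|].
  apply tame_lin; [exact IH|apply PE, lattice_ntau]. }
apply (tame_ext (fun x => 1 * sum_up (Z.to_nat n) x + 1 * sum_down (Z.to_nat (- n)) x)); [intros; unfold sum_shifts; ring|].
now apply tame_lin.
Qed.

(** Rounding [- (Im x / T)] upwards, and not [Im x / T], makes the interval in
    [level_spec] open at 0 and closed at [T], so that it lies in the domain of [F]. *)
Definition level (x : C) : Z := (- up (- (Im x / T)))%Z.
Definition continuation (x : C) : C := F (x + ntau (- level x)) + sum_shifts (level x) x.

Lemma Im_ntau (x : C) (n : Z) : Im (x + ntau (- n)) = (Im x - IZR n * T)%R.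
Proof. rewrite im_plus. unfold ntau. rewrite im_scal_l, opp_IZR. unfold T. ring. Qed.

Lemma level_spec (x : C) : (0 < Im x - IZR (level x) * T <= T)%R.
Proof.
unfold level. rewrite opp_IZR. destruct (archimed (- (Im x / T))) as [A B].
set (k := IZR (up (- (Im x / T)))) in *.
assert (E1 : Im x = (Im x / T * T)%R) by (field; unfold T; lra).
assert (HT : (0 < T)) by exact Htau. nra.
Qed.

(** The strips of height [2 * T] overlap, so near every point, including those on the
    lines separating the levels, a single holomorphic translate of [F] can be used. *)
Lemma continuation_eq (n : Z) (x : C) : (0 < Im x - IZR n * T < 2 * T)%R ->
  continuation x = F (x + ntau (- n)) + sum_shifts n x.
Proof.
intros Hn. assert (L := level_spec x). unfold continuation.
assert (HT : (0 < T)) by exact Htau.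
assert (K : ((-1) < IZR (level x - n) < 2)%R) by (rewrite minus_IZR; split; apply Rmult_lt_reg_r with T; lra).
assert (K' : (-1 < level x - n < 2)%Z) by (split; apply lt_IZR; lra).
(* the only two levels whose strips of height 2 * T contain x *)
assert (C0 : level x = n \/ level x = (n + 1)%Z) by lia.
destruct C0 as [-> | E1]; [reflexivity|].
rewrite E1 in *. rewrite plus_IZR in L.
rewrite sum_shifts_succ.
replace (x + ntau (- n)) with (x + ntau (- (n + 1)) + tau).
- rewrite Hstep; [ring|]. rewrite Im_ntau, plus_IZR. lra.
- unfold ntau. rewrite !opp_IZR, plus_IZR, !RtoC_opp, RtoC_plus. ring.
Qed.

Lemma continuation_on_strip (x : C) : (0 < Im x < 2 * T)%R -> continuation x = F x.
Proof.
intros Hx. rewrite (continuation_eq 0) by lra. unfold sum_shifts. simpl.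
replace (x + ntau 0) with x by (unfold ntau; ring). ring.
Qed.

Lemma continuation_near (x : C) : near x (fun y => continuation y =
   F (y + ntau (- level x)) + sum_shifts (level x) y) /\ holomorphic_at (fun y => F (y + ntau (- level x))) x.
Proof.
assert (L := level_spec x). assert (HT : (0 < T)) by exact Htau.
split.
- generalize (near_Im x (IZR (level x) * T) (IZR (level x) * T + 2 * T) ltac:(lra)). apply near_imp.
  intros y Hy. apply continuation_eq. lra.
- apply hol_shift, HF. rewrite Im_ntau. lra.
Qed.

Lemma continuation_tame : tame tau continuation.
Proof.
split.
- intros x. destruct (continuation_near x) as [A B].
  apply (meromorphic_ext (fun y => F (y + ntau (- level x)) + sum_shifts (level x) y)).
  + apply near_near'. revert A. apply near_imp. intros; now symmetry.
  + apply meromorphic_plus; [now apply regular_meromorphic, hol_regular|apply tame_sum_shifts].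
- intros x Hx. destruct (continuation_near x) as [A B]. split.
  + apply (hol_ext (fun y => F (y + ntau (- level x)) + sum_shifts (level x) y)).
    * revert A. apply near_imp. intros; now symmetry.
    * apply hol_plus; [exact B|]. now apply tame_sum_shifts.
  + assert (L := level_spec x). assert (HT : (0 < T)) by exact Htau.
    rewrite (continuation_eq (level x) (x + 1)) by (rewrite Im_plus_R; lra).
    rewrite (continuation_eq (level x) x) by lra. f_equal.
    * replace (x + 1 + ntau (- level x)) with (x + ntau (- level x) + 1) by ring.
      apply HF. rewrite Im_ntau. lra.
    * now apply (proj2 (tame_sum_shifts (level x))).
Qed.

(** [Delta] of the continuation is [E]: this holds for [0 < Im x < T] by assumption, and
    everywhere else by the identity theorem. *)
Lemma continuation_SK_nice : SK_nice tau (S m) continuation.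
Proof.
split; [exact continuation_tame|]. intros z Hz.
rewrite Nat.iter_succ_r. rewrite <- (proj2 HE z Hz).
apply (iter_Delta_ext tau); [|exact Hz]. clear z Hz. intros z Hz.
assert (HT : (0 < T)) by exact Htau.
apply (eq_of_meq (Delta tau continuation) E).
- apply (meromorphic_strip_eq _ _ T HT); [apply (Delta_tame tau), continuation_tame|apply HE|].
  intros x Hx. unfold Delta. rewrite !continuation_on_strip, Hstep; [ring|exact Hx|lra|].
  rewrite im_plus. fold T. lra.
- apply (proj2 (Delta_tame tau _ continuation_tame) z Hz).
- apply (proj2 (proj1 HE) z Hz).
Qed.
End Extension.

Lemma strip_conv_integral (f g : C -> C) : strip f 0 T -> strip g 0 T -> strip (conv_integral f g) 0 (2 * T).
Proof.
intros Hf Hg. assert (HT : (0 < T)) by exact Htau.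
assert (K := strip_conv_at (/ 2) T T f g HT HT ltac:(lra) Hf Hg).
intros z Hz. destruct (K z ltac:(lra)) as [A B]. split.
- revert A. apply hol_ext, filter_forall. intros w. symmetry. apply conv_integral_conv_line.
- now rewrite !conv_integral_conv_line.
Qed.

Lemma conv_integral_at (f g : C -> C) (w x : C) : strip f 0 T -> strip g 0 T ->
  (0 < Im w < T)%R -> (0 < Im x - Im w < T)%R -> conv_integral f g x = conv_line f g w x.
Proof.
intros Hf Hg H1 H2. rewrite conv_integral_conv_line. unfold conv_at.
apply (conv_line_indep f g 0 T 0 T); trivial; unfold Im in *; simpl; lra.
Qed.

(** For [x + tau] the contour has to lie above [x]. Shifting the argument of [f] by
    [tau] and moving the contour below [x] produces the residue term [R], and the
    shifted [f] is [f] plus [Delta f]. *)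
Lemma conv_integral_step (f g R : C -> C) (x : C) :
  tame tau f -> tame tau g -> crossing tau g (fun z => f (z + tau)) R -> (0 < Im x < T)%R ->
  conv_integral f g (x + tau) = conv_integral f g x + (conv_integral (Delta tau f) g x + R x).
Proof.
intros Pf Pg HR Hx.
assert (Sf : strip f 0 T) by now apply (tame_strip tau Htau).
assert (Sg : strip g 0 T) by now apply (tame_strip tau Htau).
assert (SD : strip (Delta tau f) 0 T) by now apply (tame_strip tau Htau), Delta_tame.
(* one contour above and one below the point x *)
set (w := (0, (Im x + T) / 2)%R : C). set (w' := (0, Im x / 2)%R : C).
assert (Iw : Im w = ((Im x + T) / 2)%R) by reflexivity.
assert (Iw' : Im w' = (Im x / 2)%R) by reflexivity.
rewrite (conv_integral_at f g w (x + tau)); trivial; [|lra|rewrite im_plus; fold T; lra].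
rewrite (conv_integral_at f g w' x), (conv_integral_at (Delta tau f) g w' x) by (trivial; lra).
transitivity (conv_line (fun z => f (z + tau)) g w x).
{ apply CInt_ext. intros t _. do 2 f_equal. ring. }
rewrite (HR x w w') by (unfold T in *; lra).
rewrite Cplus_assoc. f_equal.
transitivity (conv_line (fun z => 1 * f z + 1 * Delta tau f z) g w' x).
{ apply CInt_ext. intros t _. f_equal. unfold Delta. ring. }
rewrite conv_line_lin_l; [ring| |]; apply (strip_on_line _ _ 0 T 0 T); trivial; lra.
Qed.

(** Induction on the number [k] of applications of [Delta] that annihilate [f]: the
    difference of the convolution under translation by [tau] is the convolution of
    [Delta f] with [g], plus a residue term. Both are in SK, so the translates of the
    integral extend it to the whole plane. *)
Lemma conv_continuation (k j : nat) (f g : C -> C) : SK_nice tau k f -> SK_nice tau j g ->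
  exists (H : C -> C) (m : nat), SK_nice tau m H /\
    forall x, (0 < Im x < 2 * T)%R -> H x = conv_integral f g x.
Proof.
revert f. induction k as [|k IH]; intros f Hf Hg.
- exists (fun _ => RtoC 0), 0%nat. split; [split; [apply tame_zero|reflexivity]|].
  intros x Hx. rewrite conv_integral_conv_line. symmetry.
  transitivity (CInt (fun _ => 0)); [|apply CInt_const]. apply CInt_ext. intros t _.
  assert (Z := proj2 Hf). simpl in Z. rewrite Z; [ring|].
  apply (not_lattice_strip tau Htau); rewrite Im_line; unfold T, Im in *; simpl; lra.
- destruct (IH (Delta tau f) (SK_nice_Delta tau k f Hf) Hg) as (H1 & m & N1 & K1).
  destruct (crosses_tame tau Htau g j Hg (fun z => f (z + tau))) as (R & NR & KR).
  { apply tame_shift; [apply lattice_tau|apply Hf]. }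
  assert (NE := SK_nice_lin tau _ _ 1 1 H1 R N1 NR).
  set (E := fun z => 1 * H1 z + 1 * R z) in *.
  set (F := conv_integral f g).
  assert (HF : strip F 0 (2 * T)).
  { apply strip_conv_integral; apply (tame_strip tau Htau); [apply Hf|apply Hg]. }
  assert (HS : forall x, (0 < Im x < T)%R -> F (x + tau) = F x + E x).
  { intros x Hx. unfold F. rewrite (conv_integral_step f g R); trivial; [|apply Hf|apply Hg].
    unfold E. rewrite (K1 x) by lra. ring. }
  exists (continuation F E), (S (Nat.max m j)). split.
  + now apply continuation_SK_nice.
  + intros x Hx. now apply (continuation_on_strip F E HS).
Qed.

(** * Elementary properties of the convolution *)

Lemma conv_exists (f g : C -> C) : SK tau f -> SK tau g -> exists (H : C -> C) (m : nat),
  SK_nice tau m H /\ is_conv tau f g H.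
Proof.
intros Hf Hg.
destruct (SK_normalise tau f Hf) as (f0 & k & Nf & Mf & _).
destruct (SK_normalise tau g Hg) as (g0 & j & Ng & Mg & _).
destruct (conv_continuation k j f0 g0 Nf Ng) as (H & m & NH & KH).
exists H, m. split; [exact NH|].
assert (S := SK_nice_SK tau Htau m H NH). split; [apply S|]. split; [apply S|].
intros x Hx. rewrite KH by exact Hx. symmetry.
apply (conv_integral_meq f f0 g g0 T); trivial; apply (tame_strip tau Htau); [apply Nf|apply Ng].
Qed.

Lemma is_conv_unique (f g h h' : C -> C) : is_conv tau f g h -> is_conv tau f g h' -> meq h h'.
Proof.
intros (A1 & A2 & A3) (B1 & B2 & B3).
apply (meromorphic_strip_eq _ _ (2 * T)); [unfold T; lra|exact A1|exact B1|].
intros x Hx. now rewrite A3, B3.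
Qed.

Lemma conv_spec (f g h : C -> C) : is_conv tau f g h -> is_conv tau f g (conv tau f g).
Proof. intros H. unfold conv. apply epsilon_spec. now exists h. Qed.

Lemma conv_is_conv (f g : C -> C) : SK tau f -> SK tau g -> is_conv tau f g (conv tau f g).
Proof. intros Hf Hg. destruct (conv_exists f g Hf Hg) as (H & m & _ & K). now apply (conv_spec f g H). Qed.

Lemma is_conv_eq_conv (f g h : C -> C) : is_conv tau f g h -> meq (conv tau f g) h.
Proof. intros H. apply (is_conv_unique f g); [now apply (conv_spec f g h)|exact H]. Qed.

Lemma is_conv_transfer (f g f' g' h : C -> C) :
  (forall x, (0 < Im x < 2 * T)%R -> conv_integral f g x = conv_integral f' g' x) ->
  is_conv tau f g h -> is_conv tau f' g' h.
Proof.
intros E (A & B & D). split; [exact A|]. split; [exact B|]. intros x Hx. rewrite D by exact Hx. now apply E.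
Qed.

Lemma conv_SK (f g : C -> C) : SK tau f -> SK tau g -> SK tau (conv tau f g).
Proof.
intros Hf Hg. destruct (conv_exists f g Hf Hg) as (H & m & N & K).
apply (SK_meq tau H); [apply meq_sym; now apply is_conv_eq_conv|now apply (SK_nice_SK tau Htau m)].
Qed.

Lemma SK_strip (f : C -> C) : SK tau f -> exists f0, strip f0 0 T /\ meq f f0.
Proof.
intros Hf. destruct (SK_normalise tau f Hf) as (f0 & k & N & M & _). exists f0. split; [|exact M].
apply (tame_strip tau Htau), N.
Qed.

Lemma conv_integral_lin_l (a b : C) (f g h : C -> C) (x : C) :
  strip f 0 T -> strip g 0 T -> strip h 0 T -> (0 < Im x < 2 * T)%R ->
  conv_integral (fun x => a * f x + b * g x) h x = a * conv_integral f h x + b * conv_integral g h x.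
Proof.
intros Hf Hg Hh Hx. rewrite !conv_integral_conv_line. unfold conv_at.
apply conv_line_lin_l; apply (strip_on_line _ _ 0 T 0 T); trivial; unfold Im in *; simpl; lra.
Qed.

Lemma conv_integral_comm (f g : C -> C) (x : C) : strip f 0 T -> strip g 0 T -> (0 < Im x < 2 * T)%R ->
  conv_integral f g x = conv_integral g f x.
Proof.
intros Hf Hg Hx. rewrite !conv_integral_conv_line. unfold conv_at.
apply (conv_line_comm f g 0 T 0 T); trivial; unfold Im in *; simpl; lra.
Qed.

Lemma strip_lin (a b : C) (f g : C -> C) (p q : R) : strip f p q -> strip g p q ->
  strip (fun x => a * f x + b * g x) p q.
Proof.
intros Hf Hg z Hz. destruct (Hf z Hz) as [A B]. destruct (Hg z Hz) as [D E]. split.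
- apply hol_plus; apply hol_mult; trivial; apply hol_const.
- now rewrite B, E.
Qed.

Lemma meq_lin (a b : C) (f f0 g g0 : C -> C) : meq f f0 -> meq g g0 ->
  meq (fun x => a * f x + b * g x) (fun x => a * f0 x + b * g0 x).
Proof.
intros H K z. generalize (near'_and _ _ _ (H z) (K z)). apply near'_imp. intros w _ [-> ->]. reflexivity.
Qed.

Lemma is_conv_lin (a b : C) (f g h H K : C -> C) : SK tau f -> SK tau g -> SK tau h ->
  is_conv tau f h H -> is_conv tau g h K ->
  is_conv tau (fun x => a * f x + b * g x) h (fun x => a * H x + b * K x).
Proof.
intros Hf Hg Hh (A1 & A2 & A3) (B1 & B2 & B3).
destruct (SK_strip f Hf) as (f0 & Sf & Mf). destruct (SK_strip g Hg) as (g0 & Sg & Mg).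
destruct (SK_strip h Hh) as (h0 & Sh & Mh).
split; [intros z; apply meromorphic_plus; now apply meromorphic_scal|].
split; [exact (meq_lin a b (fun x => H (x + 1)) H (fun x => K (x + 1)) K A2 B2)|].
intros x Hx. rewrite A3, B3 by exact Hx.
rewrite (conv_integral_meq f f0 h h0 T), (conv_integral_meq g g0 h h0 T) by trivial.
rewrite (conv_integral_meq _ (fun x => a * f0 x + b * g0 x) h h0 T); trivial.
- symmetry. now apply conv_integral_lin_l.
- now apply meq_lin.
- now apply strip_lin.
Qed.

Lemma is_conv_comm (f g f0 g0 h : C -> C) : strip f0 0 T -> strip g0 0 T -> meq f f0 -> meq g g0 ->
  is_conv tau f g h -> is_conv tau g f h.
Proof.
intros Sf Sg Mf Mg. apply is_conv_transfer. intros x Hx.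
rewrite (conv_integral_meq f f0 g g0 T), (conv_integral_meq g g0 f f0 T) by trivial.
now apply conv_integral_comm.
Qed.

(** * Associativity *)

(** The double integral over [z] and [y] of [f (x - z - y) * g y * h z], with both
    contours at the height of [w]. It computes both ways of bracketing a threefold
    convolution. *)
Definition triple (f g h : C -> C) (w x : C) : C :=
  CInt (fun t => CInt (fun s => f (x - (w + RtoC t) - (w + RtoC s)) * g (w + RtoC s) * h (w + RtoC t))).

Lemma Im_line2 (w x : C) (t s : R) : Im (x - (w + RtoC t) - (w + RtoC s)) = (Im x - Im w - Im w)%R.
Proof. now rewrite Im_line, Im_line. Qed.

Lemma triple_conv_line (f g h : C -> C) (w x : C) : strip f 0 T -> strip g 0 T ->
  (0 < Im w < T)%R -> (0 < Im x - Im w - Im w < T)%R ->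
  conv_line (conv_integral f g) h w x = triple f g h w x.
Proof.
intros Hf Hg H1 H2. apply CInt_ext. intros t _.
rewrite (conv_integral_at f g w) by (trivial; rewrite ?Im_line; lra).
rewrite Cmult_comm. unfold conv_line, line_int. rewrite <- CInt_scal.
- apply CInt_ext. intros s _. ring.
- apply on_line_cont01, (strip_on_line f g 0 T 0 T); trivial; rewrite Im_line; lra.
Qed.

Lemma triple_swap (f g h : C -> C) (w x : C) : strip f 0 T -> strip g 0 T -> strip h 0 T ->
  (0 < Im w < T)%R -> (0 < Im x - Im w - Im w < T)%R ->
  triple f g h w x = CInt (fun s => g (w + RtoC s) * conv_line f h w (x - (w + RtoC s))).
Proof.
intros Hf Hg Hh H1 H2. unfold triple.
rewrite CInt_Fubini.
- apply CInt_ext. intros s _. unfold conv_line, line_int. rewrite <- CInt_scal.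
  + apply CInt_ext. intros t _.
    replace (x - (w + RtoC s) - (w + RtoC t)) with (x - (w + RtoC t) - (w + RtoC s)) by ring. ring.
  + apply on_line_cont01, (strip_on_line f h 0 T 0 T); trivial; rewrite Im_line; lra.
- apply ccont2_of_ccont. intros [t s].
  assert (C1 : ccont (fun p : R * R => w + RtoC (fst p)) (t, s)).
  { apply ccont_plus; [apply ccont_const|apply ccont_RtoC, continuous_fst]. }
  assert (C2 : ccont (fun p : R * R => w + RtoC (snd p)) (t, s)).
  { apply ccont_plus; [apply ccont_const|apply ccont_RtoC, continuous_snd]. }
  apply ccont_mult; [apply ccont_mult|].
  + apply (ccont_comp f (fun p : R * R => x - (w + RtoC (fst p)) - (w + RtoC (snd p)))).
    * apply ccont_minus; [|exact C2]. apply ccont_minus; [apply ccont_const|exact C1].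
    * apply hol_ccont, Hf. rewrite Im_line2. exact H2.
  + apply (ccont_comp g (fun p : R * R => w + RtoC (snd p))); [exact C2|].
    apply hol_ccont, Hg. now rewrite Im_plus_R.
  + apply (ccont_comp h (fun p : R * R => w + RtoC (fst p))); [exact C1|].
    apply hol_ccont, Hh. now rewrite Im_plus_R.
Qed.

(** After exchanging the two integrals, the inner one is the convolution of [f] and [h],
    which is symmetric. *)
Lemma triple_sym (f g h : C -> C) (w x : C) : strip f 0 T -> strip g 0 T -> strip h 0 T ->
  (0 < Im w < T)%R -> (0 < Im x - Im w - Im w < T)%R -> triple f g h w x = triple h g f w x.
Proof.
intros Hf Hg Hh H1 H2. rewrite !triple_swap by trivial.
apply CInt_ext. intros s _. f_equal.
apply (conv_line_comm f h 0 T 0 T); trivial; rewrite Im_line; lra.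
Qed.

(** By commutativity the right-hand side is the convolution of the convolution of [h]
    and [g] with [f], so associativity is the symmetry of [triple] in its two outer
    arguments. It suffices to compare at [0 < Im x < T], where all three heights may be
    taken equal to [Im x / 3]. *)
Lemma conv_assoc (f g h : C -> C) : SK tau f -> SK tau g -> SK tau h ->
  meq (conv tau (conv tau f g) h) (conv tau f (conv tau g h)).
Proof.
intros Hf Hg Hh.
destruct (SK_strip f Hf) as (f0 & Sf & Mf). destruct (SK_strip g Hg) as (g0 & Sg & Mg).
destruct (SK_strip h Hh) as (h0 & Sh & Mh).
assert (HT : (0 < T)) by exact Htau.
destruct (conv_is_conv f g Hf Hg) as (_ & _ & FG).
destruct (conv_is_conv g h Hg Hh) as (_ & _ & GH).
destruct (conv_is_conv (conv tau f g) h (conv_SK f g Hf Hg) Hh) as (U1 & _ & U3).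
destruct (conv_is_conv f (conv tau g h) Hf (conv_SK g h Hg Hh)) as (V1 & _ & V3).
assert (Wide : forall F, strip F 0 (2 * T) -> strip F 0 T) by (intros F HF z Hz; apply HF; lra).
assert (L : forall p q p0 q0 r r0 (x : C), meq p p0 -> meq q q0 -> meq r r0 -> strip p0 0 T -> strip q0 0 T -> strip r0 0 T ->
   (forall x : C, (0 < Im x < 2 * T)%R -> conv tau p q x = conv_integral p q x) -> (0 < Im x < T)%R ->
   conv_integral (conv tau p q) r x = triple p0 q0 r0 (0, (Im x / 3)%R) x).
{ intros p q p0 q0 r r0 x Mp Mq Mr Sp Sq Sr K Hx.
  set (F := conv_integral p0 q0).
  assert (SF : strip F 0 (2 * T)) by now apply strip_conv_integral.
  transitivity (conv_integral F r x).
  { rewrite !conv_integral_conv_line. apply CInt_ext. intros t _. f_equal.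
    unfold F. rewrite <- (conv_integral_meq p p0 q q0 T); trivial; [apply K|]; rewrite Im_line; unfold Im in *; simpl; lra. }
  rewrite (conv_integral_meq F F r r0 T); trivial; [|intros z; now apply near'_forall|now apply Wide|lra].
  rewrite <- triple_conv_line; trivial; [|unfold Im in *; simpl; lra|unfold Im in *; simpl; lra].
  rewrite conv_integral_conv_line. apply (conv_line_indep F r0 0 (2 * T) 0 T); trivial; unfold Im in *; simpl; lra. }
apply (meromorphic_strip_eq _ _ T HT U1 V1). intros x Hx. rewrite U3, V3 by (fold T; lra).
rewrite (L f g f0 g0 h h0) by trivial.
destruct (conv_is_conv h g Hh Hg) as (_ & _ & HG).
destruct (SK_strip _ (conv_SK g h Hg Hh)) as (k0 & Sk & Mk).
transitivity (conv_integral (conv tau h g) f x).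
- rewrite (L h g h0 g0 f f0 x Mh Mg Mf Sh Sg Sf HG Hx).
  apply triple_sym; trivial; unfold Im in *; simpl; lra.
- transitivity (conv_integral (conv tau g h) f x).
  + rewrite !conv_integral_conv_line. apply CInt_ext. intros t _. f_equal.
    assert (B : (0 < Im (x - ((0, / 2 * Im x)%R + RtoC t)) < 2 * T)%R).
    { rewrite Im_line. unfold Im in *; simpl; lra. }
    rewrite HG, GH by exact B.
    rewrite (conv_integral_meq h h0 g g0 T), (conv_integral_meq g g0 h h0 T) by trivial.
    now apply conv_integral_comm.
  + rewrite (conv_integral_meq _ k0 f f0 T), (conv_integral_meq f f0 _ k0 T) by (trivial; lra).
    apply conv_integral_comm; trivial; lra.
Qed.

(** * Regularity *)

Lemma regular_strip (f : C -> C) (b : R) : SK tau f -> regular_on_strip f b ->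
  exists f0, strip f0 0 T /\ strip f0 0 b /\ meq f f0.
Proof.
intros Hf Hb. destruct (SK_normalise tau f Hf) as (f0 & k & N & M & K). exists f0.
split; [apply (tame_strip tau Htau), N|]. split; [|exact M].
intros z Hz. assert (A := K z (Hb z Hz)). split; [exact A|].
apply (eq_of_meq (fun z => f0 (z + 1)) f0).
- apply (SK_nice_SK tau Htau k f0 N).
- apply hol_shift, K, Hb. now rewrite Im_plus_R.
- exact A.
Qed.

(** On the larger strips a contour at height [B / (A + B) * Im x] gives a holomorphic
    function for [0 < Im x < A + B], which the identity theorem identifies with the
    convolution. *)
Lemma conv_regular (f g : C -> C) (A B : R) : SK tau f -> SK tau g -> (T <= A) -> (T <= B) ->
  regular_on_strip f A -> regular_on_strip g B -> regular_on_strip (conv tau f g) (A + B).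
Proof.
intros Hf Hg HA HB Rf Rg. assert (HT : (0 < T)) by exact Htau.
destruct (regular_strip f A Hf Rf) as (f0 & Sf & Sf' & Mf).
destruct (regular_strip g B Hg Rg) as (g0 & Sg & Sg' & Mg).
set (lam := (B / (A + B))%R).
assert (Hl : (lam * (A + B) = B)%R) by (unfold lam; field; lra).
assert (l01 : (0 < lam < 1)) by nra.
assert (SK0 := strip_conv_at lam A B f0 g0 ltac:(lra) ltac:(lra) Hl Sf' Sg').
set (K := conv_at lam f0 g0) in *.
destruct (conv_is_conv f g Hf Hg) as (M & _ & E).
assert (E' : forall x, (0 < Im x < 2 * T)%R -> conv tau f g x = K x).
{ intros x Hx. rewrite E by exact Hx. rewrite (conv_integral_meq f f0 g g0 T) by trivial.
  rewrite conv_integral_conv_line.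
  assert (0 < lam * Im x)%R by nra. assert (lam * Im x < Im x)%R by nra.
  assert (lam * Im x < B)%R by nra. assert (Im x - lam * Im x < A)%R.
  { assert ((1 - lam) * Im x < (1 - lam) * (A + B))%R by (apply Rmult_lt_compat_l; lra). lra. }
  unfold K, conv_at.
  apply (conv_line_indep f0 g0 0 A 0 B); trivial; unfold Im in *; simpl; lra. }
intros x Hx.
assert (Z : near' x (fun w => conv tau f g w - K w = 0)).
{ apply (identity_theorem (fun w => conv tau f g w - K w) (0, T)).
  - intros t Ht. apply meromorphic_minus; [apply M|].
    apply regular_meromorphic, hol_regular, SK0. rewrite Im_seg. apply convex_between; trivial.
    unfold Im; simpl; lra.
  - apply near_near'. assert (Q : (0 < Im (0, T) < 2 * T)%R) by (unfold Im; simpl; lra).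
    generalize (near_Im _ 0 (2 * T) Q). apply near_imp. intros w Hw. rewrite E' by exact Hw. ring. }
exists K. split; [now apply SK0|]. revert Z. apply near'_imp. intros w _ Hw. now apply Ceq_minus.
Qed.

(** Elements of SK have no poles on the open strip [0 < Im x < T]. *)
Lemma regular_on_first_strip (f : C -> C) (m : nat) : SK tau f -> regular_on_strip f (INR m * T) ->
  regular_on_strip f (INR (Nat.max m 1) * T).
Proof.
intros Hf H. destruct m as [|m]; [|now rewrite Nat.max_l by lia].
simpl Nat.max. destruct (SK_strip f Hf) as (f0 & S & M). intros x Hx. simpl in Hx.
exists f0. split; [apply S; lra|apply M].
Qed.
End Continuation.

Theorem theorem3 (tau : C) (Htau : (0 < Im tau)%R) :
  (* the product SK x SK -> SK is well defined *)
  (forall f g : C -> C, SK tau f -> SK tau g ->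
     is_conv tau f g (conv tau f g) /\
     (forall h : C -> C, is_conv tau f g h -> meq h (conv tau f g)) /\
     SK tau (conv tau f g)) /\
  (forall f f' g g' : C -> C, SK tau f -> SK tau f' -> SK tau g -> SK tau g' ->
     meq f f' -> meq g g' -> meq (conv tau f g) (conv tau f' g')) /\
  (* bilinearity *)
  (forall (a b : C) (f g h : C -> C), SK tau f -> SK tau g -> SK tau h ->
     meq (conv tau (fun x => a * f x + b * g x)%C h)
         (fun x => a * conv tau f h x + b * conv tau g h x)%C /\
     meq (conv tau h (fun x => a * f x + b * g x)%C)
         (fun x => a * conv tau h f x + b * conv tau h g x)%C) /\
  (* (1) commutativity *)
  (forall f g : C -> C, SK tau f -> SK tau g ->
     meq (conv tau f g) (conv tau g f)) /\
  (* (2) associativity *)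
  (forall f g h : C -> C, SK tau f -> SK tau g -> SK tau h ->
     meq (conv tau (conv tau f g) h) (conv tau f (conv tau g h))) /\
  (* (3) regularity *)
  (forall (f g : C -> C) (m n : nat), SK tau f -> SK tau g ->
     regular_on_strip f (INR m * Im tau) ->
     regular_on_strip g (INR n * Im tau) ->
     regular_on_strip (conv tau f g) (INR (m + n) * Im tau)).
Proof.
assert (Comm : forall f g h, SK tau f -> SK tau g -> is_conv tau f g h -> is_conv tau g f h).
{ intros f g h Hf Hg. destruct (SK_strip tau Htau f Hf) as (f0 & Sf & Mf).
  destruct (SK_strip tau Htau g Hg) as (g0 & Sg & Mg). now apply (is_conv_comm tau f g f0 g0). }
split; [|split; [|split; [|split; [|split]]]].
- intros f g Hf Hg. split; [now apply conv_is_conv|]. split; [|now apply conv_SK].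
  intros h Hh. apply meq_sym. now apply is_conv_eq_conv.
- intros f f' g g' Hf Hf' Hg Hg' Mf Mg. apply is_conv_eq_conv; [exact Htau|].
  apply (is_conv_transfer tau f' g'); [|now apply conv_is_conv].
  intros x Hx. destruct (SK_strip tau Htau f' Hf') as (f0 & Sf & Mf').
  destruct (SK_strip tau Htau g' Hg') as (g0 & Sg & Mg').
  rewrite (conv_integral_meq f' f0 g' g0 (Im tau)) by trivial. symmetry.
  apply (conv_integral_meq f f0 g g0 (Im tau)); trivial; eapply meq_trans; eassumption.
- intros a b f g h Hf Hg Hh. split; (apply is_conv_eq_conv; [exact Htau|]).
  + apply is_conv_lin; trivial; now apply conv_is_conv.
  + destruct (SK_strip tau Htau f Hf) as (f0 & Sf & Mf). destruct (SK_strip tau Htau g Hg) as (g0 & Sg & Mg).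
    destruct (SK_strip tau Htau h Hh) as (h0 & Sh & Mh).
    apply (is_conv_comm tau _ _ (fun x => a * f0 x + b * g0 x) h0); trivial.
    * now apply strip_lin.
    * now apply meq_lin.
    * apply is_conv_lin; trivial; apply Comm; trivial; now apply conv_is_conv.
- intros f g Hf Hg. apply is_conv_eq_conv; [exact Htau|]. apply Comm; trivial. now apply conv_is_conv.
- intros f g h. now apply conv_assoc.
- intros f g m n Hf Hg Rf Rg.
  apply (regular_on_first_strip tau Htau) in Rf; [|exact Hf]. apply (regular_on_first_strip tau Htau) in Rg; [|exact Hg].
  assert (Q : forall k, (Im tau <= INR (Nat.max k 1) * Im tau)%R).
  { intros k. assert (1 <= INR (Nat.max k 1))%R; [|nra].
    replace 1%R with (INR 1) by reflexivity. apply le_INR. lia. }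
  assert (K := conv_regular tau Htau f g _ _ Hf Hg (Q m) (Q n) Rf Rg).
  intros x Hx. apply K. split; [apply Hx|]. eapply Rlt_le_trans; [apply Hx|].
  rewrite <- Rmult_plus_distr_r, <- plus_INR. apply Rmult_le_compat_r; [lra|]. apply le_INR. lia.
Qed.
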